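(* Let $k$ be an algebraically closed field of arbitrary characteristic, $G$ a connected linear algebraic group over $k$, and $V$ a finite dimensional algebraic $G$-module of dimension $n>1$ with a fixed basis $e_1,\ldots,e_n$. Let $\rho_{i,j}$ ($1\le i,j\le n$) be the regular functions on $G$ such that $\rho(g)=(\rho_{i,j}(g))\in\operatorname{Mat}_{n,n}(k)$ is the matrix of $v\mapsto g\cdot v$ in this basis, i.e. $g\cdot\bigl(\sum_j\gamma_je_j\bigr)=\sum_i\bigl(\sum_j\rho_{i,j}(g)\gamma_j\bigr)e_i$. Let $d:=\deg\rho(G)$, the degree of the subvariety $\rho(G)$ of $\operatorname{Mat}_{n,n}(k)$. Fix $r,s\in\mathbb N$ and a dominant morphism $\iota\colon\mathbb A^{r,s}\to G$, and let $x_1,\ldots,x_{r+s}$ be the standard coordinate functions on $\mathbb A^{r,s}$, so that $\iota^*(\rho_{i,j})\in k[x_1,\ldots,x_{r+s},x_1^{-1},\ldots,x_r^{-1}]$. Let $a=\sum_i\alpha_ie_i$ and $b=\sum_i\beta_ie_i$ be points of $V$ such that $\beta_1\cdots\beta_n\neq 0$, $\dim G\cdot b<\dim V$, and the orbit $G\cdot b$ is nonzero and conic. For $p=1,\ldots,n$ let $$F_p:=\sum_{\substack{q_1,\ldots,q_n\in\mathbb N\\ q_1+\cdots+q_n\le 2d-2}}c_{p,q_1,\ldots,q_n}\,y_1^{q_1}\cdots y_n^{q_n},$$ where the $c_{p,q_1,\ldots,q_n}$ are independent indeterminates, and put $H(y_1,\ldots,y_n):=(y_1-\alpha_1)F_1+\cdots+(y_n-\alpha_n)F_n-1$.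 Substituting $y_i\mapsto\sum_{j=1}^n\beta_j\iota^*(\rho_{i,j})$ gives an expression $$H\Bigl(\sum_j\beta_j\iota^*(\rho_{1,j}),\ldots,\sum_j\beta_j\iota^*(\rho_{n,j})\Bigr)=\sum_{(i_1,\ldots,i_{r+s})\in M}\ell_{i_1,\ldots,i_{r+s}}\,x_1^{i_1}\cdots x_{r+s}^{i_{r+s}},$$ where $M\subset\mathbb Z^r\times\mathbb N^s$ is finite and each $\ell_{i_1,\ldots,i_{r+s}}$ is a polynomial of degree at most $1$ in the variables $c_{p,q_1,\ldots,q_n}$ with coefficients in $k$. Then the following are equivalent: (i) the closure of the orbit $G\cdot b$ in $V$ contains the orbit $G\cdot a$; (ii) the system of linear equations $\ell_{i_1,\ldots,i_{r+s}}=0$, $(i_1,\ldots,i_{r+s})\in M$, in the unknowns $c_{p,q_1,\ldots,q_n}$ is inconsistent over $k$.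
   Context: Topological terms refer to the Zariski topology; $\mathbb N$ is the set of nonnegative integers. $\mathbb A^{r,s}:=\{(\varepsilon_1,\ldots,\varepsilon_{r+s})\in\mathbb A^{r+s}\mid\varepsilon_1\cdots\varepsilon_r\neq0\}$, with coordinate functions $x_i(\varepsilon)=\varepsilon_i$; the monomials $x_1^{i_1}\cdots x_{r+s}^{i_{r+s}}$ with $i_1,\ldots,i_r\in\mathbb Z$, $i_{r+1},\ldots,i_{r+s}\in\mathbb N$ form a $k$-basis of $k[\mathbb A^{r,s}]$. The degree of a locally closed subset $Y\subseteq\mathbb A^l$ is the number of points in the intersection of $Y$ with an $(l-\dim Y)$-dimensional affine linear subvariety of $\mathbb A^l$ in general position. A subset of $V$ is conic if it is stable under multiplication by every nonzero scalar of $k$. *)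

(* Defs.v *)
From HB Require Import structures.
From mathcomp Require Import all_boot all_order all_algebra.
From mathcomp Require Import mpoly.
Set Implicit Arguments.
Unset Strict Implicit.
Unset Printing Implicit Defensive.
Import Order.TTheory GRing.Theory.
Local Open Scope ring_scope.

Section Zariski.
Variable k : fieldType.

Definition peval (m : nat) (p : {mpoly k[m]}) (x : 'rV[k]_m) : k :=
  p.@[fun i => x ord0 i].

Definition zclosed (m : nat) (C : 'rV[k]_m -> Prop) : Prop :=
  exists P : {mpoly k[m]} -> Prop,
    forall x, C x <-> (forall p, P p -> peval p x = 0).

Definition zopen (m : nat) (U : 'rV[k]_m -> Prop) : Prop :=
  zclosed (fun x => ~ U x).

Definition zclosure (m : nat) (S : 'rV[k]_m -> Prop) (x : 'rV[k]_m) : Prop :=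
  forall C, zclosed C -> (forall y, S y -> C y) -> C x.

Definition closed_in (m : nat) (Y Z : 'rV[k]_m -> Prop) : Prop :=
  exists C, zclosed C /\ forall x, Z x <-> (Y x /\ C x).

Definition irreducible (m : nat) (Z : 'rV[k]_m -> Prop) : Prop :=
  (exists x, Z x) /\
  forall C1 C2, zclosed C1 -> zclosed C2 ->
    (forall x, Z x -> C1 x \/ C2 x) ->
    (forall x, Z x -> C1 x) \/ (forall x, Z x -> C2 x).

Definition irr_chain (m : nat) (Y : 'rV[k]_m -> Prop) (l : nat)
    (Z : nat -> 'rV[k]_m -> Prop) : Prop :=
  (forall i, (i <= l)%N -> closed_in Y (Z i) /\ irreducible (Z i)) /\
  (forall i, (i < l)%N ->
     (forall x, Z i x -> Z i.+1 x) /\ exists x, Z i.+1 x /\ ~ Z i x).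

Definition zdim (m : nat) (Y : 'rV[k]_m -> Prop) (dm : nat) : Prop :=
  (exists Z, irr_chain Y dm Z) /\ (forall l Z, irr_chain Y l Z -> (l <= dm)%N).

(* Degree: Y (of dimension dm) meets the affine linear subvariety
   {x | A x = c} (A of rank dm, i.e. of dimension l - dm), for (A, c) in a
   nonempty Zariski open subset of the parameter space A^(dm*l + dm),
   in exactly dg points. *)
Definition zdeg (l : nat) (Y : 'rV[k]_l -> Prop) (dg : nat) : Prop :=
  exists dm : nat, zdim Y dm /\
  exists U : 'rV[k]_(dm * l + dm) -> Prop,
    zopen U /\ (exists par, U par) /\
    forall par, U par ->
      let A : 'M[k]_(dm, l) := vec_mx (lsubmx par) in
      let c : 'rV[k]_dm := rsubmx par in
      \rank A = dm /\
      exists s : seq 'rV[k]_l,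
        uniq s /\ size s = dg /\
        forall x, (x \in s) <-> (Y x /\ x *m A^T = c).

Definition lin_alg_group (N : nat) (G : 'M[k]_N -> Prop) : Prop :=
  (exists C : 'rV[k]_(N * N) -> Prop, zclosed C /\
     forall g, G g <-> (\det g != 0 /\ C (mxvec g))) /\
  G 1%:M /\
  (forall g h, G g -> G h -> G (g *m h)) /\
  (forall g, G g -> G (invmx g)).

Definition connected_grp (N : nat) (G : 'M[k]_N -> Prop) : Prop :=
  forall C1 C2 : 'rV[k]_(N * N) -> Prop, zclosed C1 -> zclosed C2 ->
    (forall g, G g -> C1 (mxvec g) \/ C2 (mxvec g)) ->
    (forall g, G g -> ~ (C1 (mxvec g) /\ C2 (mxvec g))) ->
    (forall g, G g -> C1 (mxvec g)) \/ (forall g, G g -> C2 (mxvec g)).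

(* f is a regular function on G (k[GL_N] = k[x_ij, det^-1]). *)
Definition regular_on (N : nat) (G : 'M[k]_N -> Prop) (f : 'M[k]_N -> k) : Prop :=
  exists (p : {mpoly k[N * N]}) (e : nat),
    forall g, G g -> f g = peval p (mxvec g) / (\det g) ^+ e.

Definition rational_rep (N n : nat) (G : 'M[k]_N -> Prop)
    (rho : 'M[k]_N -> 'M[k]_n) : Prop :=
  rho 1%:M = 1%:M /\
  (forall g h, G g -> G h -> rho (g *m h) = rho g *m rho h) /\
  (forall i j, regular_on G (fun g => rho g i j)).

Definition act (N n : nat) (rho : 'M[k]_N -> 'M[k]_n) (g : 'M[k]_N)
    (v : 'rV[k]_n) : 'rV[k]_n :=
  \row_i \sum_j rho g i j * v ord0 j.

Definition gorbit (N n : nat) (G : 'M[k]_N -> Prop) (rho : 'M[k]_N -> 'M[k]_n)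
    (v : 'rV[k]_n) : 'rV[k]_n -> Prop :=
  fun w => exists g, G g /\ w = act rho g v.

Definition rep_image (N n : nat) (G : 'M[k]_N -> Prop) (rho : 'M[k]_N -> 'M[k]_n)
    : 'rV[k]_(n * n) -> Prop :=
  fun w => exists g, G g /\ w = mxvec (rho g).

Definition conic (n : nat) (S : 'rV[k]_n -> Prop) : Prop :=
  forall t : k, t != 0 -> forall v, S v -> S (t *: v).

Definition Ars (r s : nat) (x : 'rV[k]_(r + s)) : Prop :=
  \prod_(i < r) x ord0 (lshift s i) != 0.

Definition morphism_Ars (r s N : nat) (G : 'M[k]_N -> Prop)
    (iota : 'rV[k]_(r + s) -> 'M[k]_N) : Prop :=
  (forall x, Ars x -> G (iota x)) /\
  exists (P : 'I_N -> 'I_N -> {mpoly k[r + s]}) (e : nat),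
    forall x, Ars x -> forall u v,
      iota x u v = peval (P u v) x / (\prod_(i < r) x ord0 (lshift s i)) ^+ e.

Definition dominant (r s N : nat) (G : 'M[k]_N -> Prop)
    (iota : 'rV[k]_(r + s) -> 'M[k]_N) : Prop :=
  forall g, G g ->
    zclosure (fun w => exists x, Ars x /\ w = mxvec (iota x)) (mxvec g).

(* Multi-indices (q_1,...,q_n) with q_1+...+q_n <= 2d-2 are the q in
   {ffun 'I_n -> 'I_(2d-1)} with sum <= 2d-2.  The unknowns c_{p,q} are
   c p q.  F_p and H as in the paper: *)
Definition Fpoly (n d : nat) (c : 'I_n -> {ffun 'I_n -> 'I_(2 * d - 1)} -> k)
    (p : 'I_n) (y : 'I_n -> k) : k :=
  \sum_(q : {ffun 'I_n -> 'I_(2 * d - 1)} | (\sum_i (q i : nat) <= 2 * d - 2)%N)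
     c p q * \prod_i y i ^+ q i.

Definition Hpoly (n d : nat) (c : 'I_n -> {ffun 'I_n -> 'I_(2 * d - 1)} -> k)
    (alpha : 'rV[k]_n) (y : 'I_n -> k) : k :=
  \sum_p (y p - alpha ord0 p) * Fpoly c p y - 1.

End Zariski.

(* Main.v *)
Require Import Defs.
From HB Require Import structures.
From mathcomp Require Import all_boot all_order all_algebra.
From mathcomp Require Import mpoly separable zify.
From Stdlib Require Import Classical ClassicalEpsilon FunctionalExtensionality.
Set Implicit Arguments.
Unset Strict Implicit.
Unset Printing Implicit Defensive.
Import GRing.Theory.
Local Open Scope ring_scope.

(** If [a] lies in the closure of the orbit, a solution [c] would give a
polynomial [H] vanishing on the orbit (by dominance of [iota]) with
[H a = -1].  Conversely, if [a] is not in the closure, it suffices to find an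
equation [f] of the orbit of degree at most [d] with [f a <> 0], since Taylor
expansion of [- f / f a] at [a] then yields the [F_p].

As the orbit is conic, repeatedly projecting linearly from points outside of
its closure leads to a hypersurface [f = 0] that still separates [a]; for [f]
homogeneous of minimal degree [e], its restriction to a general direction is a
monic separable polynomial [N] of degree [e], the minimal polynomial of a
linear form [y] over algebraically independent linear forms [l_1, ..., l_m] in
the matrix entries of [rho].  Complete these to a maximal independent family
of linear forms.  If all of them could be fixed generically, the [e] values
of [y] would be [e] points of a linear section of [rho(G)].  The family may
fail to be generic, so it is perturbed to [l_i + t l'_i] with generic [l'_i]:
over [k(t)] the form [y] (or [y^(p^j)] in characteristic [p]) satisfies an
equation of degree at most [d], by counting the points of a generic section,
and this equation can be specialised to [t = 0] after dividing by a power of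
[t].  Comparing the number of roots with [N] gives [e <= d]. *)

(** * Evaluation of polynomials *)

(** All functions live in the fraction field of the polynomial ring in the parameters of [iota]. By
    dominance, a polynomial in the matrix entries vanishes on the group exactly when it vanishes at
    the resulting generic point; conicity makes the ideals of the orbit and of its projections
    homogeneous. The obstacle is that [zdeg] counts points only on sections off some hypersurface,
    while the forms over which [N] is minimal are dictated by [a]. Inseparability enters twice. A
    separating [f] of least degree is no p-th power, so [N] can be made separable. The equation over
    [k(t)] comes from counting points, which sees only separable degrees; hence the power [y^(p^j)].
    Raising to that power is injective on [k], so [e] distinct roots of a specialised [N] still give
    [e] distinct roots of the specialised equation. Equations over function fields appear with
    cleared denominators. Every genericity condition then says that some polynomial does not vanish,
    and finitely many of these can be met at once at a point over [k]. *)

Lemma rmorph_mmap n (R : nzRingType) (S T : comNzRingType) (g : {rmorphism S -> T})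
    (f : {rmorphism R -> S}) (h : 'I_n -> S) (p : {mpoly R[n]}) :
  g (mmap f h p) = mmap (g \o f) (g \o h) p.
Proof.
rewrite /mmap rmorph_sum; apply: eq_bigr => m _ /=.
rewrite rmorphM /mmap1 rmorph_prod; congr (_ * _).
by apply: eq_bigr => i _; rewrite rmorphXn.
Qed.

Lemma eq_mmap n (R S : nzRingType) (f f' : R -> S) (h h' : 'I_n -> S)
    (p : {mpoly R[n]}) : f =1 f' -> h =1 h' -> mmap f h p = mmap f' h' p.
Proof.
move=> ef eh; apply: eq_bigr => m _; rewrite ef; congr (_ * _).
exact: mmap1_eq.
Qed.

Lemma mmap_id n (R : comNzRingType) (p : {mpoly R[n]}) :
  mmap (@mpolyC n R) (fun i => 'X_i) p = p.
Proof.
rewrite [RHS]mpolyE; apply: eq_bigr => m _.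
by rewrite mmap1_id mul_mpolyC.
Qed.

Lemma mpoly_alg_ind n (R : comNzRingType) (G : {mpoly R[n]} -> Prop) :
  (forall c, G c%:MP) -> (forall i, G 'X_i) ->
  (forall p q, G p -> G q -> G (p + q)) -> (forall p q, G p -> G q -> G (p * q)) ->
  forall p, G p.
Proof.
move=> GC GX GD GM p; rewrite (mpolyE p); apply: (big_ind G) => [|//|m _].
  by rewrite -mpolyC0.
rewrite -mul_mpolyC; apply: (GM) => //; rewrite (mpolyXE_id R m).
apply: (big_ind G) => [||i _]; [by rewrite -mpolyC1|exact: GM|].
by elim: (m i) => [|e IH]; rewrite ?expr0 -?mpolyC1 // exprS; apply: GM.
Qed.

Lemma mmapXU n (R : nzRingType) (S : comNzRingType) (f : {rmorphism R -> S})
    (h : 'I_n -> S) i : mmap f h 'X_i = h i.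
Proof. by rewrite mmapX mmap1U. Qed.

Section EvalPoly.
Variables (R : nzRingType) (S : comNzRingType) (f : {rmorphism R -> S}) (y : S).

Definition evp (P : {poly R}) : S :=
  horner_morph (fun x => mulrC y (f x)) P.

HB.instance Definition _ :=
  GRing.RMorphism.copy evp (horner_morph (fun x => mulrC y (f x))).

Lemma evpE P : evp P = (map_poly f P).[y]. Proof. by []. Qed.
Lemma evpC c : evp c%:P = f c.
Proof. by rewrite evpE map_polyC hornerC. Qed.
Lemma evpX : evp 'X = y.
Proof. by rewrite evpE map_polyX hornerX. Qed.
End EvalPoly.

Lemma rmorph_evp (R : nzRingType) (S T : comNzRingType) (g : {rmorphism S -> T})
    (f : {rmorphism R -> S}) y P : g (evp f y P) = evp (g \o f) (g y) P.
Proof. by rewrite !evpE map_poly_comp horner_map. Qed.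

Lemma eq_evp (R : nzRingType) (S : comNzRingType) (f f' : {rmorphism R -> S}) y P :
  f =1 f' -> evp f y P = evp f' y P.
Proof. by move=> e; rewrite !evpE (eq_map_poly e). Qed.

Definition wdn n (i : 'I_n) : 'I_n.+1 := widen_ord (leqnSn n) i.

(** The tool for induction on the number of variables: [muni] singles out the last one. *)
Lemma muni_eval n (R S : comNzRingType) (f : {rmorphism R -> S})
    (h : 'I_n.+1 -> S) p :
  evp (mmap f (h \o @wdn n)) (h ord_max) (muni p) = mmap f h p.
Proof.
rewrite /muni; set X := fun i => _.
rewrite (rmorph_mmap (evp (mmap f (h \o @wdn n)) (h ord_max)) (polyC \o @mpolyC n R)).
apply: eq_mmap => [c|i] /=; first by rewrite evpC /= mmapC.
rewrite /X; case: splitP => [j|j] /= eqj.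
  by rewrite evpC /= mmapXU /=; congr h; apply/val_inj.
by rewrite evpX; congr h; apply/val_inj; rewrite /= eqj ord1 addn0.
Qed.

Lemma muni_inj n (R : comNzRingType) : injective (@muni n R).
Proof.
move=> p q epq; rewrite -[p]mmap_id -[q]mmap_id.
by rewrite -!muni_eval epq.
Qed.

(** By induction the leading coefficient in the last variable is nonzero at some point; what remains
    is a nonzero polynomial in one variable over an infinite field. *)
Lemma mpoly_nonvanishing (k : closedFieldType) n (p : {mpoly k[n]}) :
  p != 0 -> exists v, p.@[v] != 0.
Proof.
elim: n p => [|n IH] p p0.
  exists (fun=> 0); rewrite (nvar0_mpolyC p) mevalC.
  by apply: contraNneq p0 => e; rewrite (nvar0_mpolyC p) e mpolyC0.
have u0 : muni p != 0.
  by apply: contraNneq p0 => e; apply/eqP/(@muni_inj n k); rewrite e muni0.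
have [v vP] := IH (lead_coef (muni p)) (ltac:(by rewrite lead_coef_eq0)).
pose q := map_poly (meval v) (muni p).
have q0 : q != 0.
  apply/eqP => /(congr1 (fun q : {poly k} => q`_(size (muni p)).-1)).
  by rewrite coef_map coef0; apply/eqP.
have [x qx] : exists x, q.[x] != 0.
  by have /closed_nonrootP [x hx] := q0; exists x.
exists (fun i => oapp v x (insub (val i))).
pose h (i : 'I_n.+1) := oapp v x (insub (val i)).
have hx : h ord_max = x by rewrite /h insubF //= ltnn.
have hw i : h (wdn i) = v i.
  by rewrite /h /= insubT //= => lt; congr v; apply/val_inj.
rewrite -/h /meval -muni_eval evpE hx.
rewrite (eq_map_poly (g := meval v)) // => c; exact: eq_mmap.
Qed.

Definition membed (k : fieldType) p q (le : (p <= q)%N) :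
    {rmorphism {mpoly k[p]} -> {mpoly k[q]}} :=
  mmap (@mpolyC q k) (fun i => 'X_(widen_ord le i)).

Lemma membed_eval (k : fieldType) p q (le : (p <= q)%N) (S : comNzRingType)
    (f : {rmorphism k -> S}) (z : 'I_q -> S) c :
  mmap f z (membed k le c) = mmap f (fun i => z (widen_ord le i)) c.
Proof.
rewrite [membed k le c]/(mmap _ _ _) (rmorph_mmap (mmap f z) (@mpolyC q k)).
by apply: eq_mmap => [a|i] /=; rewrite ?mmapC ?mmapXU.
Qed.

Lemma membed_inj (k : closedFieldType) p q (le : (p <= q)%N) : injective (membed k le).
Proof.
apply: raddf_inj => c c0; apply/eqP/negPn/negP => /mpoly_nonvanishing [v].
apply/negP/negPn/eqP; pose v' (i : 'I_q) := oapp v 0 (insub (val i)).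
have <- : (membed k le c).@[v'] = 0 by rewrite c0 meval0.
rewrite [in RHS]/meval membed_eval; apply: eq_mmap => // i.
by rewrite /v' /= insubT //= => lt; congr v; apply/val_inj.
Qed.

Lemma ex_minimal (T : Type) (Q : T -> Prop) (m : T -> nat) :
  (exists x, Q x) -> exists x, Q x /\ forall y, Q y -> (m x <= m y)%N.
Proof.
move=> [x Qx]; move: {2}(m x) (leqnn (m x)) => n.
elim: n x Qx => [|n IH] x Qx le.
  by exists x; split=> // y _; move: le; rewrite leqn0 => /eqP ->.
case: (classic (exists y, Q y /\ (m y < m x)%N)) => [[y [Qy lt]]|no].
  by apply: (IH y Qy); rewrite -ltnS (leq_trans lt).
exists x; split=> // y Qy; rewrite leqNgt; apply/negP => lt.
by apply: no; exists y.
Qed.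

(** * Factorial rings *)

Section Factorial.
Import Pdiv.Idomain.

Definition prime_elt (R : idomainType) (p : R) : Prop :=
  [/\ p != 0, p \isn't a GRing.unit &
      forall a b c, a * b = p * c ->
        (exists d, a = p * d) \/ (exists d, b = p * d)].

(** Unique factorisation in a form suited to induction: [mu] bounds chains of proper divisors, and a
    prime can be split off every nonzero nonunit. *)
Definition factorial_ring (R : idomainType) : Prop :=
  (exists mu : R -> nat, forall a b : R, a * b != 0 ->
     (mu b <= mu (a * b)%R)%N /\
     (a \isn't a GRing.unit -> (mu b < mu (a * b)%R)%N)) /\
  (forall a : R, a != 0 -> a \isn't a GRing.unit ->
     exists p c, prime_elt p /\ a = p * c).

Lemma factorial_field (F : fieldType) : factorial_ring F.
Proof.
split=> [|a a0]; last by rewrite unitfE a0.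
exists (fun=> 0%N) => a b; rewrite mulf_eq0 negb_or => /andP[a0 _].
by rewrite unitfE a0.
Qed.

Lemma factorial_iso (R S : idomainType) (f : {rmorphism R -> S})
    (g : {rmorphism S -> R}) :
  cancel f g -> cancel g f -> factorial_ring R -> factorial_ring S.
Proof.
move=> fK gK [[mu muP] pr].
have uf a : (f a \is a GRing.unit) = (a \is a GRing.unit).
  by apply/idP/idP => [/(rmorph_unit g)|/(rmorph_unit f)//]; rewrite fK.
have ug b : (g b \is a GRing.unit) = (b \is a GRing.unit) by rewrite -uf gK.
split=> [|a a0 aU].
  exists (mu \o g) => a b ab0 /=; rewrite rmorphM -ug; apply: muP.
  by rewrite -rmorphM; apply: contraNneq ab0 => e; rewrite -[_ * _]gK e rmorph0.
have ga0 : g a != 0 by apply: contraNneq a0 => e; rewrite -[a]gK e rmorph0.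
have [p [c [[p0 pU pp] e]]] := pr (g a) ga0 (ltac:(by rewrite ug)).
exists (f p), (f c); split; last by rewrite -rmorphM -e gK.
split; last move=> x y z e'.
- by apply: contraNneq p0 => e'; rewrite -[p]fK e' rmorph0.
- by rewrite uf.
- case: (pp (g x) (g y) (g z)) => [|[d ed]|[d ed]].
  + by rewrite -rmorphM e' rmorphM fK.
  + by left; exists (f d); rewrite -rmorphM -ed gK.
  + by right; exists (f d); rewrite -rmorphM -ed gK.
Qed.

Section Gauss.
Variable R : idomainType.
Implicit Types (F h q : {poly R}).

Lemma scale_mulX (p : R) F h : p *: F = h * 'X -> exists h', h = p *: h'.
Proof.
elim/poly_ind: F => [|F c _] e.
  exists 0; apply/eqP; rewrite scaler0 -(mulIr_eq0 h (@mulIf _ 'X _)).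
    by rewrite -e scaler0.
  by rewrite polyX_eq0.
exists F; apply/polyP => i; have := congr1 (fun P : {poly R} => P`_i.+1) e.
by rewrite !coefZ coefD !coefMX coefC /= addr0.
Qed.

(** The product of the constant terms is divisible by [p], hence so is one of them. Removing it and
    dividing by ['X] shortens one of the two factors. *)
Lemma gauss_prime (p : R) h q F : prime_elt p -> p *: F = h * q ->
  (exists h', h = p *: h') \/ (exists q', q = p *: q').
Proof.
move=> [p0 pU pP]; elim/poly_ind: h q F => [|h a IHh] q F.
  by left; exists 0; rewrite scaler0.
elim/poly_ind: q F => [|q b IHq] F e; first by right; exists 0; rewrite scaler0.
have e0 : a * b = p * F`_0.
  have := congr1 (fun P : {poly R} => P`_0) e.
  by rewrite coefZ coef0M !coefD !coefMX !coefC /= !add0r.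
case: (pP _ _ _ e0) => -[d ed].
- have e1 : p *: (F - d *: (q * 'X + b%:P)) = (h * (q * 'X + b%:P)) * 'X.
    rewrite scalerBr e scalerA -ed mulrDl -mul_polyC.
    by rewrite addrK mulrAC.
  have [G eG] := scale_mulX e1.
  case: (IHh _ _ (esym eG)) => [[h' eh]|[q' eq]]; last by right; exists q'.
  left; exists (h' * 'X + d%:P).
  by rewrite eh ed scalerDr scalerAl -(mul_polyC p d%:P) -polyCM.
- have e1 : p *: (F - d *: (h * 'X + a%:P)) = ((h * 'X + a%:P) * q) * 'X.
    rewrite scalerBr e scalerA -ed mulrDr [_ * b%:P]mulrC mul_polyC.
    by rewrite addrK mulrA.
  have [G eG] := scale_mulX e1.
  case: (IHq _ (esym eG)) => [[h' eh]|[q' eq]]; first by left; exists h'.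
  right; exists (q' * 'X + d%:P).
  by rewrite eq ed scalerDr scalerAl -(mul_polyC p d%:P) -polyCM.
Qed.

(* Gauss's lemma: removing prime factors one at a time, a factorisation over
   the fraction field descends to [R]. *)
Lemma gauss_descent (a : R) F h q : factorial_ring R -> a != 0 -> a *: F = h * q ->
  exists a1 a2 h' q', [/\ a1 != 0, a2 != 0, h = a1 *: h', q = a2 *: q' &
    F = h' * q'].
Proof.
move=> [[mu muP] pr]; move: {2}(mu a).+1 (ltnSn (mu a)) => n.
elim: n a h q => // n IH a h q lt a0 e.
case: (boolP (a \is a GRing.unit)) => aU.
  exists 1, a, h, (a^-1 *: q); rewrite oner_neq0 scale1r scalerA mulrV // scale1r.
  by rewrite -scalerAr -e scalerA mulVr // scale1r.
have [p [c [pp ea]]] := pr a a0 aU.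
have [p0 pU _] := pp.
have c0 : c != 0 by apply: contraNneq a0 => c0; rewrite ea c0 mulr0.
have ltc : (mu c < n)%N.
  have [_ /(_ pU) lc] := muP p c (ltac:(by rewrite -ea)).
  by rewrite -ltnS (leq_ltn_trans _ lt) // ea.
have e' : p *: (c *: F) = h * q by rewrite scalerA -ea.
have sI : injective ( *:%R p : {poly R} -> {poly R}).
  by move=> x y; rewrite -!mul_polyC; apply: mulfI; rewrite polyC_eq0.
case: (gauss_prime pp e') => -[h1 eh].
- have e1 : c *: F = h1 * q by apply: sI; rewrite e' eh scalerAl.
  have [a1 [a2 [h' [q' [A1 A2 H1 H2 H3]]]]] := IH _ _ _ ltc c0 e1.
  exists (p * a1), a2, h', q'; split=> //; first by rewrite mulf_neq0.
  by rewrite eh H1 scalerA.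
- have e1 : c *: F = h * h1 by apply: sI; rewrite e' eh scalerAr.
  have [a1 [a2 [h' [q' [A1 A2 H1 H2 H3]]]]] := IH _ _ _ ltc c0 e1.
  exists a1, (p * a2), h', q'; split=> //; first by rewrite mulf_neq0.
  by rewrite eh H2 scalerA.
Qed.

Lemma bezout_coprime F h : coprimep F h ->
  exists S T D, D != 0 /\ S * F + T * h = D%:P.
Proof.
move=> /Bezout_coprimepP [[u v] /= /eqpP [[c1 c2] /= /andP[c10 c20] e]].
exists (c1 *: u), (c1 *: v), c2; split=> //.
by rewrite -!scalerAl -scalerDr e -mul_polyC mulr1.
Qed.

(** [gcdp] is a gcd over the fraction field only. Gauss's lemma brings the factorisations of [F] and
    [g] through it back to [R], where the unit leading coefficient of [F] turns the stray constants
    into units. *)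
Lemma gauss_irreducible F g : factorial_ring R -> lead_coef F \is a GRing.unit ->
  (forall h q, F = h * q -> (size h = 1)%N \/ (size q = 1)%N) ->
  coprimep F g \/ exists c, g = c * F.
Proof.
move=> fR uF irr; have F0 : F != 0.
  by apply: contraTneq uF => ->; rewrite lead_coef0 unitr0.
case: (boolP (coprimep F g)) => [|ncop]; first by left.
right; set h := gcdp F g in ncop *.
have h0 : h != 0 by rewrite gcdp_eq0 negb_and F0.
have /dvdpP [[c1 q1] /= c10 e1] := dvdp_gcdl F g.
have /dvdpP [[c2 q2] /= c20 e2] := dvdp_gcdr F g.
rewrite -/h in e1 e2.
have [a1 [a2 [q' [h' [A1 A2 H1 H2 H3]]]]] := gauss_descent fR c10 e1.
have sh' : size h' != 1%N by rewrite -(size_scale h' A2) -H2 -coprimep_def.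
have /size_poly1P [u u0 eu] : size q' == 1%N.
  by case: (irr _ _ H3) => [->//|s1]; rewrite s1 eqxx in sh'.
have uu : u \is a GRing.unit.
  by move: uF; rewrite H3 eu mul_polyC lead_coefZ unitrM => /andP[].
have eh' : h' = u^-1 *: F.
  by rewrite H3 eu mul_polyC scalerA mulVr // scale1r.
have e3 : c2 *: g = (q2 * (a2 * u^-1)%:P) * F.
  by rewrite e2 H2 eh' scalerA -mul_polyC mulrA.
have [b1 [b2 [w [F' [B1 B2 K1 K2 K3]]]]] := gauss_descent fR c20 e3.
have ub : b2 \is a GRing.unit.
  by move: uF; rewrite K2 lead_coefZ unitrM => /andP[].
exists (b2^-1 *: w); rewrite K2 -scalerAl -scalerAr scalerA mulVr // scale1r.
exact: K3.
Qed.

(** The measure adds the size to the measure of the leading coefficient. If no prime of [R] divides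
    [P], a nonconstant factor [h] of least degree is prime: it is primitive, and by minimality its
    gcd with any [u] is trivial or [h] itself, up to constants. *)
Lemma factorial_poly : factorial_ring R -> factorial_ring {poly R}.
Proof.
move=> fR; have [[mu muP] pr] := fR; split.
  exists (fun P : {poly R} => size P + mu (lead_coef P))%N => a b ab0.
  have [a0 b0] : a != 0 /\ b != 0.
    by apply/andP; rewrite -negb_or -mulf_eq0.
  have lab : lead_coef a * lead_coef b != 0.
    by rewrite -lead_coefM lead_coef_eq0.
  have [le lt] := muP _ _ lab; rewrite lead_coefM size_mul //.
  have sa : (0 < size a)%N by rewrite size_poly_gt0.
  have sb : (0 < size b)%N by rewrite size_poly_gt0.
  have les : (size b <= (size a + size b).-1)%N.
    by case: (size a) sa => // n _; rewrite addSn /= leq_addl.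
  split; first by rewrite leq_add.
  rewrite poly_unitE negb_and => /orP[s1|nu].
    rewrite -addSn leq_add //.
    by case: (size a) sa s1 => [|[|n]] // _ _; rewrite !addSn /= ltnS leq_addl.
  case: (ltngtP (size a) 1) => [|s1|s1].
  - by rewrite ltnS leqNgt sa.
  - rewrite -addSn leq_add //.
    by case: (size a) s1 => [|[|n]] // _; rewrite !addSn /= ltnS leq_addl.
  - rewrite -addnS leq_add // lt //.
    by rewrite lead_coefE s1.
move=> P P0 PU.
case: (classic (exists p Q, prime_elt p /\ P = p *: Q)) => [[p [Q [pp eP]]]|nop].
  exists p%:P, Q; split; last by rewrite mul_polyC.
  have [p0 pU _] := pp; split; first by rewrite polyC_eq0.
    by rewrite poly_unitE coefC /= (negPf pU) andbF.
  move=> x y z; rewrite mul_polyC => /esym /(gauss_prime pp).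
  by case=> [[h eh]|[h eh]]; [left|right]; exists h; rewrite mul_polyC.
have sP : (1 < size P)%N.
  rewrite ltn_neqAle eq_sym size_poly_gt0 P0 andbT.
  apply/negP => /size_poly1P [c c0 eP].
  move: PU; rewrite eP poly_unitE size_polyC c0 coefC /= => cU.
  have [p [d [pp ec]]] := pr c c0 cU.
  by apply: nop; exists p, d%:P; split=> //; rewrite eP ec polyCM mul_polyC.
have [h [[[Q eP] sh] hmin]] :=
  @ex_minimal _ (fun h : {poly R} => (exists Q, P = h * Q) /\ (1 < size h)%N)
    (fun h => size h) (ex_intro _ P (conj (ex_intro _ 1 (esym (mulr1 P))) sP)).
have h0 : h != 0 by rewrite -size_poly_gt0 ltnW.
have noh p h1 : prime_elt p -> h <> p *: h1.
  by move=> pp eh; apply: nop; exists p, (h1 * Q); rewrite scalerAl -eh.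
have hu a h1 : h = a *: h1 -> a \is a GRing.unit.
  move=> eh; apply: contraT => aU.
  have a0 : a != 0 by apply: contraNneq h0 => a0; rewrite eh a0 scale0r.
  have [p [c [pp ea]]] := pr a a0 aU.
  by case: (noh p (c *: h1) pp); rewrite scalerA -ea.
(* As [h] is primitive, a constant [a] can be cancelled from a multiple of [h]. *)
have clear a u w : a != 0 -> a *: u = h * w -> exists w', u = h * w'.
  move=> a0 e; have [a1 [a2 [h' [q' [A1 A2 H1 H2 H3]]]]] := gauss_descent fR a0 e.
  have ua := hu _ _ H1.
  exists (a1^-1 *: q'); rewrite H1 -scalerAl -scalerAr scalerA mulrV // scale1r.
  exact: H3.
exists h, Q; split=> //; split=> // [|u v w e].
  by rewrite poly_unitE gtn_eqF.
case: (classic (exists d, u = h * d)) => [|nu]; first by left.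
right; case: (boolP (coprimep h u)) => [/bezout_coprime [S [T [D [D0 eD]]]]|ncop].
  apply: (clear D v (S * v + T * w)) => //.
  rewrite -mul_polyC -eD mulrDl mulrDr -!mulrA e.
  by congr (_ + _); rewrite mulrCA.
case: nu; set g := gcdp h u in ncop *.
have /dvdpP [[c1 q1] /= c10 e1] := dvdp_gcdl h u.
have /dvdpP [[c2 q2] /= c20 e2] := dvdp_gcdr h u.
rewrite -/g in e1 e2.
have g0 : g != 0 by rewrite gcdp_eq0 negb_and h0.
have [a1 [a2 [q' [g' [A1 A2 H1 H2 H3]]]]] := gauss_descent fR c10 e1.
have sg' : (1 < size g')%N.
  rewrite -(size_scale g' A2) -H2 ltn_neqAle eq_sym -coprimep_def ncop.
  by rewrite size_poly_gt0.
have eP' : P = g' * (q' * Q) by rewrite mulrA (mulrC g') -H3.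
have le := hmin g' (conj (ex_intro _ _ eP') sg').
have q'0 : q' != 0 by apply: contraNneq h0 => e'; rewrite H3 e' mul0r.
have g'0 : g' != 0 by rewrite -size_poly_gt0 ltnW.
have /size_poly1P [x x0 ex] : size q' == 1%N.
  move: le; rewrite H3 size_mul // => le.
  rewrite eqn_leq size_poly_gt0 q'0 andbT -(leq_add2r (size g')) add1n.
  by case: (size g') sg' le => // n _; rewrite addnS.
have ux : x \is a GRing.unit by apply: (hu _ g'); rewrite H3 ex mul_polyC.
apply: (clear c2 u (q2 * (a2 * x^-1)%:P)) => //.
rewrite e2 H2 -(mul_polyC a2 g') H3 ex polyCM.
rewrite [RHS]mulrC -!mulrA; congr (_ * (_ * _)).
by rewrite mulrA -polyCM mulVr // mul1r.
Qed.

End Gauss.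
End Factorial.

(** * Polynomials along a direction *)

Section Direction.
Variables (k : fieldType) (j : nat) (lam : 'I_j.+1 -> k) (i0 : 'I_j.+1).

(* Writing a point of the affine space of dimension [j.+1] as
   [sigma w + t *: lam], where [sigma w] has coordinate [0] at [i0], turns a
   polynomial into a polynomial in [t] over the polynomials in [w]. *)
Definition dvar (i : 'I_j.+1) : {poly {mpoly k[j]}} :=
  (oapp (fun i' => 'X_i') 0 (unlift i0 i))%:P + ((lam i)%:MP)%:P * 'X.

Definition dpoly (p : {mpoly k[j.+1]}) : {poly {mpoly k[j]}} :=
  mmap (polyC \o @mpolyC j k) dvar p.

HB.instance Definition _ :=
  GRing.RMorphism.copy dpoly (mmap (polyC \o @mpolyC j k) dvar).

Lemma dpolyD p q : dpoly (p + q) = dpoly p + dpoly q.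
Proof. exact: rmorphD. Qed.
Lemma dpolyM p q : dpoly (p * q) = dpoly p * dpoly q.
Proof. exact: rmorphM. Qed.
Lemma dpolyC c : dpoly c%:MP = c%:MP%:P. Proof. exact: mmapC. Qed.
Lemma dpolyXU i : dpoly 'X_i = dvar i. Proof. exact: mmapXU. Qed.
Lemma dpolyX m : dpoly 'X_[m] = \prod_i dvar i ^+ m i.
Proof. by rewrite /dpoly mmapX. Qed.
Lemma dpolyZ c p : dpoly (c *: p) = c%:MP *: dpoly p.
Proof. by rewrite /dpoly mmapZ /= mul_polyC. Qed.

Section Coord.
Variables (E : comNzRingType) (kap : {rmorphism k -> E}) (z : 'I_j.+1 -> E).

(** The coordinates [w] (here) and [t] (in [dcoord]) of a point [z] written as [sigma w + t *: lam],
    over any [k]-algebra. *)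
Definition dproj (i : 'I_j) : E :=
  z (lift i0 i) - kap (lam (lift i0 i) / lam i0) * z i0.
Definition dcoord : E := kap (lam i0)^-1 * z i0.

Hypothesis lam0 : lam i0 != 0.

Lemma dpoly_eval p : evp (mmap kap dproj) dcoord (dpoly p) = mmap kap z p.
Proof.
rewrite /dpoly (rmorph_mmap (evp (mmap kap dproj) dcoord) (polyC \o @mpolyC j k)).
apply: eq_mmap => [c|i] /=; first by rewrite evpC /= mmapC.
rewrite /dvar rmorphD rmorphM /= !evpC evpX /= mmapC /dcoord mulrA -rmorphM.
case: unliftP => [i'|] -> /=; first by rewrite mmapXU /dproj subrK.
by rewrite raddf0 add0r mulfV // rmorph1 mul1r.
Qed.
End Coord.

Hypothesis lam0 : lam i0 != 0.

Definition dmulti (P : {poly {mpoly k[j]}}) : {mpoly k[j.+1]} :=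
  evp (mmap (@mpolyC j.+1 k) (dproj (@mpolyC j.+1 k) (fun i => 'X_i)))
    (dcoord (@mpolyC j.+1 k) (fun i => 'X_i)) P.

HB.instance Definition _ := GRing.RMorphism.copy dmulti
  (evp (mmap (@mpolyC j.+1 k) (dproj (@mpolyC j.+1 k) (fun i => 'X_i)))
    (dcoord (@mpolyC j.+1 k) (fun i => 'X_i))).

Lemma dpolyK : cancel dpoly dmulti.
Proof. by move=> p; rewrite /dmulti dpoly_eval // mmap_id. Qed.

Lemma dmultiK : cancel dmulti dpoly.
Proof.
move=> P; rewrite /dmulti (rmorph_evp dpoly).
have eX : dpoly (dcoord (@mpolyC j.+1 k) (fun i => 'X_i)) = 'X.
  rewrite /dcoord rmorphM /= dpolyC dpolyXU /dvar unlift_none /= add0r.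
  by rewrite mulrA -polyCM -mpolyCM mulVf // mpolyC1 mul1r.
rewrite /= eX -[RHS]comp_polyXr [RHS]/(evp polyC 'X P); apply: eq_evp => c /=.
rewrite (rmorph_mmap dpoly (@mpolyC j.+1 k)).
rewrite -[in RHS](mmap_id c) (rmorph_mmap polyC (@mpolyC j k)).
apply: eq_mmap => [a|i] /=; first by rewrite dpolyC.
rewrite /dproj rmorphB !rmorphM /= !dpolyC !dpolyXU /dvar liftK unlift_none /= add0r.
by rewrite mulrA -!polyCM -!mpolyCM divfK // addrK.
Qed.

End Direction.

Lemma factorial_mpoly (k : fieldType) n : factorial_ring {mpoly k[n]}.
Proof.
elim: n => [|n IH].
  apply: (@factorial_iso k {mpoly k[0]} (@mpolyC 0 k) (mcoeff 0%MM)).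
  - by move=> c; rewrite /= mcoeffC eqxx mulr1.
  - by move=> p; rewrite /= -nvar0_mpolyC.
  - exact: factorial_field.
(* Along a coordinate direction, [dpoly] identifies the ring with polynomials in one variable over a
   ring with one variable fewer. *)
pose lam (i : 'I_n.+1) : k := (i == ord0)%:R.
have lam0 : lam ord0 != 0 by rewrite /lam eqxx oner_neq0.
apply: (@factorial_iso {poly {mpoly k[n]}} {mpoly k[n.+1]}
  (dmulti lam ord0) (dpoly lam ord0)).
- exact: dmultiK.
- exact: dpolyK.
- exact: factorial_poly.
Qed.

(** A formal leading coefficient: [c] may be zero, which makes it multiplicative without any side
    condition. *)
Definition topc (R : nzRingType) (d : nat) (c : R) (P : {poly R}) : Prop :=
  (size P <= d.+1)%N /\ P`_d = c.

Lemma topcM (R : comNzRingType) a b (x y : R) P Q :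
  topc a x P -> topc b y Q -> topc (a + b) (x * y) (P * Q).
Proof.
move=> [sP eP] [sQ eQ]; split.
  apply: leq_trans (size_polyMleq P Q) _.
  by rewrite -ltnS; case: (_ + _)%N (leq_add sP sQ) => // n; rewrite addSn addnS.
rewrite coefM (bigD1 (Ordinal (leq_addr b a : (a < (a + b).+1)%N))) //= addKn eP eQ.
rewrite big1 ?addr0 // => i ne.
have [lt|le] := ltnP i a.
  rewrite [Q`_ _]nth_default ?mulr0 // (leq_trans sQ) //.
  by rewrite ltn_subRL ltn_add2r.
rewrite [P`_ _]nth_default ?mul0r // (leq_trans sP) // ltn_neqAle le andbT.
by apply: contra ne => /eqP e; apply/eqP/val_inj.
Qed.

Section DirectionDegree.
Variables (k : fieldType) (j : nat) (lam : 'I_j.+1 -> k) (i0 : 'I_j.+1).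
Local Notation dpoly := (dpoly lam i0).

Lemma topc_dpolyX m : topc (mdeg m) ((\prod_i lam i ^+ m i)%:MP) (dpoly 'X_[m]).
Proof.
rewrite dpolyX mdegE rmorph_prod.
elim: (index_enum _) => [|i r IH].
  by rewrite !big_nil; split; [rewrite size_poly1|rewrite coefC].
rewrite !big_cons; apply: topcM IH; rewrite rmorphXn.
elim: (m i) => [|n IH]; first by rewrite !expr0; split; [rewrite size_poly1|rewrite coefC].
rewrite !exprS -add1n; apply: topcM IH.
rewrite /dvar; split; last by rewrite coefD coefC add0r coefMX coefC.
apply: leq_trans (size_polyD _ _) _; rewrite geq_max.
apply/andP; split; first exact: leq_trans (size_polyC_leq1 _) _.
apply: leq_trans (size_polyMleq _ _) _; rewrite size_polyX addn2.
exact: (leq_ltn_trans (size_polyC_leq1 _)).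
Qed.

Lemma size_dpoly p : (size (dpoly p) <= msize p)%N.
Proof.
rewrite [p in dpoly p]mpolyE rmorph_sum /=.
apply: leq_trans (size_sum _ _ _) _.
rewrite big_seq; apply/bigmax_leqP_seq => m mp _.
rewrite dpolyZ; apply: leq_trans (size_scale_leq _ _) _.
have [le _] := topc_dpolyX m.
exact: leq_trans le (msize_mdeg_lt mp).
Qed.

(** For a direction off the zeros of [p] this top coefficient is a nonzero constant, so [p] becomes
    an integral equation for the coordinate [t]. *)
Lemma coef_dpoly_homog d p : p \is d.-homog -> (dpoly p)`_d = (p.@[lam])%:MP.
Proof.
move=> hp; rewrite [p in dpoly p]mpolyE rmorph_sum /= coef_sum mevalE rmorph_sum /=.
rewrite !big_seq; apply: eq_bigr => m mp.
rewrite dpolyZ coefZ rmorphM /=; congr (_ * _).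
by have [_] := topc_dpolyX m; rewrite (dhomog_mf hp mp).
Qed.

Definition dderiv (p : {mpoly k[j.+1]}) := \sum_i lam i *: p^`M(i).

Lemma dpoly_deriv p : (dpoly p)^`() = dpoly (dderiv p).
Proof.
have D1 p1 p2 : dderiv (p1 + p2) = dderiv p1 + dderiv p2.
  by rewrite /dderiv -big_split; apply: eq_bigr => i _; rewrite mderivD scalerDr.
have DM p1 p2 : dderiv (p1 * p2) = dderiv p1 * p2 + p1 * dderiv p2.
  rewrite /dderiv mulr_suml mulr_sumr -big_split; apply: eq_bigr => i _.
  by rewrite mderivM scalerDr scalerAl scalerAr.
pose G p := (dpoly p)^`() = dpoly (dderiv p).
have GM p1 p2 : G p1 -> G p2 -> G (p1 * p2).
  rewrite /G => e1 e2.
  rewrite DM dpolyD !dpolyM; move: e1 e2.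
  move: (dpoly p1) (dpoly p2) (dpoly (dderiv p1)) (dpoly (dderiv p2)) => a b a' b' <- <-.
  exact: derivM.
have GD p1 p2 : G p1 -> G p2 -> G (p1 + p2).
  rewrite /G => e1 e2.
  rewrite D1 !dpolyD; move: e1 e2.
  move: (dpoly p1) (dpoly p2) (dpoly (dderiv p1)) (dpoly (dderiv p2)) => a b a' b' <- <-.
  exact: derivD.
have GC c : G c%:MP.
  rewrite /G dpolyC derivC /dderiv big1 ?rmorph0 // => i _.
  by rewrite mderivC scaler0.
have DX i : dderiv 'X_i = (lam i)%:MP.
  rewrite /dderiv (bigD1 i) //= big1 ?addr0 => [|i' ne].
    have e0 : (U_(i) - U_(i) = 0 :> 'X_{1..j.+1})%MM.
      by apply/mnmP => i'; rewrite mnmBE subnn mnm0E.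
    by rewrite mderivX mnm1E eqxx scale1r e0 mpolyX0 -mul_mpolyC mulr1.
  by rewrite mderivX mnm1E eq_sym (negPf ne) scale0r scaler0.
have GX i : G 'X_i.
  rewrite /G DX dpolyC dpolyXU /dvar.
  by rewrite derivD derivC add0r derivM derivC mul0r add0r derivX mulr1.
exact: (mpoly_alg_ind GC GX GD GM).
Qed.
End DirectionDegree.

(** * Minimal equations and their specialisations *)

Section Specialization.
Import Pdiv.Idomain.
Variables (R E : idomainType) (ev : {rmorphism R -> E}).
Implicit Types (P Q M V : {poly R}).

Lemma map_poly0_coef P : map_poly ev P = 0 <-> forall i, ev P`_i = 0.
Proof.
split=> [e i|e]; first by have := coef_map ev P i; rewrite e coef0.
by apply/polyP => i; rewrite coef_map coef0 /= e.
Qed.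

(** Truncating [P] at the degree of its image removes the leading coefficients killed by [ev]. *)
Lemma trim_kernel P : map_poly ev P != 0 ->
  exists Q, [/\ map_poly ev Q = map_poly ev P, ev (lead_coef Q) != 0 &
    (size Q <= size P)%N].
Proof.
move=> P0; set s := size (map_poly ev P).
have s0 : (0 < s)%N by rewrite size_poly_gt0.
have lP : ev P`_s.-1 != 0.
  by rewrite -coef_map /= -[_`_ _]/(lead_coef _) lead_coef_eq0.
exists (take_poly s P); split.
- apply/polyP => i; rewrite !coef_map coef_take_poly; case: ltnP => //= le.
  by have := coef_map ev P i; rewrite nth_default //= rmorph0.
- suff es : size (take_poly s P) = s.
    by rewrite lead_coefE es coef_take_poly prednK // leqnn.
  apply/eqP; rewrite eqn_leq size_take_poly /= leqNgt; apply/negP => lt.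
  move: lP; suff -> : P`_s.-1 = 0 by rewrite rmorph0 eqxx.
  have := coef_take_poly s P s.-1; rewrite prednK // leqnn => <-.
  by rewrite nth_default // -ltnS prednK.
- apply/leq_sizeP => i le; rewrite coef_take_poly; case: ifP => // _.
  by rewrite nth_default.
Qed.

Variable y : E.

(** The minimal polynomial of [y] over the fraction field of the image of [ev], with denominators
    cleared. Since [ev] may have a kernel, it is the image of the leading coefficient that has to be
    nonzero. *)
Definition min_poly M : Prop :=
  [/\ ev (lead_coef M) != 0, evp ev y M = 0 &
   forall P, ev (lead_coef P) != 0 -> evp ev y P = 0 -> (size M <= size P)%N].

Lemma min_poly_exists P : map_poly ev P != 0 -> evp ev y P = 0 ->
  exists M, min_poly M /\ (size M <= size P)%N.
Proof.
move=> P0 Py; have [Q [eQ lQ sQ]] := trim_kernel P0.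
have Qy : evp ev y Q = 0 by rewrite evpE eQ.
have [M [[M1 M2] M3]] := @ex_minimal _
  (fun Q : {poly R} => ev (lead_coef Q) != 0 /\ evp ev y Q = 0)
  (fun Q => size Q) (ex_intro _ Q (conj lQ Qy)).
exists M; split; last exact: leq_trans (M3 Q (conj lQ Qy)) sQ.
by split=> // P' h1 h2; apply: M3.
Qed.

Section Minimal.
Variable M : {poly R}.
Hypothesis Mmin : min_poly M.

Lemma min_poly_kernel P : (size P < size M)%N -> evp ev y P = 0 ->
  map_poly ev P = 0.
Proof.
move=> lt Py; apply/eqP/negPn/negP => P0; have [Q [eQ lQ sQ]] := trim_kernel P0.
have [_ _ /(_ Q lQ)] := Mmin; rewrite evpE eQ => /(_ Py).
by rewrite leqNgt (leq_ltn_trans sQ).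
Qed.

Lemma min_poly_lead0 : lead_coef M != 0.
Proof. by have [+ _ _] := Mmin; apply: contraNneq => ->; rewrite rmorph0. Qed.

Lemma min_poly_neq0 : M != 0.
Proof. by rewrite -lead_coef_eq0 min_poly_lead0. Qed.

Lemma min_poly_size : (1 < size M)%N.
Proof.
rewrite ltnNge; apply/negP => /size1_polyC eM.
have [lM My _] := Mmin; move: lM My; rewrite eM lead_coefC evpC => lM e.
by rewrite e eqxx in lM.
Qed.

(** An element [h] of least degree in the ideal of [M] and [V], modulo the kernel of [ev], divides
    both up to constants. If it were not constant, [h] could not vanish at [y] because [V] does not,
    nor could its cofactor in [M], whose degree is too small. *)
Lemma min_poly_bezout V : evp ev y V != 0 ->
  exists S T U, ev U != 0 /\ map_poly ev (S * M + T * V) = (ev U)%:P.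
Proof.
move=> Vy; have [lM My Mm] := Mmin.
pose J h := (exists S T, map_poly ev h = map_poly ev (S * M + T * V)) /\
  ev (lead_coef h) != 0.
have JM : J M.
  by split=> //; exists 1, 0; rewrite mul1r mul0r addr0.
have [h [[[S [T eh]] lh] hmin]] := @ex_minimal _ J (fun h => size h) (ex_intro _ M JM).
have h0 : h != 0.
  by apply: contraNneq lh => ->; rewrite lead_coef0 rmorph0.
case: (leqP (size h) 1) => sh.
  exists S, T, (lead_coef h); split=> //.
  by rewrite -eh (size1_polyC sh) lead_coefC map_polyC.
have red P : (exists S T, map_poly ev P = map_poly ev (S * M + T * V)) ->
    exists q r c, [/\ ev c != 0, c *: P = q * h + r, (size r < size h)%N &
      map_poly ev r = 0].
  move=> [S1 [T1 e1]].
  exists (P %/ h), (P %% h), (lead_coef h ^+ scalp P h).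
  split; rewrite ?rmorphXn ?expf_neq0 ?divp_eq ?ltn_modp //.
  apply/eqP/negPn/negP => r0; have [Q [eQ lQ sQ]] := trim_kernel r0.
  have JQ : J Q.
    split=> //; set c := lead_coef h ^+ scalp P h.
    exists (c *: S1 - P %/ h * S), (c *: T1 - P %/ h * T).
    have -> : (c *: S1 - P %/ h * S) * M + (c *: T1 - P %/ h * T) * V =
       c *: (S1 * M + T1 * V) - P %/ h * (S * M + T * V).
      rewrite !mulrBl mulrDr scalerDr -!scalerAl -!mulrA opprD !addrA.
      by congr (_ - _); rewrite addrAC.
    have -> : map_poly ev Q = map_poly ev (c *: P - P %/ h * h).
      by rewrite eQ divp_eq addrC addKr.
    by rewrite -!mul_polyC !rmorphB !rmorphM /= e1 eh.
  by have := leq_trans (hmin Q JQ) sQ; rewrite leqNgt ltn_modp h0.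
have [q [r [c [c0 e sr r0]]]] := red M JM.1.
have ry : evp ev y r = 0 by rewrite evpE r0 horner0.
have : evp ev y (c *: M) = 0 by rewrite -mul_polyC rmorphM /= My mulr0.
rewrite e rmorphD rmorphM /= ry addr0 => /eqP; rewrite mulf_eq0 => /orP[/eqP qy|/eqP hy].
  have c0' : c != 0 by apply: contraNneq c0 => ->; rewrite rmorph0.
  have sM : (size r < size (c *: M))%N.
    by rewrite size_scale // (leq_trans sr) // hmin.
  have eq : q * h = c *: M - r by rewrite e addrK.
  have lq : lead_coef q * lead_coef h = c * lead_coef M.
    by rewrite -lead_coefM eq lead_coefDl ?size_polyN // lead_coefZ.
  have lq' : ev (lead_coef q) != 0.
    have : ev (lead_coef q * lead_coef h) != 0 by rewrite lq rmorphM mulf_neq0.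
    by rewrite rmorphM mulf_eq0 negb_or => /andP[].
  have q0 : q != 0.
    by apply: contraNneq lq' => ->; rewrite lead_coef0 rmorph0.
  have := Mm q lq' qy; rewrite -(size_scale M c0') -(size_polyDl (p:=c *: M) (q:=-r)) ?size_polyN //.
  rewrite -eq size_mul // leqNgt; case: (size h) sh => [|[|m]] // _.
  by rewrite !addnS /= ltnS leq_addr.
have eV : map_poly ev V = map_poly ev (0 * M + 1 * V).
  by rewrite mul0r add0r mul1r.
have [q2 [r2 [c2 [c20 e2 _ r20]]]] := red V (ex_intro _ 0 (ex_intro _ 1 eV)).
have : evp ev y (c2 *: V) = 0.
  by rewrite e2 rmorphD rmorphM /= hy mulr0 add0r evpE r20 horner0.
rewrite -mul_polyC rmorphM /= evpC => /eqP.
by rewrite mulf_eq0 (negPf c20) (negPf Vy).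
Qed.

Lemma min_poly_pseudo_dvd P : evp ev y P = 0 ->
  exists q r c, [/\ ev c != 0, c *: P = q * M + r & map_poly ev r = 0].
Proof.
move=> Py; have [lM My Mm] := Mmin.
exists (P %/ M), (P %% M), (lead_coef M ^+ scalp P M).
split; rewrite ?rmorphXn ?expf_neq0 ?divp_eq //.
apply: min_poly_kernel; first by rewrite ltn_modp min_poly_neq0.
have : evp ev y (lead_coef M ^+ scalp P M *: P) = 0.
  by rewrite -mul_polyC rmorphM /= Py mulr0.
by rewrite divp_eq rmorphD rmorphM /= My mulr0 add0r.
Qed.
End Minimal.

Variable k : closedFieldType.
(** Equivalently, [sp] factors through the image of [ev]: all relations valid at the generic point
    [ev] hold at the [k]-point [sp]. *)
Definition specializes (sp : {rmorphism R -> k}) := forall a, ev a = 0 -> sp a = 0.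

Lemma specializes_map sp P : specializes sp ->
  map_poly ev P = 0 -> map_poly sp P = 0.
Proof.
move=> hs /map_poly0_coef h; apply/polyP => i.
by rewrite coef_map coef0; apply: hs.
Qed.

Lemma specializes_root M sp eta : min_poly M -> specializes sp ->
  sp (lead_coef M) != 0 -> root (map_poly sp M) eta ->
  forall P, evp ev y P = 0 -> evp sp eta P = 0.
Proof.
move=> Mmin hs lM /rootP rt P Py.
apply/eqP; have [lM' My _] := Mmin.
have e := divp_eq P M; set c := lead_coef M ^+ _ in e.
have r0 : map_poly ev (P %% M) = 0.
  apply: (min_poly_kernel Mmin); first by rewrite ltn_modp (min_poly_neq0 Mmin).
  have : evp ev y (c *: P) = 0 by rewrite -mul_polyC rmorphM /= Py mulr0.
  by rewrite e rmorphD rmorphM /= My mulr0 add0r.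
have : evp sp eta (c *: P) = 0.
  rewrite e rmorphD rmorphM /= [evp sp eta M]evpE rt mulr0 add0r.
  by rewrite evpE (specializes_map hs) // horner0.
rewrite -mul_polyC rmorphM /= evpC => /eqP.
by rewrite mulf_eq0 /c rmorphXn expf_eq0 (negPf lM) andbF.
Qed.

(* Either [y] is algebraic, and [eta] is taken among the roots of the specialised
   minimal equation, or every [eta] off the zeros of [V] will do. *)
Lemma specializes_extend V : evp ev y V != 0 ->
  exists U, ev U != 0 /\ forall sp : {rmorphism R -> k}, specializes sp -> sp U != 0 ->
    exists eta, (forall P, evp ev y P = 0 -> evp sp eta P = 0) /\ evp sp eta V != 0.
Proof.
move=> Vy.
case: (classic (exists P, map_poly ev P != 0 /\ evp ev y P = 0)) => [[P [P0 Py]]|no].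
  have [M [Mmin _]] := min_poly_exists P0 Py.
  have [S [T [U [U0 e]]]] := min_poly_bezout Mmin Vy.
  have [lM _ _] := Mmin.
  (* Off [U], the identity [S * M + T * V = U] keeps [V] nonzero at every root of the specialised
     [M]; off the leading coefficient, such a root exists. *)
  exists (lead_coef M * U); split; first by rewrite rmorphM mulf_neq0.
  move=> sp hs; rewrite rmorphM mulf_eq0 negb_or => /andP[lsM sU].
  have sM : size (map_poly sp M) != 1%N.
    by rewrite size_map_poly_id0 // gtn_eqF // (min_poly_size Mmin).
  have /closed_rootP [eta rt] := sM.
  exists eta; split; first exact: (specializes_root Mmin).
  have : map_poly sp (S * M + T * V - U%:P) = 0.
    apply: specializes_map => //.
    by rewrite rmorphB /= e map_polyC subrr.
  move=> /(congr1 (fun p : {poly k} => p.[eta])).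
  rewrite horner0 -evpE rmorphB rmorphD !rmorphM /= [evp sp eta M]evpE (rootP rt) mulr0 add0r evpC.
  move=> /eqP; rewrite subr_eq0 => /eqP e'.
  by apply: contraNneq sU => V0; rewrite -e' V0 mulr0.
have Vne : map_poly ev V != 0.
  by apply: contraNneq Vy; rewrite evpE => ->; rewrite horner0.
exists V`_(size (map_poly ev V)).-1; split.
  by rewrite -coef_map /= -[_`_ _]/(lead_coef _) lead_coef_eq0.
move=> sp hs sV.
have /closed_nonrootP [eta nr] : map_poly sp V != 0.
  by apply: contraNneq sV => e; rewrite -coef_map /= e coef0.
exists eta; split=> // P Py; rewrite evpE (specializes_map hs) ?horner0 //.
by apply/eqP/negPn/negP => P0; apply: no; exists P.
Qed.
End Specialization.

(** An elementary form of Chevalley's theorem: extending one coordinate at a time, every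
    specialisation of the base off [U] lifts to the whole point [x], with [V] still nonzero. *)
Lemma specializes_mpoly (k : closedFieldType) (R E : idomainType)
    (ev : {rmorphism R -> E}) h (x : 'I_h -> E) (V : {mpoly R[h]}) :
  mmap ev x V != 0 ->
  exists U, ev U != 0 /\ forall sp : {rmorphism R -> k}, specializes ev sp -> sp U != 0 ->
    exists q : 'I_h -> k, (forall P, mmap ev x P = 0 -> mmap sp q P = 0) /\
      mmap sp q V != 0.
Proof.
elim: h x V => [|h IH] x V.
  rewrite (nvar0_mpolyC V) mmapC => V0; exists V@_0%MM; split=> // sp hs sV.
  exists (fun=> 0); split; last by rewrite mmapC.
  by move=> P; rewrite (nvar0_mpolyC P) !mmapC; apply: hs.
rewrite -muni_eval => /(specializes_extend k) [U [U0 hU]].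
have [U' [U'0 hU']] := IH _ _ U0.
exists U'; split=> // sp hs sU.
have [q [qs qU]] := hU' sp hs sU.
have [eta [es eV]] := hU (mmap sp q) qs qU.
pose q' (i : 'I_h.+1) := oapp q eta (insub (val i)).
have hx : q' ord_max = eta by rewrite /q' insubF //= ltnn.
have hw i : q' (wdn i) = q i.
  by rewrite /q' /= insubT //= => lt; congr q; apply/val_inj.
have e P : mmap sp q' P = evp (mmap sp q) eta (muni P).
  rewrite -muni_eval hx; apply: eq_evp => c; exact: eq_mmap.
exists q'; split=> [P|]; last by rewrite e.
by rewrite e -muni_eval => /es.
Qed.

(** * Algebraic independence *)

Lemma fin_choice (I T : Type) (Q : I -> T -> Prop) :
  (forall i, exists x, Q i x) -> exists f, forall i, Q i (f i).
Proof.
move=> h; exists (fun i => proj1_sig (constructive_indefinite_description _ (h i))).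
by move=> i; case: constructive_indefinite_description.
Qed.

Lemma row_relation (F : fieldType) (I J : finType) (M : I -> J -> F) :
  (#|J| < #|I|)%N ->
  exists v : I -> F, (exists i, v i != 0) /\ forall c, \sum_i v i * M i c = 0.
Proof.
move=> lt; pose A := \matrix_(i < #|I|, c < #|J|) M (enum_val i) (enum_val c).
have : kermx A != 0.
  rewrite kermx_eq0 /row_free neq_ltn (leq_ltn_trans (rank_leq_col A) lt) //.
move=> /rowV0Pn [u /sub_kermxP uA /rV0Pn [i ui]].
exists (fun x => u ord0 (enum_rank x)); split.
  by exists (enum_val i); rewrite enum_valK.
move=> c; have := congr1 (fun B : 'rV_#|J| => B ord0 (enum_rank c)) uA.
rewrite !mxE => e; rewrite -[RHS]e (reindex_onto enum_val enum_rank) /=; last first.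
  by move=> x _; rewrite enum_rankK.
apply: eq_big => [x|x _]; first by rewrite enum_valK eqxx.
by rewrite !mxE enum_valK enum_rankK.
Qed.

Lemma leq_card_bmultinom q B : (#|{: 'X_{1..q < B}}| <= B ^ q)%N.
Proof.
have lt (m : 'X_{1..q < B}) i : (m i < B)%N.
  by apply: leq_ltn_trans (bmdeg m); rewrite mdegE (bigD1 i) //= leq_addr.
pose f (m : 'X_{1..q < B}) : {ffun 'I_q -> 'I_B} := [ffun i => Ordinal (lt m i)].
have fI : injective f.
  move=> m1 m2 /ffunP e; apply/val_inj/mnmP => i.
  by have := congr1 val (e i); rewrite !ffunE.
by apply: leq_trans (leq_card f fI) _; rewrite card_ffun !card_ord.
Qed.

Lemma msizeM_leq (k : fieldType) n (p q : {mpoly k[n]}) :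
  (msize (p * q) <= msize p + msize q)%N.
Proof.
have [->|p0] := eqVneq p 0; first by rewrite mul0r msize0.
have [->|q0] := eqVneq q 0; first by rewrite mulr0 msize0.
by rewrite msizeM // leq_pred.
Qed.

Section Steinitz.
Variables (k : fieldType) (E : idomainType) (kap : {rmorphism k -> E}).

Definition indep q (w : 'I_q -> E) : Prop := forall p, mmap kap w p = 0 -> p = 0.

Definition algebraic_over q (w : 'I_q -> E) (y : E) : Prop :=
  exists P : {poly {mpoly k[q]}},
    map_poly (mmap kap w) P != 0 /\ evp (mmap kap w) y P = 0.

Variables (q l : nat) (w : 'I_q -> E) (phi : 'I_l -> E).
Local Notation ev := (mmap kap w).

(** Each equation is multiplied by a power of the unknown and by the leading coefficients of the
    others, so that all share one degree [r] and one leading coefficient [D]. *)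
Lemma algebraic_uniform : (forall i, algebraic_over w (phi i)) ->
  exists r D, [/\ (0 < r)%N, ev D != 0 & forall i, exists C : 'I_r -> {mpoly k[q]},
    ev D * phi i ^+ r = \sum_s ev (C s) * phi i ^+ s].
Proof.
move=> alg.
have /fin_choice [P hP] : forall i, exists P : {poly {mpoly k[q]}},
    ev (lead_coef P) != 0 /\ evp ev (phi i) P = 0.
  move=> i; have [P [P0 Py]] := alg i; have [Q [eQ lQ _]] := trim_kernel P0.
  by exists Q; split=> //; rewrite evpE eQ.
exists (\sum_i size (P i)).+1, (\prod_i lead_coef (P i)); split=> //.
  by rewrite rmorph_prod; apply/prodf_neq0 => i _; have [] := hP i.
move=> i; set r := (_.+1); pose d := (size (P i)).-1.
have dr : (d <= r)%N.
  apply: leq_trans (leq_pred _) _; rewrite /r (bigD1 i) //=.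
  by rewrite leqW // leq_addr.
pose c := \prod_(i' | i' != i) lead_coef (P i').
pose G := c%:P * P i * 'X^(r - d).
have Gy : evp ev (phi i) G = 0 by rewrite /G !rmorphM /= (hP i).2 mulr0 mul0r.
have Gi s : G`_s = if (s < r - d)%N then 0 else c * (P i)`_(s - (r - d)).
  by rewrite /G coefMXn coefCM.
exists (fun s => - G`_s).
have -> : \prod_i' lead_coef (P i') = G`_r.
  by rewrite Gi ltnNge leq_subr /= subKn // (bigD1 i) //= mulrC.
have sG : (size G <= r.+1)%N.
  apply/leq_sizeP => s lt; rewrite Gi ltnNge (leq_trans (leq_subr _ _) (ltnW lt)) /=.
  rewrite nth_default ?mulr0 //; move: lt dr; rewrite /d; move: (size (P i)) (r) => x y; clear; lia.
apply/eqP; rewrite -subr_eq0 -sumrN; apply/eqP.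
rewrite -[RHS]Gy evpE (@horner_coef_wide _ r.+1); last first.
  exact: leq_trans (size_poly _ _) sG.
rewrite [in RHS]big_ord_recr /= coef_map /= addrC; congr (_ + _).
by apply: eq_bigr => s _; rewrite coef_map rmorphN mulNr opprK.
Qed.

Section Span.
Variables (r : nat) (D : {mpoly k[q]}).
Hypothesis r0 : (0 < r)%N.
Hypothesis D0 : ev D != 0.
Variable C : 'I_l -> 'I_r -> {mpoly k[q]}.
Hypothesis HC : forall i, ev D * phi i ^+ r = \sum_s ev (C i s) * phi i ^+ s.

Definition pmon (b : {ffun 'I_l -> 'I_r}) : E := \prod_i phi i ^+ b i.

(** A filtration of the module spanned over [k[w]] by the monomials in [phi] with exponents below
    [r]: [n] bounds the size of the coefficients. *)
Definition inspan (n : nat) (x : E) : Prop :=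
  exists A : {ffun 'I_l -> 'I_r} -> {mpoly k[q]},
    (forall b, (msize (A b) <= n)%N) /\ x = \sum_b ev (A b) * pmon b.

Lemma inspan_leq m n x : (m <= n)%N -> inspan m x -> inspan n x.
Proof.
by move=> le [A [sA e]]; exists A; split=> // b; exact: leq_trans (sA b) le.
Qed.

Lemma inspan0 n : inspan n 0.
Proof.
exists (fun=> 0); split=> [b|]; first by rewrite msize0.
by rewrite big1 // => b _; rewrite rmorph0 mul0r.
Qed.

Lemma inspanD n x y : inspan n x -> inspan n y -> inspan n (x + y).
Proof.
move=> [A [sA ->]] [B [sB ->]]; exists (fun b => A b + B b); split.
  by move=> b; apply: leq_trans (msizeD_le _ _) _; rewrite geq_max sA sB.
by rewrite -big_split; apply: eq_bigr => b _; rewrite rmorphD mulrDl.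
Qed.

Lemma inspanM n c x : inspan n x -> inspan (n + msize c) (ev c * x).
Proof.
move=> [A [sA ->]]; exists (fun b => c * A b); split=> [b|].
  by apply: leq_trans (msizeM_leq _ _) _; rewrite addnC leq_add2r.
by rewrite mulr_sumr; apply: eq_bigr => b _; rewrite rmorphM mulrA.
Qed.

Lemma inspanZ n (a : k) x : inspan n x -> inspan n (kap a * x).
Proof.
move=> [A [sA ->]]; exists (fun b => a *: A b); split=> [b|].
  exact: leq_trans (msizeZ_le _ _) _.
by rewrite mulr_sumr; apply: eq_bigr => b _; rewrite mmapZ mulrA.
Qed.

Lemma inspan_sum (I : Type) (s : seq I) (P : pred I) F n :
  (forall i, P i -> inspan n (F i)) -> inspan n (\sum_(i <- s | P i) F i).
Proof.
move=> h; apply: big_ind => //; [exact: inspan0|exact: inspanD].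
Qed.

Lemma inspan_pmon b : inspan 1 (pmon b).
Proof.
exists (fun b' => (b' == b)%:R); split=> [b'|].
  by case: eqP => _; rewrite ?msize1 ?msize0.
rewrite (bigD1 b) //= eqxx rmorph1 mul1r big1 ?addr0 // => b' /negPf ->.
by rewrite rmorph0 mul0r.
Qed.

Definition raises (c : nat) (th : E) : Prop :=
  forall n x, inspan n x -> inspan (n + c) (th * x).

(** Multiplying a reduced monomial by [ev D * phi i] needs the equation of [phi i] at most once, so
    this shift covers every [i]. *)
Definition step := (msize D + \sum_i \sum_s msize (C i s)).+1.

Lemma inspan_step i b : inspan step (ev D * phi i * pmon b).
Proof.
pose upd (s : 'I_r) : {ffun 'I_l -> 'I_r} := [ffun i' => if i' == i then s else b i'].
have updE s : pmon (upd s) = phi i ^+ s * \prod_(i' | i' != i) phi i' ^+ b i'.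
  rewrite /pmon (bigD1 i) //= ffunE eqxx; congr (_ * _).
  by apply: eq_bigr => i' /negPf ne; rewrite ffunE ne.
have -> : ev D * phi i * pmon b =
    ev D * phi i ^+ (b i).+1 * \prod_(i' | i' != i) phi i' ^+ b i'.
  by rewrite /pmon (bigD1 i) //= exprS !mulrA.
case: (ltnP (b i).+1 r) => [lt|ge].
  rewrite -mulrA -(updE (Ordinal lt)).
  apply: inspan_leq (inspanM D (inspan_pmon _)).
  by rewrite add1n /step ltnS leq_addr.
have -> : (b i).+1 = r by apply/eqP; rewrite eqn_leq ge ltn_ord.
rewrite HC mulr_suml; apply: inspan_sum => s _.
rewrite -mulrA -updE; apply: inspan_leq (inspanM _ (inspan_pmon _)).
rewrite add1n /step ltnS; apply: leq_trans (leq_addl _ _).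
by rewrite (bigD1 i) //= (bigD1 s) //= -addnA leq_addr.
Qed.

Lemma raises_phi i : raises step (ev D * phi i).
Proof.
move=> n x [A [sA ->]]; rewrite mulr_sumr; apply: inspan_sum => b _.
rewrite mulrCA; apply: inspan_leq (inspanM (A b) (inspan_step i b)).
by rewrite addnC leq_add2r.
Qed.

Lemma raises_D : raises step (ev D).
Proof.
move=> n x h; apply: inspan_leq (inspanM D h).
by rewrite leq_add2l /step leqW // leq_addr.
Qed.

Lemma raises_leq a b th : (a <= b)%N -> raises a th -> raises b th.
Proof. by move=> le h n x hx; apply: inspan_leq (h n x hx); rewrite leq_add2l. Qed.

Lemma raises1 : raises 0 1.
Proof. by move=> n x; rewrite addn0 mul1r. Qed.

Lemma raisesM a b x y : raises a x -> raises b y -> raises (a + b) (x * y).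
Proof.
by move=> hx hy n z hz; rewrite addnA addnAC -mulrA; apply/hx/hy.
Qed.

Lemma raisesX a x n : raises a x -> raises (a * n) (x ^+ n).
Proof.
move=> hx; elim: n => [|n IH]; first by rewrite muln0 expr0; apply: raises1.
by rewrite mulnS exprS; apply: raisesM.
Qed.

Lemma raisesD a x y : raises a x -> raises a y -> raises a (x + y).
Proof. by move=> hx hy n z hz; rewrite mulrDl; apply: inspanD; [apply: hx|apply: hy]. Qed.

Lemma raises_prod p a (x : 'I_p -> E) :
  (forall i, raises a (x i)) -> raises (a * p) (\prod_i x i).
Proof.
elim: p x => [|p IH] x h; first by rewrite big_ord0 muln0; apply: raises1.
by rewrite big_ord_recl mulnS; apply: raisesM => //; apply: IH.
Qed.

Lemma raises_poly (t : {mpoly k[l]}) :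
  exists m c, raises c (ev D ^+ m * mmap kap phi t).
Proof.
elim/mpoly_alg_ind: t => [a|i|t1 t2 [m1 [c1 h1]] [m2 [c2 h2]]|t1 t2 [m1 [c1 h1]] [m2 [c2 h2]]].
- exists 0%N, 0%N; rewrite expr0 mul1r mmapC => n x h.
  by rewrite addn0; apply: inspanZ.
- by exists 1%N, step; rewrite expr1 mmapXU; apply: raises_phi.
- exists (m1 + m2)%N, (step * m2 + c1 + (step * m1 + c2))%N.
  rewrite rmorphD mulrDr /=; apply: raisesD.
    rewrite addnC exprD -mulrA mulrCA.
    apply: raises_leq (raisesM (raisesX m2 raises_D) h1).
    exact: leq_addl.
  rewrite exprD -mulrA.
  apply: raises_leq (raisesM (raisesX m1 raises_D) h2).
  exact: leq_addl.
- exists (m1 + m2)%N, (c1 + c2)%N.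
  by rewrite rmorphM exprD mulrACA; apply: raisesM.
Qed.

Lemma raises_uniform p (t : 'I_p -> {mpoly k[l]}) :
  exists m c, raises c (ev D ^+ m) /\
    forall i, raises c (ev D ^+ m * mmap kap phi (t i)).
Proof.
elim: p t => [|p IH] t.
  by exists 0%N, 0%N; split=> [|[]//]; rewrite expr0; apply: raises1.
have [m1 [c1 [h1 H1]]] := IH (fun i => t (lift ord0 i)).
have [m2 [c2 h2]] := raises_poly (t ord0).
exists (m1 + m2)%N, (step * m1 + c1 + (step * m2 + c2))%N; split.
  rewrite exprD; apply: raises_leq (raisesM h1 (raisesX m2 raises_D)).
  lia.
move=> i; case: (unliftP ord0 i) => [i'|] ->.
  rewrite exprD -mulrA mulrCA.
  apply: raises_leq (raisesM (raisesX m2 raises_D) (H1 i')).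
  lia.
rewrite exprD -mulrA.
apply: raises_leq (raisesM (raisesX m1 raises_D) h2).
lia.
Qed.

(* The monomials of degree less than [n] in each [t i] are about [n ^ p] elements
   of a space of dimension [O(n ^ q)]: if [q < p] they are linearly dependent. *)
Lemma span_bound p (t : 'I_p -> {mpoly k[l]}) :
  indep (fun i => mmap kap phi (t i)) -> (p <= q)%N.
Proof.
move=> ind; rewrite leqNgt; apply/negP => ltqp.
have [m [c [hD ht]]] := raises_uniform t.
(* Large enough for [r ^ l * B ^ q < n ^ p]: since [B <= n * (1 + c * p)] and [q < p], one spare
   factor [n] beats the constant. *)
pose n := (r ^ l * (1 + c * p) ^ q).+1.
pose B := (1 + c * n * p)%N.
pose tau i := mmap kap phi (t i).
(* Padding by powers of [D ^ m] gives all monomials the same extra factor, so a linear relation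
   among the [W al] is a relation among monomials in the [tau i]. *)
pose W (al : {ffun 'I_p -> 'I_n}) :=
  \prod_i ((ev D ^+ m * tau i) ^+ al i * (ev D ^+ m) ^+ (n - al i)).
have WE al : W al = (ev D ^+ m) ^+ n ^+ p * \prod_i tau i ^+ al i.
  rewrite -[X in _ ^+ X * _](card_ord p) -prodr_const -big_split.
  apply: eq_bigr => i _; rewrite exprMn mulrAC -exprD subnKC //.
  exact: ltnW.
have hW al : inspan B (W al).
  rewrite -[W al]mulr1.
  have r1 i : raises (c * n) ((ev D ^+ m * tau i) ^+ al i * (ev D ^+ m) ^+ (n - al i)).
    rewrite -[X in raises (c * X)%N](subnKC (ltnW (ltn_ord (al i)))) mulnDr.
    exact: (raisesM (raisesX _ (ht i)) (raisesX _ hD)).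
  apply: (raises_prod r1); pose z : {ffun 'I_l -> 'I_r} := [ffun=> Ordinal r0].
  suff -> : 1 = pmon z by apply: inspan_pmon.
  by rewrite /pmon big1 // => i _; rewrite ffunE expr0.
have [A hA] := fin_choice hW.
pose M (al : {ffun 'I_p -> 'I_n}) (bm : {ffun 'I_l -> 'I_r} * 'X_{1..q < B}) : k :=
  (A al bm.1)@_(bm.2).
have lt : (#|{: {ffun 'I_l -> 'I_r} * 'X_{1..q < B}}| < #|{ffun 'I_p -> 'I_n}|)%N.
  rewrite card_prod !card_ffun !card_ord.
  apply: leq_ltn_trans (leq_mul (leqnn _) (leq_card_bmultinom q B)) _.
  have le1 : (B <= n * (1 + c * p))%N.
    by rewrite mulnDr muln1 /B mulnA [(n * c)%N]mulnC leq_add2r.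
  apply: leq_ltn_trans (leq_mul (leqnn _) (_ : (_ <= (n * (1 + c * p)) ^ q)%N)) _.
    by have [->|q0] := posnP q; rewrite ?expn0 // leq_exp2r.
  rewrite expnMn mulnCA -[X in (_ < n ^ X)%N](subnKC ltqp) expnD expnSr.
  apply: leq_trans (leq_pmulr _ _); last by rewrite expn_gt0.
  by rewrite ltn_pmul2l ?expn_gt0.
have [v [[a0 va0] hv]] := row_relation M lt.
pose X (al : {ffun 'I_p -> 'I_n}) : 'X_{1..p} := [multinom (al i : nat) | i < p].
pose F : {mpoly k[p]} := \sum_al v al *: 'X_[X al].
have XI : injective X.
  move=> x y /mnmP e; apply/ffunP => i; apply/val_inj.
  by have := e i; rewrite !mnmE.
have F0 : F = 0.
  apply: ind; rewrite -/tau rmorph_sum /=.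
  have -> : \sum_al mmap kap tau (v al *: 'X_[X al]) =
      \sum_al kap (v al) * \prod_i tau i ^+ al i.
    apply: eq_bigr => al _; rewrite mmapZ mmapX /mmap1; congr (_ * _).
    by apply: eq_bigr => i _; rewrite mnmE.
  apply/eqP; rewrite -(mulrI_eq0 _ (@mulfI _ ((ev D ^+ m) ^+ n ^+ p) _)) ?expf_neq0 //.
  rewrite mulr_sumr.
  have -> : \sum_al (ev D ^+ m) ^+ n ^+ p * (kap (v al) * \prod_i tau i ^+ al i) =
     \sum_al \sum_bm kap (v al * M al bm) * (mmap1 w bm.2 * pmon bm.1).
    apply: eq_bigr => al _; rewrite mulrCA -WE (hA al).2.
    rewrite mulr_sumr -(pair_bigA _ (fun b m' => kap (v al * M al (b, m')) * (mmap1 w m' * pmon b))) /=.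
    apply: eq_bigr => b _; rewrite (mmapE _ ((hA al).1 b)) mulr_suml mulr_sumr.
    by apply: eq_bigr => m' _; rewrite rmorphM !mulrA.
  rewrite exchange_big big1 // => bm _.
  by rewrite -mulr_suml -rmorph_sum hv rmorph0 mul0r.
have := congr1 (mcoeff (X a0)) F0; rewrite mcoeff0 /F raddf_sum /=.
rewrite (bigD1 a0) //= mcoeffZ mcoeffX eqxx mulr1 big1 ?addr0 => [e|al ne].
  by rewrite e eqxx in va0.
by rewrite mcoeffZ mcoeffX (inj_eq XI) (negPf ne) mulr0.
Qed.
End Span.

Lemma steinitz p (t : 'I_p -> {mpoly k[l]}) :
  (forall i, algebraic_over w (phi i)) ->
  indep (fun i => mmap kap phi (t i)) -> (p <= q)%N.
Proof.
move=> /algebraic_uniform [r [D [r0 D0 /fin_choice [C HC]]]].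
exact: (span_bound r0 D0 HC).
Qed.
End Steinitz.

(** * Projection of cones to hypersurfaces *)

Lemma map_resultant_coef (R S : comNzRingType) (f : {rmorphism R -> S}) (p q : {poly R}) :
  f (lead_coef p) != 0 -> f (lead_coef q) != 0 ->
  f (resultant p q) = resultant (map_poly f p) (map_poly f q).
Proof.
move=> nz_fp nz_fq; rewrite /resultant /Sylvester_mx !size_map_poly_id0 //.
rewrite -det_map_mx /= map_col_mx; congr (\det (col_mx _ _));
  by apply: map_lin1_mx => v; rewrite map_poly_rV rmorphM /= map_rVpoly.
Qed.

Lemma dhomog_mdeg (R : nzRingType) n d (p : {mpoly R[n]}) m :
  p \is d.-homog -> m \in msupp p -> mdeg m = d.
Proof. by move=> hp mp; apply: (dhomog_mf hp mp). Qed.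

Lemma dhomogXU (R : nzRingType) n i : ('X_i : {mpoly R[n]}) \is 1.-homog.
Proof. by rewrite dhomogX; apply/eqP/mdeg1. Qed.

Lemma field_rmorph_eq0 (k : fieldType) (E : nzRingType) (f : {rmorphism k -> E}) c :
  f c = 0 -> c = 0.
Proof. by move=> /eqP; rewrite fmorph_eq0 => /eqP. Qed.

Lemma dhomog_mmap (k : fieldType) n m d (h : 'I_n -> {mpoly k[m]}) (p : {mpoly k[n]}) :
  (forall i, h i \is 1.-homog) -> p \is d.-homog ->
  mmap (@mpolyC m k) h p \is d.-homog.
Proof.
move=> hh hp; rewrite /mmap big_seq; apply: rpred_sum => mo mp.
rewrite mul_mpolyC; apply: rpredZ.
rewrite -(dhomog_mdeg hp mp) mdegE /mmap1.
elim: (index_enum _) => [|i r IH]; first by rewrite !big_nil dhomog1.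
rewrite !big_cons; apply: dhomogM IH.
by have := dhomogMn (mo i) (hh i); rewrite mul1n.
Qed.

Lemma meval_homog (k : fieldType) n d (p : {mpoly k[n]}) (s : k) v :
  p \is d.-homog -> p.@[fun i => s * v i] = s ^+ d * p.@[v].
Proof.
move=> hp; rewrite !mevalE mulr_sumr !big_seq; apply: eq_bigr => m mp.
rewrite mulrCA; congr (_ * _).
rewrite -(dhomog_mdeg hp mp) mdegE -prodrXr -big_split.
by apply: eq_bigr => i _; rewrite exprMn.
Qed.

Lemma meval0_homog (k : fieldType) n d (p : {mpoly k[n]}) v :
  (0 < d)%N -> p \is d.-homog -> (forall i, v i = 0) -> p.@[v] = 0.
Proof.
move=> d0 hp v0; have := meval_homog 0 v hp.
rewrite expr0n gtn_eqF // mul0r => <-; apply: meval_eq => i.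
by rewrite v0 mulr0.
Qed.

(** Adding a multiple of [G] to [P] preserves the common roots with [G]; this multiple is high
    enough to impose the leading coefficient of [G]. *)
Lemma lead_coef_shift (R : idomainType) (P G : {poly R}) : G != 0 ->
  lead_coef (P + 'X^(size P) * G) = lead_coef G /\
  size (P + 'X^(size P) * G) = (size P + size G)%N.
Proof.
move=> G0; have s1 : size ('X^(size P) * G) = (size P + size G)%N.
  by rewrite mulrC size_mulXn // addnC.
have lt : (size P < size ('X^(size P) * G)%R)%N.
  by rewrite s1 -[X in (X < _)%N]addn0 ltn_add2l size_poly_gt0.
by rewrite addrC lead_coefDl // size_polyDl // lead_coefM lead_coefXn mul1r.
Qed.

Section Projection.
Variables (k : closedFieldType) (E : idomainType) (kap : {rmorphism k -> E}).

(** The forms with coefficient matrix [B] are evaluated over any ring receiving [k], so that generic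
    points and points of [k] are treated alike. *)
Definition lin j n (B : 'I_j -> 'I_n -> k) (S : nzRingType) (f : k -> S) (z : 'I_n -> S)
  (i : 'I_j) : S := \sum_c f (B i c) * z c.

Lemma lin_id n (S : nzRingType) (f : {rmorphism k -> S}) z :
  lin (fun i c : 'I_n => (i == c)%:R) f z =1 z.
Proof.
move=> i; rewrite /lin (bigD1 i) //= eqxx rmorph1 mul1r big1 ?addr0 // => c ne.
by rewrite eq_sym (negPf ne) rmorph0 mul0r.
Qed.

Definition linear_pullback n l (C : 'I_n -> 'I_l -> k) (f : {mpoly k[n]}) :
  {mpoly k[l]} := mmap (@mpolyC l k) (lin C (@mpolyC l k) (fun c => 'X_c)) f.

Lemma linear_pullbackE n l (C : 'I_n -> 'I_l -> k) f (S : comNzRingType)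
    (g : {rmorphism k -> S}) z :
  mmap g z (linear_pullback C f) = mmap g (lin C g z) f.
Proof.
rewrite /linear_pullback (rmorph_mmap (mmap g z) (@mpolyC l k)).
apply: eq_mmap => [c|i] /=; first by rewrite mmapC.
rewrite /lin rmorph_sum; apply: eq_bigr => c _.
by rewrite rmorphM /= mmapC mmapXU.
Qed.

Definition dproj_lin j n (lam : 'I_j.+1 -> k) (i0 : 'I_j.+1) (B : 'I_j.+1 -> 'I_n -> k)
    (i : 'I_j) (c : 'I_n) : k :=
  B (lift i0 i) c - lam (lift i0 i) / lam i0 * B i0 c.

Lemma dproj_linE j n (lam : 'I_j.+1 -> k) (i0 : 'I_j.+1) (B : 'I_j.+1 -> 'I_n -> k)
    (S : comNzRingType) (f : {rmorphism k -> S}) z :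
  dproj lam i0 f (lin B f z) =1 lin (dproj_lin lam i0 B) f z.
Proof.
move=> i; rewrite /dproj /lin mulr_sumr -sumrB; apply: eq_bigr => c _.
by rewrite rmorphB [f (_ * B _ _)]rmorphM mulrBl mulrA.
Qed.

Lemma dcoord_linE j n (lam : 'I_j.+1 -> k) (i0 : 'I_j.+1) (B : 'I_j.+1 -> 'I_n -> k)
    (S : comNzRingType) (f : {rmorphism k -> S}) z :
  dcoord lam i0 f (lin B f z) = \sum_c f ((lam i0)^-1 * B i0 c) * z c.
Proof.
rewrite /dcoord /lin mulr_sumr; apply: eq_bigr => c _.
by rewrite rmorphM mulrA.
Qed.

Definition dlift j (i0 : 'I_j.+1) (mu : 'I_j -> k) (i : 'I_j.+1) : k :=
  oapp mu 0 (unlift i0 i).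

(* Elimination of the coordinate along a direction on which [g] does not vanish:
   [g] depends only on coordinates vanishing at [alp], so on the line through
   [alp] in that direction it vanishes at [alp] only, where [p] does not. *)
Lemma project_step j (ze : 'I_j.+1 -> E) (alp : 'I_j.+1 -> k) i0 D
    (p : {mpoly k[j.+1]}) (g : {mpoly k[j]}) :
  alp i0 != 0 -> mmap kap ze p = 0 -> p.@[alp] != 0 ->
  g \is D.-homog -> g != 0 -> mmap kap (dproj alp i0 kap ze) g = 0 ->
  exists lam i1 (p' : {mpoly k[j]}), [/\ lam i1 != 0,
    mmap kap (dproj lam i1 kap ze) p' = 0 &
    p'.@[dproj lam i1 idfun alp] != 0].
Proof.
move=> a0 pz pa hg g0 gz.
have D0 : (0 < D)%N.
  rewrite lt0n; apply/eqP => e; rewrite e in hg.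
  have /msize1_polyC eg : (msize g <= 1)%N.
    rewrite msizeE; apply/bigmax_leqP_seq => m mg _.
    by rewrite (dhomog_mdeg hg mg).
  move: gz g0; rewrite eg mmapC => /field_rmorph_eq0 ->.
  by rewrite mpolyC0 eqxx.
have [mu gmu] := mpoly_nonvanishing g0.
have [i mui] : exists i, mu i != 0.
  apply: NNPP => no; have := gmu; rewrite (meval0_homog D0 hg) ?eqxx // => i.
  by apply/eqP/negPn/negP => h; apply: no; exists i.
pose lam := dlift i0 mu; pose i1 := lift i0 i.
have l1 : lam i1 != 0 by rewrite /lam /dlift /i1 liftK.
(* The pullback of [g] under the projection from [alp], hence constant along the direction [alp]; at
   [lam], which lifts [mu], it takes the nonzero value [g.@[mu]]. *)
pose g' := mmap (@mpolyC j.+1 k) (dproj alp i0 (@mpolyC j.+1 k) (fun i => 'X_i)) g.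
have g'E (S : comNzRingType) (f : {rmorphism k -> S}) z :
    mmap f z g' = mmap f (dproj alp i0 f z) g.
  rewrite /g' (rmorph_mmap (mmap f z) (@mpolyC j.+1 k)); apply: eq_mmap => [c|i'] /=.
    by rewrite mmapC.
  by rewrite /dproj rmorphB (rmorphM (mmap f z)) /= mmapC !mmapXU.
have hg' : g' \is D.-homog.
  apply: dhomog_mmap hg => i'; rewrite /dproj rpredB ?dhomogXU //.
  by rewrite mul_mpolyC rpredZ // dhomogXU.
have prl : dproj alp i0 idfun lam =1 mu.
  by move=> i'; rewrite /dproj /lam /dlift liftK unlift_none /= mulr0 subr0.
have g'l : g'.@[lam] = g.@[mu].
  by rewrite [LHS]g'E /meval; apply: eq_mmap.
set ev := mmap kap (dproj lam i1 kap ze).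
pose sp : {rmorphism {mpoly k[j]} -> k} := mmap idfun (dproj lam i1 idfun alp).
have [P P0 hP] : exists2 P : {poly {mpoly k[j]}}, P != 0 &
    forall (S : comNzRingType) (f : {rmorphism k -> S}) z,
    evp (mmap f (dproj lam i1 f z)) (dcoord lam i1 f z) P = mmap f z p.
  exists (dpoly lam i1 p); last by move=> S f z; apply: dpoly_eval.
  apply: contraNneq pa => e; rewrite -[p](dpolyK l1) e rmorph0.
  by rewrite meval0.
have [G [hG GD sG]] : exists G : {poly {mpoly k[j]}}, [/\
    forall (S : comNzRingType) (f : {rmorphism k -> S}) z,
    evp (mmap f (dproj lam i1 f z)) (dcoord lam i1 f z) G = mmap f z g',
    G`_D = (g.@[mu])%:MP & (size G <= D.+1)%N].
  exists (dpoly lam i1 g'); split; first by move=> S f z; apply: dpoly_eval.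
    by rewrite (coef_dpoly_homog _ _ hg') g'l.
  apply: leq_trans (size_dpoly _ _ _) _.
  by rewrite msizeE; apply/bigmax_leqP_seq => m mg _; rewrite (dhomog_mdeg hg' mg).
have {}sG : size G = D.+1.
  apply/eqP; rewrite eqn_leq sG.
  rewrite ltnNge; apply/negP => /leq_sizeP /(_ D (leqnn D)) /eqP.
  by rewrite GD mpolyC_eq0 (negPf gmu).
have G0 : G != 0 by rewrite -size_poly_gt0 sG.
have lG : lead_coef G = (g.@[mu])%:MP by rewrite lead_coefE sG.
have Py : evp ev (dcoord lam i1 kap ze) P = 0 by rewrite hP.
have Gy : evp ev (dcoord lam i1 kap ze) G = 0 by rewrite hG g'E.
(* The leading coefficient of [P] may vanish under [sp]. That of [P1] is a nonzero constant, so the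
   resultant commutes with [sp]. *)
pose P1 := P + 'X^(size P) * G.
have [lP1 sP1] := lead_coef_shift P G0; rewrite -/P1 lG in lP1; rewrite -/P1 sG in sP1.
have spC c : sp c%:MP = c by rewrite /sp /= mmapC.
exists lam, i1, (resultant P1 G); split=> //.
  have s1 : (1 < size P1)%N by rewrite sP1 addnS ltnS (leq_trans D0) ?leq_addl.
  have s2 : (1 < size G)%N by rewrite sG ltnS.
  have [u _ eu] := resultant_in_ideal s1 s2.
  rewrite -(evpC (mmap kap (dproj lam i1 kap ze)) (dcoord lam i1 kap ze)) eu rmorphD !rmorphM /= Gy mulr0 addr0.
  by rewrite /P1 rmorphD rmorphM /= Py Gy mulr0 addr0 mulr0.
rewrite /meval -[mmap _ _ _]/(sp _) map_resultant_coef ?lP1 ?lG ?spC // resultant_eq0 -leqNgt.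
rewrite leqNgt; apply/negP => sg.
have [|x] := closed_rootP (gcdp (map_poly sp P1) (map_poly sp G)) _.
  by rewrite neq_ltn sg orbT.
rewrite root_gcd => /andP[/rootP r1 /rootP r2].
(* On the line [alp + s * lam] the value of [g'] is [s ^+ D * g.@[mu]], so a common root forces
   [s = 0]. *)
have ex : x = dcoord lam i1 idfun alp.
  pose z i' := alp i' + (x - dcoord lam i1 idfun alp) * lam i'.
  have e1 : dproj lam i1 idfun z =1 dproj lam i1 idfun alp.
    move=> i'; rewrite /dproj /z /= mulrDr opprD addrACA [X in _ + X](_ : _ = 0) ?addr0 //.
    by rewrite mulrCA divfK // subrr.
  have e2 : dcoord lam i1 idfun z = x.
    by rewrite /dcoord /z /= mulrDr mulrCA mulVf // mulr1 addrC subrK.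
  have : mmap idfun z g' = 0.
    rewrite -hG e2 -[RHS]r2 evpE.
    by congr (_.[_]); apply: eq_map_poly => c; apply: eq_mmap.
  rewrite g'E.
  have e3 : dproj alp i0 idfun z =1
      (fun i' => (x - dcoord lam i1 idfun alp) * mu i').
    move=> i'; rewrite -prl /dproj /z /= mulrDr opprD addrACA.
    by rewrite divfK // subrr add0r mulrBr mulrCA.
  rewrite (eq_mmap _ (fun=> erefl) e3) -/(meval _ g) (meval_homog _ _ hg) => /eqP.
  rewrite mulf_eq0 (negPf gmu) orbF expf_eq0 D0 subr_eq0.
  by move/eqP.
have := r1; rewrite /P1 rmorphD rmorphM hornerD hornerM r2 mulr0 addr0 ex -evpE.
by rewrite hP => e; rewrite /meval e eqxx in pa.
Qed.
End Projection.

Lemma msize_homog (R : nzRingType) n d (p : {mpoly R[n]}) :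
  p \is d.-homog -> (msize p <= d.+1)%N.
Proof.
move=> hp; rewrite msizeE; apply/bigmax_leqP_seq => m mp _.
by rewrite (dhomog_mdeg hp mp).
Qed.

Lemma pihomog_neq0 (R : nzRingType) n (p : {mpoly R[n]}) :
  p != 0 -> exists d, pihomog mdeg d p != 0.
Proof.
move=> p0; apply: NNPP => no; case/eqP: p0.
rewrite [LHS](pihomog_partitionE (mf := mdeg) (leqnn (msize p))) big1 // => d _.
by apply/eqP/negPn/negP => h; apply: no; exists d.
Qed.

(* In characteristic [p] a polynomial with vanishing partial derivatives is a
   [p]-th power, [k] being perfect. *)
Lemma mderiv_eq0_pth_power (k : closedFieldType) n (f : {mpoly k[n]}) :
  (forall i, f^`M(i) = 0) ->
  (exists c, f = c%:MP) \/ exists p h, (1 < p)%N /\ f = h ^+ p.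
Proof.
move=> df; have cf m i : f@_m *+ m i = 0.
  case: (posnP (m i)) => [->//|mi].
  have := congr1 (mcoeff (m - U_(i))) (df i).
  rewrite mcoeff_mderiv mcoeff0 mnmBE mnm1E eqxx subn1 prednK //.
  rewrite submK // lep1mP -lt0n //.
case: (classic (exists p, p \in [pchar k])) => [[p pc]|noc]; last first.
  left; exists (f@_0%MM); apply/mpolyP => m; rewrite mcoeffC.
  case: eqVneq => [->|m0]; first by rewrite mulr1.
  rewrite mulr0; have [i mi] : exists i, (0 < m i)%N.
    apply: NNPP => no; case/eqP: m0; apply/mnmP => i; rewrite mnm0E.
    by apply/eqP; rewrite -leqn0 leqNgt; apply/negP => h; apply: no; exists i.
  apply/eqP; have /eqP := cf m i; rewrite -mulr_natr mulf_eq0 => /orP[//|/eqP e].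
  by case: (natf0_pchar mi (introT eqP e)) => p hp; case: noc; exists p.
right; exists p.
have pp : prime p := pcharf_prime pc.
have root c : exists r : k, r ^+ p = c.
  have sz : size ('X^p - c%:P : {poly k}) != 1%N.
    by rewrite size_XnsubC ?prime_gt0 // eqSS -lt0n prime_gt0.
  have /closed_rootP [r] := sz.
  by rewrite /root !hornerE subr_eq0 => /eqP; exists r.
have [rt hrt] := fin_choice root.
have dv m i : m \in msupp f -> (p %| m i)%N.
  rewrite mcoeff_msupp => fm; have /eqP := cf m i.
  by rewrite -mulr_natr mulf_eq0 (negPf fm) /= (dvdn_pcharf pc).
pose h := \sum_(m <- msupp f) rt f@_m *: 'X_[[multinom (m i %/ p)%N | i < n]].
exists h; split; first exact: prime_gt1.
have pc' : p \in [pchar {mpoly k[n]}] by apply: (rmorph_pchar (@mpolyC n k)).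
rewrite -(pFrobenius_autE pc') /h rmorph_sum [LHS]mpolyE !big_seq.
apply: eq_bigr => m mf; rewrite /= pFrobenius_autE exprZn hrt; congr (_ *: _).
rewrite mpolyXn; congr 'X_[_]; apply/mnmP => i.
by rewrite mulmnE mnmE divnK // dv.
Qed.

(** * Normal form of a separating hypersurface *)

Section NormalForm.
Variables (k : closedFieldType) (E : idomainType) (kap : {rmorphism k -> E}).
Variables (n : nat) (psi : 'I_n -> E) (a : 'I_n -> k).

(** Homogeneity of the ideal of relations of [z]; conicity of the orbit enters the projection
    argument in this form. *)
Definition homog_stable j (z : 'I_j -> E) : Prop := forall g d,
  mmap kap z g = 0 -> mmap kap z (pihomog mdeg d g) = 0.

Hypothesis Hom : forall j (B : 'I_j -> 'I_n -> k), homog_stable (lin B kap psi).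

Lemma homog_separate j (z : 'I_j -> E) (al : 'I_j -> k) g :
  homog_stable z -> mmap kap z g = 0 -> g.@[al] != 0 ->
  exists d g', [/\ g' \is d.-homog, mmap kap z g' = 0, g'.@[al] != 0 &
    (d < msize g)%N].
Proof.
move=> hz gz ga; apply: NNPP => no; case/eqP: ga.
rewrite (pihomog_partitionE (mf := mdeg) (leqnn (msize g))) rmorph_sum big1 // => d _.
apply/eqP/negPn/negP => h; apply: no.
exists (val d), (pihomog mdeg d g).
by split; [exact: pihomogP|exact: hz|exact: h|exact: ltn_ord].
Qed.

Lemma homog_positive j (z : 'I_j -> E) (al : 'I_j -> k) d g :
  g \is d.-homog -> mmap kap z g = 0 -> g.@[al] != 0 -> (0 < d)%N.
Proof.
move=> hg gz ga; rewrite lt0n; apply/eqP => e; rewrite e in hg.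
have eg := msize1_polyC (msize_homog hg).
by move: gz ga; rewrite eg mmapC mevalC => /field_rmorph_eq0 ->; rewrite eqxx.
Qed.

Lemma homog_nonzero_coord j d (g : {mpoly k[j]}) (al : 'I_j -> k) :
  (0 < d)%N -> g \is d.-homog -> g.@[al] != 0 -> exists i, al i != 0.
Proof.
move=> d0 hg ga; apply: NNPP => no; case/eqP: ga.
apply: (meval0_homog d0 hg) => i.
by apply/eqP/negPn/negP => h; apply: no; exists i.
Qed.

(** Take the least number of linear forms that still separate [a]. A relation among the forms left
    after projecting from the image of [a] would let [project_step] drop one more. *)
Lemma projection_exists p : mmap kap psi p = 0 -> p.@[a] != 0 ->
  exists j (B : 'I_j.+1 -> 'I_n -> k) i0, [/\ lin B idfun a i0 != 0,
    indep kap (dproj (lin B idfun a) i0 kap (lin B kap psi)) &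
    exists p', mmap kap (lin B kap psi) p' = 0 /\ p'.@[lin B idfun a] != 0].
Proof.
move=> pz pa.
pose T := {j : nat & 'I_j -> 'I_n -> k}.
pose Q (x : T) := exists p', mmap kap (lin (projT2 x) kap psi) p' = 0 /\
  p'.@[lin (projT2 x) idfun a] != 0.
have Q0 : exists x, Q x.
  exists (existT (fun j => 'I_j -> 'I_n -> k) n (fun i c => (i == c)%:R)).
  exists p; split; first by rewrite -[RHS]pz; apply: eq_mmap => //; apply: lin_id.
  by rewrite (meval_eq _ (lin_id idfun a)).
have [[j B] [[p' [pz' pa']] mn]] := ex_minimal (fun x : T => projT1 x) Q0.
rewrite /= in pz' pa' mn.
case: j B p' pz' pa' mn => [|j] B p' pz' pa' mn.
  by move: pz' pa'; rewrite (nvar0_mpolyC p') mmapC mevalC => /field_rmorph_eq0 ->;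
    rewrite eqxx.
set ze := lin B kap psi in pz' *; set al := lin B idfun a in pa' *.
have [d [g [hg gz ga _]]] := homog_separate (@Hom _ B) pz' pa'.
have [i0 ai0] := homog_nonzero_coord (homog_positive hg gz ga) hg ga.
exists j, B, i0; split=> //; last by exists p'.
move=> q qz; apply/eqP/negPn/negP => q0.
have zE := dproj_linE al i0 B kap psi.
have qz' : mmap kap (lin (dproj_lin al i0 B) kap psi) q = 0.
  by rewrite -[RHS]qz; apply: eq_mmap => // i; rewrite zE.
have [d' qd0] := pihomog_neq0 q0.
have qdz := Hom d' qz'.
have {}qdz : mmap kap (dproj al i0 kap ze) (pihomog mdeg d' q) = 0.
  by rewrite -[RHS]qdz; apply: eq_mmap.
have [lam [i1 [p2 [l0 p2z p2a]]]] :=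
  project_step ai0 pz' pa' (pihomogP _ _ _) qd0 qdz.
have := mn (existT _ j (dproj_lin lam i1 B)); rewrite /= ltnn.
suff h : Q (existT _ j (dproj_lin lam i1 B)) by move/(_ h).
exists p2; split => /=.
  by rewrite -[RHS]p2z; apply: eq_mmap => // i; rewrite -dproj_linE.
rewrite (meval_eq (v2 := dproj lam i1 idfun al)) // => i.
by rewrite -(dproj_linE lam i1 B idfun a).
Qed.

(** Along [al] the leading coefficient of [f] is the unit [f.@[al]]. In a factorisation of [f], one
    factor vanishes at [ze] without vanishing at [al], so by minimality the other is constant. A [g]
    not divisible by [f] would then be coprime to it, and Bezout would give a relation among the
    independent projected forms. *)
Lemma ideal_principal j (ze : 'I_j.+1 -> E) (al : 'I_j.+1 -> k) i0 e f :
  al i0 != 0 -> indep kap (dproj al i0 kap ze) ->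
  f \is e.-homog -> mmap kap ze f = 0 -> f.@[al] != 0 ->
  (forall p, mmap kap ze p = 0 -> p.@[al] != 0 -> (e < msize p)%N) ->
  forall g, mmap kap ze g = 0 -> exists h, g = h * f.
Proof.
move=> a0 ind hf fz fa fmin g gz.
pose y := dcoord al i0 kap ze.
have [F [eF Fz lF irr]] : exists F, [/\ F = dpoly al i0 f,
    evp (mmap kap (dproj al i0 kap ze)) y F = 0,
    lead_coef F \is a GRing.unit &
    forall h q, F = h * q -> (size h = 1)%N \/ (size q = 1)%N].
  exists (dpoly al i0 f); split=> //; first by rewrite dpoly_eval.
    have sF : (size (dpoly al i0 f) <= e.+1)%N.
      exact: leq_trans (size_dpoly _ _ _) (msize_homog hf).
    have cF := coef_dpoly_homog al i0 hf.
    move: (dpoly al i0 f) sF cF => F sF cF.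
    have -> : lead_coef F = (f.@[al])%:MP.
      rewrite lead_coefE; suff -> : size F = e.+1 by [].
      apply/eqP; rewrite eqn_leq sF ltnNge; apply/negP => /leq_sizeP /(_ e (leqnn e)) /eqP.
      by rewrite cF mpolyC_eq0 (negPf fa).
    apply: (rmorph_unit (@mpolyC j k)); rewrite unitfE //.
  have irr' h q : f = h * q -> mmap kap ze h = 0 -> exists2 c, c != 0 & q = c%:MP.
    move=> ef hz; have ha : h.@[al] != 0.
      by apply: contraNneq fa => e0; rewrite ef mevalM e0 mul0r.
    have q0 : q != 0.
      by apply: contraNneq fa => e0; rewrite ef e0 mulr0 meval0.
    have lt := fmin h hz ha.
    have h0 : h != 0 by rewrite -msize_poly_eq0 -lt0n (leq_ltn_trans _ lt).
    have sq : (msize q <= 1)%N.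
      have := msize_homog hf; rewrite ef msizeM //.
      by move: lt; move: (msize h) (msize q) => x x'; clear; lia.
    have eq := msize1_polyC sq; exists q@_0%MM => //.
    by apply: contraNneq q0 => e0; rewrite eq e0 mpolyC0.
  have sC c : c != 0 -> size (dpoly al i0 c%:MP) = 1%N.
    by move=> c0; rewrite dpolyC size_polyC mpolyC_eq0 c0.
  move=> h q ehq.
  have ef : f = dmulti al i0 h * dmulti al i0 q.
    by rewrite -rmorphM -ehq /= dpolyK.
  have : mmap kap ze (dmulti al i0 h) * mmap kap ze (dmulti al i0 q) = 0.
    by rewrite -rmorphM -ef.
  move/eqP; rewrite mulf_eq0 => /orP[/eqP e0|/eqP e0].
    have [c c0 ec] := irr' _ _ ef e0.
    by right; rewrite -(dmultiK a0 q) ec sC.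
  rewrite mulrC in ef; have [c c0 ec] := irr' _ _ ef e0.
  by left; rewrite -(dmultiK a0 h) ec sC.
have [G eG Gz] : exists2 G, G = dpoly al i0 g &
    evp (mmap kap (dproj al i0 kap ze)) y G = 0.
  exists (dpoly al i0 g); [exact: erefl|rewrite dpoly_eval; [exact: gz|exact: a0]].
case: (gauss_irreducible G (factorial_mpoly k j) lF irr) => [|[c ec]].
  move=> /bezout_coprime [S [T' [D [D0 eD]]]].
  case/eqP: D0; apply: ind.
  rewrite -(evpC (mmap kap (dproj al i0 kap ze)) y) -eD rmorphD !rmorphM /=.
  by rewrite Fz Gz !mulr0 addr0.
exists (dmulti al i0 c); rewrite -[g](dpolyK a0) -eG ec rmorphM.
by rewrite eF /= dpolyK.
Qed.

(* [N] is the minimal polynomial of the linear form [y] over the independent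
   linear forms [lin L kap psi]; its degree bounds the degree of an equation
   separating [a] from the point [psi]. *)
Lemma normal_form p : mmap kap psi p = 0 -> p.@[a] != 0 ->
  exists m (L : 'I_m -> 'I_n -> k) (L0 : 'I_n -> k) (N : {poly {mpoly k[m]}}) e,
  let ev := mmap kap (lin L kap psi) in let y := \sum_c kap (L0 c) * psi c in
  [/\ [/\ size N = e.+1, lead_coef N \is a GRing.unit, evp ev y N = 0 & N^`() != 0],
      indep kap (lin L kap psi),
      forall G, evp ev y G = 0 -> exists h, G = h * N &
      exists h, [/\ mmap kap psi h = 0, h.@[a] != 0 & (msize h <= e.+1)%N]].
Proof.
move=> pz pa; have [j [B [i0 [ai0 ind [p' [pz' pa']]]]]] := projection_exists pz pa.
set ze := lin B kap psi in ind pz'; set al := lin B idfun a in ai0 ind pa'.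
have [d0 [g0 [hg0 gz0 ga0 _]]] := homog_separate (@Hom _ B) pz' pa'.
have [e [[f [hf fz fa]] emin]] := @ex_minimal nat
  (fun e => exists f, [/\ f \is e.-homog, mmap kap ze f = 0 & f.@[al] != 0]) id
  (ex_intro _ d0 (ex_intro _ g0 (And3 hg0 gz0 ga0))).
have fmin q : mmap kap ze q = 0 -> q.@[al] != 0 -> (e < msize q)%N.
  move=> qz qa; have [d [g [hg gz ga lt]]] := homog_separate (@Hom _ B) qz qa.
  by apply: leq_ltn_trans lt; apply: emin; exists g.
have prin := ideal_principal ai0 ind hf fz fa fmin.
have e0 := homog_positive hf fz fa.
have f0 : f != 0 by apply: contraNneq fa => ->; rewrite meval0.
(* Otherwise [f] is constant or a p-th power, and its p-th root would separate [a] with smaller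
   degree. *)
have [i fi] : exists i, f^`M(i) != 0.
  apply: NNPP => no.
  have df i : f^`M(i) = 0 by apply/eqP/negPn/negP => h; apply: no; exists i.
  case: (mderiv_eq0_pth_power df) => [[c ec]|[pp [h [pp1 eh]]]].
    by have := fmin f fz fa; rewrite ec msizeC; case: (c != 0); case: (e) e0.
  have hz : mmap kap ze h = 0.
    have /eqP := fz; rewrite eh rmorphXn expf_eq0 => /andP[_ /eqP //].
  have ha : h.@[al] != 0.
    by apply: contraNneq fa => e'; rewrite eh rmorphXn /= e' expr0n gtn_eqF // ltnW.
  have lt := fmin h hz ha; have := msize_homog hf.
  have h0 : h != 0 by apply: contraNneq ha => ->; rewrite meval0.
  rewrite eh; case: (pp) pp1 => [|[|q]] // _; rewrite exprS msizeM ?expf_neq0 //.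
  rewrite exprS msizeM ?expf_neq0 //.
  have : (0 < msize (h ^+ q))%N by rewrite lt0n msize_poly_eq0 expf_neq0.
  by move: lt e0; move: (msize h) (msize (h ^+ q)) => x x'; clear; lia.
have [m fim] : exists m, (f^`M(i))@_m != 0.
  apply: NNPP => no; case/eqP: fi; apply/mpolyP => m; rewrite mcoeff0.
  by apply/eqP/negPn/negP => h; apply: no; exists m.
(* [D] at [v] is the coefficient of [m] in the derivative of [f] along [v]. A direction off the
   zeros of [f] and [D] gives an [N] with unit leading coefficient and nonzero derivative. *)
pose D := \sum_i' (f^`M(i'))@_m *: 'X_i' : {mpoly k[j.+1]}.
have D0 : D != 0.
  apply: contraNneq fim => /(congr1 (mcoeff U_(i))) /eqP.
  rewrite mcoeff0 /D raddf_sum /= (bigD1 i) //= mcoeffZ mcoeffXU eqxx mulr1.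
  by rewrite big1 ?addr0 // => i' ne; rewrite mcoeffZ mcoeffXU (negPf ne) mulr0.
have [v] := mpoly_nonvanishing (mulf_neq0 f0 D0).
rewrite mevalM mulf_eq0 negb_or => /andP[fv Dv].
have [i1 vi1] := homog_nonzero_coord e0 hf fv.
have Nsize : (size (dpoly v i1 f) <= e.+1)%N.
  exact: leq_trans (size_dpoly _ _ _) (msize_homog hf).
have Ncoef := coef_dpoly_homog v i1 hf.
have Nder : (dpoly v i1 f)^`() != 0.
  rewrite dpoly_deriv; apply: contraNneq Dv => e'.
  have : dderiv v f = 0 by rewrite -[LHS](dpolyK vi1) e' rmorph0.
  move=> /(congr1 (mcoeff m)); rewrite mcoeff0 /dderiv /D !raddf_sum /= => eD.
  apply/eqP; rewrite -[RHS]eD; apply: eq_bigr => i' _.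
  by rewrite mevalZ mevalXU mcoeffZ mulrC.
have Nz : evp (mmap kap (dproj v i1 kap ze)) (dcoord v i1 kap ze) (dpoly v i1 f) = 0.
  by rewrite dpoly_eval.
have Ndvd G : evp (mmap kap (dproj v i1 kap ze)) (dcoord v i1 kap ze) G = 0 ->
    exists h, G = h * dpoly v i1 f.
  move=> Gz; have gz : mmap kap ze (dmulti v i1 G) = 0.
    by rewrite -(dpoly_eval _ _ vi1) dmultiK.
  have [h eh] := prin _ gz; exists (dpoly v i1 h).
  by rewrite -dpolyM -eh dmultiK.
move: (dpoly v i1 f) Nsize Ncoef Nder Nz Ndvd => N Nsize Ncoef Nder Nz Ndvd.
have sN : size N = e.+1.
  apply/eqP; rewrite eqn_leq Nsize ltnNge; apply/negP => /leq_sizeP /(_ e (leqnn e)) /eqP.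
  by rewrite Ncoef mpolyC_eq0 (negPf fv).
pose L := dproj_lin v i1 B.
pose L0 c := (v i1)^-1 * B i1 c.
have eL : dproj v i1 kap ze =1 lin L kap psi by apply: dproj_linE.
have eL0 : dcoord v i1 kap ze = \sum_c kap (L0 c) * psi c by apply: dcoord_linE.
have evE G : evp (mmap kap (lin L kap psi)) (\sum_c kap (L0 c) * psi c) G =
   evp (mmap kap (dproj v i1 kap ze)) (dcoord v i1 kap ze) G.
  by rewrite eL0; apply: eq_evp => c; apply: eq_mmap.
exists j, L, L0, N, e => ev y; split.
- split=> //; last by rewrite /ev /y evE.
  rewrite lead_coefE sN Ncoef; apply: (rmorph_unit (@mpolyC j k)).
  by rewrite unitfE.
(* A relation not involving [y] would be a nonzero constant polynomial divisible by [N], whose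
   degree [e] is positive. *)
- move=> g gz; apply/eqP/negPn/negP => g0'.
  have : evp ev y g%:P = 0 by rewrite evpC.
  rewrite /ev /y evE => /Ndvd [h eh].
  have h0 : h != 0.
    by apply: contraNneq g0' => e'; rewrite -polyC_eq0 eh e' mul0r.
  have N0 : N != 0 by rewrite -size_poly_gt0 sN.
  have := congr1 (fun P : {poly {mpoly k[j]}} => size P) eh.
  rewrite size_polyC g0' size_mul // sN.
  have : (0 < size h)%N by rewrite size_poly_gt0.
  by move: e0; move: (size h) => x; clear; lia.
- by move=> G; rewrite /ev /y evE; apply: Ndvd.
- pose lB (i' : 'I_j.+1) : {mpoly k[n]} := lin B (@mpolyC n k) (fun c => 'X_c) i'.
  have hl i' : lB i' \is 1.-homog.
    by apply: rpred_sum => c _; rewrite mul_mpolyC rpredZ // dhomogXU.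
  exists (linear_pullback B f); split; first by rewrite linear_pullbackE.
    by rewrite /meval linear_pullbackE.
  exact: msize_homog (dhomog_mmap hl hf).
Qed.
End NormalForm.

(** * Points of generic linear sections *)

Lemma distinct_roots (k : closedFieldType) (p S T : {poly k}) c e :
  size p = e.+1 -> c != 0 -> S * p + T * p^`() = c%:P ->
  exists s : seq k, [/\ uniq s, size s = e & forall x, x \in s -> root p x].
Proof.
move=> sp c0 eq; have [r er] := closed_field_poly_normal p.
have p0 : p != 0 by rewrite -size_poly_gt0 sp.
have l0 : lead_coef p != 0 by rewrite lead_coef_eq0.
exists r; split.
- rewrite -separable_prod_XsubC; have : separable_poly p.
    rewrite unlock; apply/Bezout_coprimepP; exists (S, T) => /=.
    by rewrite eq polyC_eqp1.
  by rewrite {1}er unlock derivZ coprimepZl // coprimepZr.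
- have := sp; rewrite er size_scale // size_prod_XsubC => -[//].
- by move=> x xr; rewrite er rootZ // root_prod_XsubC.
Qed.

Lemma many_nonroots (k : closedFieldType) (p : {poly k}) e : p != 0 ->
  exists s : seq k, [/\ uniq s, size s = e & forall x, x \in s -> p.[x] != 0].
Proof.
move=> p0; elim: e => [|e [s [us ss hs]]]; first by exists [::].
have q0 : p * \prod_(x <- s) ('X - x%:P) != 0.
  by rewrite mulf_neq0 // monic_neq0 // monic_prod_XsubC.
have /closed_nonrootP [x] := q0.
rewrite rootM negb_or root_prod_XsubC => /andP[px xs].
exists (x :: s); split=> //=; rewrite ?xs ?ss // => z.
by rewrite in_cons => /orP[/eqP ->|/hs].
Qed.

Lemma deriv_eq0_comp (k : fieldType) (R : idomainType) (f : {rmorphism k -> R})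
    (F : {poly R}) : F^`() = 0 ->
  (size F <= 1)%N \/ exists p G, [/\ p \in [pchar k], F = G \Po 'X^p &
    (1 < size F)%N -> (size G < size F)%N].
Proof.
move=> dF; have cf i : F`_i != 0 -> i%:R = 0 :> k.
  case: i => [//|i] Fi; have := congr1 (fun P : {poly R} => P`_i) dF.
  rewrite coef_deriv coef0 -(mulr_natr F`_i.+1) => /eqP; rewrite mulf_eq0 (negPf Fi) /= => /eqP e.
  by apply: (@field_rmorph_eq0 _ _ f); rewrite rmorph_nat.
case: (leqP (size F) 1) => sF; first by left.
right; have F0 : F != 0 by rewrite -size_poly_gt0 ltnW.
have lF : F`_(size F).-1 != 0 by rewrite -[_`_ _]/(lead_coef F) lead_coef_eq0.
have sF0 : (0 < (size F).-1)%N by case: (size F) sF => [|[]].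
have [p pc] := natf0_pchar sF0 (introT eqP (cf _ lF)).
have pp := pcharf_prime pc.
exists p, (\poly_(i < ((size F).-1 %/ p).+1) F`_(i * p)); split=> //; last first.
  move=> _; apply: leq_ltn_trans (size_poly _ _) _.
  rewrite -[X in (_ < X)%N](prednK (ltnW sF)) ltnS.
  by apply: ltn_Pdiv => //; apply: prime_gt1.
apply/polyP => i; rewrite coef_comp_poly_Xn ?prime_gt0 //.
case: ifP => dv; last first.
  apply/eqP; apply: contraFT dv => Fi; by rewrite (dvdn_pcharf pc) cf.
rewrite coef_poly divnK //; case: ltnP => // le.
apply: nth_default; rewrite leqNgt; apply/negP => lt.
move: le; rewrite ltnNge leq_div2r //.
by rewrite -ltnS prednK // ltnW.
Qed.

Lemma pchar_exp_inj (k : fieldType) p : p \in [pchar k] ->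
  injective (fun x : k => x ^+ p).
Proof.
move=> pc x y e; apply: (fmorph_inj (pFrobenius_aut pc)).
by rewrite /= !pFrobenius_autE.
Qed.

Section Extend.
Variables (k : closedFieldType) (E : idomainType) (kap : {rmorphism k -> E}).

(** Indexing by [nat], with only the first [q] members counted, lets families be extended and cut
    without reindexing. *)
Definition indepn (q : nat) (w : nat -> E) := indep kap (fun i : 'I_q => w i).
Definition algn (q : nat) (w : nat -> E) := algebraic_over kap (fun i : 'I_q => w i).

Lemma indepn_leq p q w : (p <= q)%N -> indepn q w -> indepn p w.
Proof.
move=> le ind f fz.
apply: (@membed_inj k _ _ le); rewrite rmorph0; apply: ind.
by rewrite membed_eval.
Qed.

Lemma algn_leq p q w w' y : (p <= q)%N -> (forall i, (i < p)%N -> w' i = w i) ->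
  indepn q w' -> algn p w y -> algn q w' y.
Proof.
move=> le eqw ind [P [P0 Py]].
have embE c : mmap kap (fun i : 'I_q => w' i) (membed k le c) =
    mmap kap (fun i : 'I_p => w i) c.
  by rewrite membed_eval; apply: eq_mmap => // i; rewrite /= eqw.
have eP : map_poly (mmap kap (fun i : 'I_q => w' i)) (map_poly (membed k le) P) =
    map_poly (mmap kap (fun i : 'I_p => w i)) P.
  by rewrite -map_poly_comp; apply: eq_map_poly.
by exists (map_poly (membed k le) P); rewrite evpE eP.
Qed.

Lemma indepn_extend q w y : indepn q w ->
  algn q w y \/ indepn q.+1 (fun i => if (i < q)%N then w i else y).
Proof.
move=> ind; case: (classic (algn q w y)) => [|na]; [by left|right].
move=> f; rewrite -muni_eval /= ltnn.
set ev' := mmap _ _.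
have eev c : ev' c = mmap kap (fun i : 'I_q => w i) c.
  by apply: eq_mmap => // i; rewrite /= ltn_ord.
rewrite (eq_evp (f' := mmap kap (fun i : 'I_q => w i))) // => fy.
have e0 : muni f = 0.
  have : map_poly (mmap kap (fun i : 'I_q => w i)) (muni f) = 0.
    by apply/eqP/negPn/negP => h; apply: na; exists (muni f).
  move/map_poly0_coef => h; apply/polyP => i; rewrite coef0; exact: (ind _ (h i)).
by apply: (@muni_inj q k); rewrite e0 muni0.
Qed.

(** Each [v] in turn either is algebraic over the family or joins it; [Lin] records that the members
    added are again linear forms. *)
Lemma indepn_maximal (Lin : E -> Prop) q w (vs : seq E) :
  indepn q w -> (forall i, (i < q)%N -> Lin (w i)) -> (forall v, v \in vs -> Lin v) ->
  exists q' w', [/\ (q <= q')%N, forall i, (i < q)%N -> w' i = w i, indepn q' w',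
    forall i, (i < q')%N -> Lin (w' i) & forall v, v \in vs -> algn q' w' v].
Proof.
elim: vs q w => [|v vs IH] q w ind lw lv; first by exists q, w.
have lvs u : u \in vs -> Lin u by move=> uv; apply: lv; rewrite in_cons uv orbT.
case: (indepn_extend v ind) => [alg|ind'].
  have [q' [w' [le ew ind' lw' alg']]] := IH q w ind lw lvs.
  exists q', w'; split=> // u; rewrite in_cons => /orP[/eqP ->|]; last exact: alg'.
  exact: algn_leq le ew ind' alg.
have [|q' [w' [le ew ind2 lw' alg']]] := IH q.+1 _ ind' _ lvs.
  move=> i _; case: ltnP => // lt; first exact: lw.
  by apply: lv; rewrite mem_head.
exists q', w'; split=> //; first exact: ltnW.
  by move=> i lt; rewrite ew ?lt // ltnW.
move=> u; rewrite in_cons => /orP[/eqP ->|]; last exact: alg'.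
pose P : {poly {mpoly k[q']}} := 'X - ('X_(Ordinal le))%:P.
exists P; split.
  apply: contraTneq isT => /(congr1 (fun p : {poly E} => p`_1)).
  rewrite coef_map /= coefB coefX coefC /= subr0 rmorph1 coef0 => /eqP.
  by rewrite oner_eq0.
by rewrite /P rmorphB /= evpX evpC /= mmapXU /= ew // ltnn subrr.
Qed.
End Extend.

Lemma mmap_map_mpoly n (R S T : comNzRingType) (f : {rmorphism R -> S})
    (g : {rmorphism S -> T}) (x : 'I_n -> T) (p : {mpoly R[n]}) :
  mmap g x (map_mpoly f p) = mmap (g \o f) x p.
Proof.
rewrite /map_mpoly (rmorph_mmap (mmap g x) (@mpolyC n S \o f)).
by apply: eq_mmap => [c|i] /=; rewrite ?mmapC ?mmapXU.
Qed.

(** The section [A x = c] as a point of the parameter space of [zdeg], with coefficients of any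
    type: constants, or functions of [t]. *)
Definition param (dm l : nat) (S : Type) (A : 'I_dm -> 'I_l -> S) (c : 'I_dm -> S)
    (i : 'I_(dm * l + dm)) : S :=
  row_mx (mxvec (\matrix_(r, j) A r j)) (\row_r c r) ord0 i.

Lemma map_param dm l (S T : Type) (f : S -> T) (A : 'I_dm -> 'I_l -> S) c i :
  f (param A c i) = param (fun r j => f (A r j)) (f \o c) i.
Proof.
rewrite /param; set M := row_mx _ _; rewrite -[LHS](mxE map_mx_key (fun i j => f (M i j))).
rewrite -[matrix_of_fun _ _]/(map_mx f M) /M map_row_mx map_mxvec.
by congr (row_mx (mxvec _) _ _ _); apply/matrixP => r j; rewrite !mxE.
Qed.

Lemma eq_param dm l (S : Type) (A A' : 'I_dm -> 'I_l -> S) c c' :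
  (forall r j, A r j = A' r j) -> c =1 c' -> param A c =1 param A' c'.
Proof.
move=> eA ec i; rewrite /param; congr (row_mx (mxvec _) _ _ _);
by apply/matrixP => r j; rewrite !mxE.
Qed.

(* [Rt] is a ring of parameters for linear sections, [evt] embeds it in a
   domain in which [xE] is the generic point and [yE] a linear form of it; the
   coefficients [A0 + A1 t] and [c] of the section through this point lie in
   [Rt]. *)
Section AbstractFiber.
Variables (k : closedFieldType) (h l dm d : nat).
Variables (Q : {mpoly k[h]}) (P : 'I_l -> {mpoly k[h]}).

Definition phx (x : 'I_h -> k) (j : 'I_l) : k := (P j).@[x] / Q.@[x].

Variable hU : {mpoly k[dm * l + dm]}.
Hypothesis count : forall (A : 'I_dm -> 'I_l -> k) (c : 'I_dm -> k) e
    (pts : 'I_e -> 'I_h -> k),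
  hU.@[param A c] != 0 -> (forall i, Q.@[pts i] != 0) ->
  (forall i r, \sum_j A r j * phx (pts i) j = c r) ->
  (forall i i', phx (pts i) =1 phx (pts i') -> i = i') -> (e <= d)%N.

Variables (A0 A1 : 'I_dm -> 'I_l -> k) (L0 : 'I_l -> k).

Variables (Rt Et : idomainType) (kR : {rmorphism k -> Rt}) (evt : {rmorphism Rt -> Et}).
Variables (tR : Rt) (cR : 'I_dm -> Rt) (xE : 'I_h -> Et) (yE : Et).
Local Notation kE := (evt \o kR).
Local Notation pE := (mmap kE xE).
Definition AtR (r : 'I_dm) (j : 'I_l) : Rt := kR (A0 r j) + kR (A1 r j) * tR.
Definition hUt : Rt := mmap kR (param AtR cR) hU.

Hypothesis evt_inj : forall a, evt a = 0 -> a = 0.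
Hypothesis QE : pE Q != 0.
Hypothesis relA : forall r, evt (cR r) * pE Q = \sum_j evt (AtR r j) * pE (P j).
Hypothesis relY : \sum_j kE (L0 j) * pE (P j) = pE Q * yE.
Hypothesis hUt0 : hUt != 0.

Definition scalar_morph (sp : {rmorphism Rt -> k}) := forall c, sp (kR c) = c.
Hypothesis sp_exists : forall G : Rt, G != 0 ->
  exists sp : {rmorphism Rt -> k}, scalar_morph sp /\ sp G != 0.

Lemma sp_hUt (sp : {rmorphism Rt -> k}) : scalar_morph sp ->
  sp hUt = hU.@[param (fun r j => A0 r j + A1 r j * sp tR) (sp \o cR)].
Proof.
move=> hs; rewrite /hUt (rmorph_mmap sp kR).
apply: eq_mmap => [c|i] /=; first exact: hs.
rewrite (map_param sp); apply: eq_param => // r j.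
by rewrite /AtR rmorphD rmorphM /= !hs.
Qed.

(* A specialisation of [yE ^ pw] away from [U] extends to the generic point, so
   distinct values of [yE ^ pw] come from distinct points of one section. *)
Lemma fiber_bound pw : exists U : {poly Rt}, evp evt (yE ^+ pw) U != 0 /\
  forall sp : {rmorphism Rt -> k}, scalar_morph sp -> sp hUt != 0 ->
  forall s : seq k, uniq s ->
    (forall eta, eta \in s ->
      (forall V, evp evt (yE ^+ pw) V = 0 -> evp sp eta V = 0) /\ evp sp eta U != 0) ->
    (size s <= d)%N.
Proof.
pose ev1 : {rmorphism {poly Rt} -> Et} := evp evt (yE ^+ pw).
(* Coefficients move from [k] to [Rt[Y]], where [Y] stands for [yE ^+ pw]; a specialisation of this
   base is [sp] together with a value [eta] of [Y]. *)
have [lift [liftE lift2]] : exists lift : {mpoly k[h]} -> {mpoly {poly Rt}[h]},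
    (forall p, mmap ev1 xE (lift p) = pE p) /\
    (forall (sp : {rmorphism Rt -> k}) eta q p, scalar_morph sp ->
       mmap (evp sp eta) q (lift p) = p.@[q]).
  exists (map_mpoly (polyC \o kR)); split=> [p|sp eta q p hs].
    by rewrite mmap_map_mpoly; apply: eq_mmap => // c /=; rewrite evpC.
  rewrite mmap_map_mpoly; apply: eq_mmap => // c /=.
  by rewrite evpC hs.
have evC (a : Rt) : evp evt (yE ^+ pw) a%:P = evt a by exact: evpC.
have spC (sp : {rmorphism Rt -> k}) eta (a : Rt) : evp sp eta a%:P = sp a by exact: evpC.
have V0 : mmap ev1 xE (lift Q) != 0 by rewrite liftE.
have [U [U0 hUU]] := specializes_mpoly k V0.
exists U; split=> // sp hs sphU s us hspec.
have spU (i : 'I_(size s)) : exists q : 'I_h -> k,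
    (forall Pl, mmap ev1 xE Pl = 0 -> mmap (evp sp s`_i) q Pl = 0) /\
    mmap (evp sp s`_i) q (lift Q) != 0.
  have [h1 h2] := hspec s`_i (mem_nth 0 (ltn_ord i)).
  exact: hUU.
have [pts hpts] := fin_choice spU.
have Qp i : Q.@[pts i] != 0 by have [_] := hpts i; rewrite lift2.
pose A r j := A0 r j + A1 r j * sp tR.
apply: (count (A := A) (c := sp \o cR) (pts := pts)) => //.
- by rewrite -sp_hUt.
- move=> i r; pose Rel := lift Q * ((cR r)%:P)%:MP - \sum_j ((AtR r j)%:P)%:MP * lift (P j).
  have Rel0 : mmap ev1 xE Rel = 0.
    have -> : mmap ev1 xE Rel = mmap ev1 xE (lift Q) * mmap ev1 xE ((cR r)%:P)%:MP -
        \sum_j mmap ev1 xE ((AtR r j)%:P)%:MP * mmap ev1 xE (lift (P j)).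
      rewrite /Rel rmorphB rmorphM rmorph_sum; congr (_ - _).
      by apply: eq_bigr => j _; rewrite rmorphM.
    rewrite mmapC /= evC liftE mulrC relA -sumrB big1 // => j _.
    by rewrite mmapC /= evC liftE subrr.
  have := (hpts i).1 _ Rel0; rewrite rmorphB rmorphM /= mmapC /= spC lift2 // rmorph_sum.
  move/eqP; rewrite subr_eq0 => /eqP e.
  rewrite /= -[RHS](mulKf (Qp i)) e mulr_sumr; apply: eq_bigr => j _.
  rewrite rmorphM /= mmapC /= spC lift2 // /phx /A /AtR rmorphD rmorphM /= !hs.
  by rewrite [RHS]mulrCA [_^-1 * _]mulrC.
- move=> i i' ephx.
  (* This relation recovers [eta] from the point above it, so distinct values have distinct
     points. *)
  pose RelY := (\sum_j ((kR (L0 j))%:P)%:MP * lift (P j)) ^+ pw - lift Q ^+ pw * ('X)%:MP.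
  have RelY0 : mmap ev1 xE RelY = 0.
    have -> : mmap ev1 xE RelY =
        (\sum_j mmap ev1 xE ((kR (L0 j))%:P)%:MP * mmap ev1 xE (lift (P j))) ^+ pw -
        mmap ev1 xE (lift Q) ^+ pw * mmap ev1 xE ('X)%:MP.
      rewrite /RelY rmorphB rmorphM !rmorphXn rmorph_sum; congr (_ ^+ _ - _).
      by apply: eq_bigr => j _; rewrite rmorphM.
    rewrite mmapC /= evpX liftE -exprMn -relY.
    apply/eqP; rewrite subr_eq0; apply/eqP; congr (_ ^+ _).
    by apply: eq_bigr => j _; rewrite mmapC /= evC liftE.
  have key (i0 : 'I_(size s)) : s`_i0 = (\sum_j L0 j * phx (pts i0) j) ^+ pw.
    have := (hpts i0).1 _ RelY0; rewrite rmorphB rmorphM !rmorphXn /= mmapC /= evpX lift2 //.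
    move/eqP; rewrite subr_eq0 => /eqP e.
    have qn : Q.@[pts i0] ^+ pw != 0 by rewrite expf_neq0.
    apply: (mulfI qn); rewrite -e -exprMn; congr (_ ^+ _).
    rewrite rmorph_sum mulr_sumr; apply: eq_bigr => j _.
    rewrite rmorphM /= mmapC lift2 //= spC hs /phx.
    by rewrite [RHS]mulrCA [_ / _]mulrC mulVKf.
  have : s`_i = s`_i'.
    by rewrite !key; congr (_ ^+ _); apply: eq_bigr => j _; rewrite ephx.
  by move/eqP; rewrite nth_uniq // => /eqP /val_inj.
Qed.

Lemma evt_map_inj (F : {poly Rt}) : map_poly evt F = 0 -> F = 0.
Proof.
by move/map_poly0_coef => e; apply/polyP => i; rewrite coef0; apply: evt_inj.
Qed.

(* Powers of the characteristic exponent; raising [yE] to such a power makes its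
   minimal equation separable. *)
Definition good_power (pw : nat) := (0 < pw)%N /\ injective (fun x : k => x ^+ pw).

(** Minimising the degree over all powers [pw] as well makes [F] separable: if its derivative were
    zero, [F] would be [G \Po 'X^p], and [G] would be a shorter equation for [pw * p]. If its degree
    exceeded [d], its specialised roots would be too many values for [fiber_bound]. If there were no
    equation at all, any [d.+1] values off [U] would be too many. *)
Lemma fiber_equation : exists pw (F : {poly Rt}), [/\ good_power pw, F != 0,
  (size F <= d.+1)%N & evp evt (yE ^+ pw) F = 0].
Proof.
apply: NNPP => no.
have spec_inj (sp : {rmorphism Rt -> k}) : specializes evt sp.
  by move=> b /evt_inj ->; rewrite rmorph0.
case: (classic (exists x : nat * {poly Rt}, [/\ good_power x.1, x.2 != 0 &
    evp evt (yE ^+ x.1) x.2 = 0])) => [exF|noF].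
  have [[pw F] [[/= gp F0 Fy] Fmin]] := ex_minimal (fun x : nat * {poly Rt} => size x.2) exF.
  have sF : (d.+1 < size F)%N.
    by rewrite ltnNge; apply/negP => le; apply: no; exists pw, F.
  have mF : min_poly evt (yE ^+ pw) F.
    split=> // [|G lG Gy].
      by apply: contraNneq F0 => /evt_inj /eqP; rewrite lead_coef_eq0.
    apply: (Fmin (pw, G)); split=> //=.
    by apply: contraNneq lG => ->; rewrite lead_coef0 rmorph0.
  have dF : F^`() != 0.
    apply/eqP => e; case: (deriv_eq0_comp kR e) => [|[p [G [pc eF sG]]]].
      by rewrite leqNgt (leq_trans _ sF).
    have pp := pcharf_prime pc.
    have gpp : good_power (pw * p).
      split; first by rewrite muln_gt0 gp.1 prime_gt0.
      by move=> x z /=; rewrite !exprM => /(pchar_exp_inj pc) /gp.2.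
    have [sF1 G0] : (1 < size F)%N /\ G != 0.
      split; first exact: leq_trans sF.
      by apply: contraNneq F0 => e0; rewrite eF e0 comp_poly0.
    have Gy : evp evt (yE ^+ (pw * p)) G = 0.
      by rewrite -[RHS]Fy eF !evpE map_comp_poly map_polyXn horner_comp hornerXn exprM.
    have := Fmin (pw * p, G)%N (And3 gpp G0 Gy).
    by rewrite /= leqNgt sG.
  have dFy : evp evt (yE ^+ pw) F^`() != 0.
    apply/eqP => e; case/eqP: dF; apply: evt_map_inj.
    by apply: (min_poly_kernel mF) => //; apply: lt_size_deriv.
  have [U [Uy hUf]] := fiber_bound pw.
  have [S1 [T1 [D1 [D10 e1]]]] := min_poly_bezout mF dFy.
  have [S2 [T2 [D2 [D20 e2]]]] := min_poly_bezout mF Uy.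
  have nz a : evt a != 0 -> a != 0 by apply: contraNneq => ->; rewrite rmorph0.
  (* Off [D1] the roots are distinct, off [D2] they avoid [U], and off the leading coefficient there
     are as many as the degree of [F]. *)
  have [sp [hs]] := sp_exists (mulf_neq0 (mulf_neq0 (nz _ D10) (nz _ D20))
     (mulf_neq0 hUt0 (min_poly_lead0 mF))).
  rewrite !rmorphM !mulf_eq0 !negb_or => /andP[/andP[sD1 sD2] /andP[shU slF]].
  have lift_eq A B : map_poly evt A = (evt B)%:P -> map_poly sp A = (sp B)%:P.
    move=> e; have : A - B%:P = 0 by apply: evt_map_inj; rewrite rmorphB /= map_polyC e subrr.
    by move/eqP; rewrite subr_eq0 => /eqP ->; rewrite map_polyC.
  have sspF : size (map_poly sp F) = (size F).-1.+1.
    by rewrite size_map_poly_id0 // prednK // (leq_trans _ sF).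
  have e1' : map_poly sp S1 * map_poly sp F + map_poly sp T1 * (map_poly sp F)^`() = (sp D1)%:P.
    by rewrite deriv_map -!rmorphM -rmorphD; apply: lift_eq.
  have [s [us ss hr]] := distinct_roots sspF sD1 e1'.
  have : (size s <= d)%N.
    apply: (hUf sp hs shU s us) => eta es; split.
      exact: (specializes_root mF (spec_inj sp) slF (hr _ es)).
    have := lift_eq _ _ e2 => /(congr1 (fun p : {poly k} => p.[eta])).
    rewrite rmorphD !rmorphM hornerD !hornerM (rootP (hr _ es)) mulr0 add0r hornerC.
    by move=> e3; apply: contraNneq sD2 => U0; rewrite -e3 -[X in _ * X]evpE U0 mulr0.
  by rewrite ss leqNgt -ltnS prednK ?sF // (leq_trans _ sF).
have [U [Uy hUf]] := fiber_bound 1.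
have U0 : U != 0 by apply: contraNneq Uy => ->; rewrite rmorph0.
have lU : lead_coef U != 0 by rewrite lead_coef_eq0.
have [sp [hs]] := sp_exists (mulf_neq0 hUt0 lU).
rewrite rmorphM mulf_eq0 negb_or => /andP[shU slU].
have : map_poly sp U != 0 by rewrite -size_poly_gt0 size_map_poly_id0 // size_poly_gt0.
move/(many_nonroots d.+1) => [s [us ss hr]].
have : (size s <= d)%N.
  apply: (hUf sp hs shU s us) => eta es; split; last exact: hr.
  move=> V Vy; suff -> : V = 0 by rewrite rmorph0.
  apply/eqP/negPn/negP => V0; apply: noF; exists (1%N, V); split=> //=.
  by split=> // x z; rewrite /= !expr1.
by rewrite ss ltnn.
Qed.
End AbstractFiber.

Local Notation "x %:F" := (@tofrac _ x).

Lemma evp_map (R S T : comNzRingType) (g : {rmorphism R -> S}) (f : {rmorphism S -> T})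
    y (P : {poly R}) : evp f y (map_poly g P) = evp (f \o g) y P.
Proof. by rewrite !evpE -map_poly_comp. Qed.

Lemma affine_polyCM (R : comNzRingType) (x z u v : R) :
  ((u * x)%:P + (v * x)%:P * 'X) * z%:P = (u%:P + v%:P * 'X) * (x * z)%:P.
Proof.
rewrite !polyCM mulrDl [RHS]mulrDl; congr (_ + _); first by rewrite mulrA.
by rewrite mulrA; congr (_ * _); rewrite mulrAC.
Qed.

Lemma polyC_mulCA (R : comNzRingType) (x z u : R) :
  u%:P * (x * z)%:P = z%:P * (u * x)%:P.
Proof. by rewrite -!polyCM mulrA mulrC. Qed.

(** * Perturbation of the linear forms *)

Section Perturb.
Variables (k : closedFieldType) (h l dm d : nat).
Variables (Q : {mpoly k[h]}) (P : 'I_l -> {mpoly k[h]}).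
Hypothesis Q0 : Q != 0.

Local Notation E0 := {fraction {mpoly k[h]}}.
Definition kapF : {rmorphism k -> E0} := (@tofrac _) \o (@mpolyC h k).
Definition phiF (j : 'I_l) : E0 := (P j)%:F / Q%:F.

Lemma phiFE j : phiF j * Q%:F = (P j)%:F.
Proof. by rewrite /phiF divfK // tofrac_eq0. Qed.

Variable hU : {mpoly k[dm * l + dm]}.
Hypothesis count : forall (A : 'I_dm -> 'I_l -> k) (c : 'I_dm -> k) e
    (pts : 'I_e -> 'I_h -> k),
  hU.@[param A c] != 0 -> (forall i, Q.@[pts i] != 0) ->
  (forall i r, \sum_j A r j * phx Q P (pts i) j = c r) ->
  (forall i i', phx Q P (pts i) =1 phx Q P (pts i') -> i = i') -> (e <= d)%N.

Variables (A0 A1 : 'I_dm -> 'I_l -> k) (c1 : 'I_dm -> k) (L0 : 'I_l -> k).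
Definition aF (A : 'I_dm -> 'I_l -> k) (r : 'I_dm) : E0 :=
  \sum_j kapF (A r j) * phiF j.
Definition yF : E0 := \sum_j kapF (L0 j) * phiF j.
Hypothesis ind0 : indep kapF (aF A0).
Hypothesis hU1 : hU.@[param (fun r j => A0 r j + A1 r j) c1] != 0.

Local Notation Rt := {poly {mpoly k[dm]}}.
Local Notation Et := {poly E0}.

Definition kapt : {rmorphism k -> Et} := polyC \o kapF.
(** The perturbed forms, [t] being ['X]. Injectivity of [evt] below expresses that they are
    independent over [k(t)]. *)
Definition at_ (r : 'I_dm) : Et := (aF A0 r)%:P + (aF A1 r)%:P * 'X.
Definition evt : {rmorphism Rt -> Et} := evp (mmap kapt at_) 'X.

Lemma evt_at0 (q : Rt) : (evt q).[0] = mmap kapF (aF A0) q.[0].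
Proof.
elim/poly_ind: q => [|q c _]; first by rewrite !rmorph0 !horner0 rmorph0.
rewrite /evt /= rmorphD rmorphM /= evpX evpC !hornerE.
rewrite -[LHS]/(horner_eval 0 (mmap kapt at_ c)) (rmorph_mmap (horner_eval 0) kapt).
apply: eq_mmap => [a|r] /=; rewrite /horner_eval /=; first by rewrite hornerC.
by rewrite /at_ !hornerE.
Qed.

Lemma evtX : evt 'X = 'X. Proof. exact: evpX. Qed.
Lemma evtC c : evt c%:MP%:P = kapt c.
Proof. by rewrite [LHS]evpC /= mmapC. Qed.

(** At [t = 0] the perturbed forms are the independent forms of [A0], so [q] has zero constant term
    in [t]; then [t] is divided out. *)
Lemma evt_inj q : evt q = 0 -> q = 0.
Proof.
elim/poly_ind: q => [_|q c IH e]; first exact: erefl.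
have c0 : c = 0.
  by apply: ind0; have := evt_at0 (q * 'X + c%:P); rewrite e !hornerE => <-.
move: e; rewrite c0 addr0 rmorphM => /eqP.
rewrite mulf_eq0 => /orP[/eqP /IH ->|]; first by rewrite mul0r.
by rewrite evtX polyX_eq0.
Qed.

Definition kRt : {rmorphism k -> Rt} := polyC \o @mpolyC dm k.
Definition cRt (r : 'I_dm) : Rt := ('X_r)%:P.
Definition xEt (i : 'I_h) : Et := (('X_i : {mpoly k[h]})%:F)%:P.

Lemma pEt p : mmap (evt \o kRt) xEt p = (p%:F)%:P.
Proof.
rewrite -[in RHS](mmap_id p).
rewrite -[RHS]/((polyC \o @tofrac {mpoly k[h]}) _).
rewrite (rmorph_mmap (polyC \o @tofrac {mpoly k[h]}) (@mpolyC h k)).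
by apply: eq_mmap => [c|i]; [exact: evtC|exact: erefl].
Qed.

(** It suffices to look at [t = 1] and [c = c1], where the section is the one supplied by [hU1]. *)
Lemma hUt_neq0 : hUt hU A0 A1 kRt 'X cRt != 0.
Proof.
pose sp : {rmorphism Rt -> k} := evp (meval c1) 1.
have hs : scalar_morph kRt sp by move=> c; rewrite /sp /= evpC /= mevalC.
apply: contraNneq hU1 => e; have := sp_hUt hU A0 A1 'X cRt hs; rewrite e rmorph0 => e'.
apply/eqP; rewrite [RHS]e'; apply: meval_eq => i; apply: eq_param => [r j|r] /=.
  by rewrite /sp /= evpX mulr1.
by rewrite /sp /cRt /= evpC /= mevalXU.
Qed.

Lemma specialize_exists (G : Rt) : G != 0 ->
  exists sp : {rmorphism Rt -> k}, scalar_morph kRt sp /\ sp G != 0.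
Proof.
move=> G0; have lG : lead_coef G != 0 by rewrite lead_coef_eq0.
have [c hc] := mpoly_nonvanishing lG.
have : map_poly (meval c) G != 0.
  apply: contraNneq hc => e.
  by have := coef_map (meval c) G (size G).-1; rewrite e coef0 lead_coefE => /= <-.
move=> /closed_nonrootP [t ht].
exists (evp (meval c) t); split; last exact: ht.
by move=> a; rewrite /= evpC /= mevalC.
Qed.

Lemma perturbed_equation : exists pw (F : {poly Rt}), [/\ good_power k pw, F != 0,
  (size F <= d.+1)%N & evp evt (yF%:P ^+ pw) F = 0].
Proof.
apply: (fiber_equation count evt_inj (xE := xEt) (L0 := L0) (tR := 'X) (cR := cRt)
  (A0 := A0) (A1 := A1) (kR := kRt)).
- by rewrite pEt polyC_eq0 tofrac_eq0.
- move=> r; have -> : evt (cRt r) = at_ r by rewrite [LHS]evpC /= mmapXU.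
  rewrite pEt /at_ /aF !rmorph_sum /= mulr_suml -big_split mulr_suml /=.
  apply: eq_bigr => j _; rewrite pEt.
  have -> : evt (AtR A0 A1 kRt 'X r j) = (kapF (A0 r j))%:P + (kapF (A1 r j))%:P * 'X.
    by rewrite /AtR rmorphD rmorphM evtX /kRt /= !evtC.
  by rewrite -phiFE; apply: affine_polyCM.
- rewrite pEt /yF rmorph_sum mulr_sumr; apply: eq_bigr => j _.
  rewrite pEt -phiFE [(evt \o kRt) _]evtC /kapt /=.
  exact: polyC_mulCA.
- exact: hUt_neq0.
- exact: specialize_exists.
Qed.

(* A nonzero equation of minimal total degree in [t] is not divisible by [t],
   hence remains nonzero at [t = 0]. *)
Lemma special_equation : exists pw (F : {poly {mpoly k[dm]}}), [/\ good_power k pw, F != 0,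
  (size F <= d.+1)%N & evp (mmap kapF (aF A0)) (yF ^+ pw) F = 0].
Proof.
have [pw [F1 [gp F10 sF1 F1y]]] := perturbed_equation.
pose Good (F : {poly Rt}) := [/\ F != 0, (size F <= d.+1)%N & evp evt (yF%:P ^+ pw) F = 0].
pose csz (F : {poly Rt}) (i : nat) : nat := size (F`_i : Rt).
pose mu (F : {poly Rt}) := (\sum_(i < d.+1) csz F i)%N.
have [F [[F0 sF Fy] Fmin]] := ex_minimal mu (ex_intro Good F1 (And3 F10 sF1 F1y)).
exists pw, (map_poly (horner_eval 0) F); split=> //; last 2 first.
- exact: leq_trans (size_poly _ _) sF.
- rewrite evp_map; have := congr1 (horner_eval 0) Fy.
  rewrite (rmorph_evp (horner_eval 0)) rmorph0 => e; rewrite -[RHS]e.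
  have eY : yF ^+ pw = horner_eval 0 (yF%:P ^+ pw : Et).
    by rewrite rmorphXn /= /horner_eval hornerC.
  rewrite eY.
  by apply: eq_evp => q /=; rewrite /horner_eval evt_at0.
apply/eqP => e0.
pose G : {poly Rt} := \poly_(i < d.+1) (drop_poly 1 F`_i : Rt).
have Fi i : F`_i = G`_i * 'X.
  rewrite coef_poly; case: ltnP => lt; last first.
    by rewrite mul0r nth_default // (leq_trans sF).
  rewrite -[LHS](poly_take_drop 1) expr1 [X in X + _](_ : _ = 0) ?add0r //.
  apply/polyP => -[|n]; rewrite coef_take_poly coef0 //.
  have := congr1 (fun p : {poly {mpoly k[dm]}} => p`_i) e0.
  by rewrite coef_map coef0 /= /horner_eval horner_coef0.
have FG : F = ('X%:P) * G by apply/polyP => i; rewrite coefCM Fi mulrC.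
have G0 : G != 0 by apply: contraNneq F0 => e; rewrite FG e mulr0.
have Gy : evp evt (yF%:P ^+ pw) G = 0.
  have := Fy; rewrite FG rmorphM /= evpC evtX => /eqP.
  by rewrite mulf_eq0 polyX_eq0 => /eqP.
have := Fmin G (And3 G0 (size_poly _ _) Gy); rewrite leqNgt => /negP; apply.
have [i lt nz] : exists2 i, (i < d.+1)%N & G`_i != 0.
  exists (size G).-1; last by rewrite -[_`_ _]/(lead_coef G) lead_coef_eq0.
  by rewrite prednK ?size_poly_gt0 // size_poly.
have sz j : csz F j = if G`_j == 0 then 0%N else (csz G j).+1.
  rewrite /csz Fi; case: eqP => [->|/eqP nz']; first by rewrite mul0r size_poly0.
  by rewrite size_mulX.
rewrite /mu (bigD1 (Ordinal lt)) //= [X in (_ < X)%N](bigD1 (Ordinal lt)) //=.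
rewrite sz (negPf nz) addSn ltnS leq_add2l; apply: leq_sum => j _.
by rewrite sz; case: eqP => [e|_] //; rewrite /csz e size_poly0.
Qed.
End Perturb.

(** * Comparison of the two equations of [y] *)

Section Compare.
Variables (k : closedFieldType) (E : idomainType) (kap : {rmorphism k -> E}).
Variables (q m dm d e pw : nat) (w : nat -> E) (y : E).
Hypothesis ind : indepn kap q w.
Hypotheses (mq : (m <= q)%N) (dmq : (dm <= q)%N).
Local Notation ev n := (mmap kap (fun i : 'I_n => w i)).
Variable N : {poly {mpoly k[m]}}.
Hypotheses (sN : size N = e.+1) (lN : lead_coef N \is a GRing.unit).
Hypotheses (Ny : evp (ev m) y N = 0) (N'0 : N^`() != 0).
Hypothesis Ndvd : forall G, evp (ev m) y G = 0 -> exists h, G = h * N.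
Variable F : {poly {mpoly k[dm]}}.
Hypotheses (gp : good_power k pw) (F0 : F != 0) (sF : (size F <= d.+1)%N).
Hypothesis Fy : evp (ev dm) (y ^+ pw) F = 0.

Local Notation Rq := {mpoly k[q]}.
Let Nq : {poly Rq} := map_poly (membed k mq) N.

Lemma ev_inj c : ev q c = 0 -> c = 0. Proof. exact: ind. Qed.

Lemma map_ev_inj (G : {poly Rq}) : map_poly (ev q) G = 0 -> G = 0.
Proof.
move/map_poly0_coef => e0; apply/polyP => i; rewrite coef0; exact: (ev_inj (e0 i)).
Qed.

Lemma evp_membed p (le : (p <= q)%N) (z : E) G :
  evp (ev q) z (map_poly (membed k le) G) = evp (ev p) z G.
Proof. rewrite evp_map; apply: eq_evp => c; exact: membed_eval. Qed.

Lemma lead_Nq : lead_coef Nq \is a GRing.unit /\ size Nq = e.+1.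
Proof.
have nz : membed k mq (lead_coef N) != 0.
  have := rmorph_unit (membed k mq) lN; apply: contraTneq => ->; rewrite unitr0 //.
have s : size Nq = e.+1 by rewrite size_map_poly_id0.
split=> //; rewrite lead_coef_map_eq //.
exact: rmorph_unit.
Qed.

(* [N] remains minimal after adjoining the further independent elements: specialise
   those in a factorisation. *)
Lemma Nq_min : min_poly (ev q) y Nq.
Proof.
have [lNq sNq] := lead_Nq.
have Nqy : evp (ev q) y Nq = 0 by rewrite /Nq evp_membed.
have Nq0 : Nq != 0 by rewrite -size_poly_gt0 sNq.
have lNq0 : ev q (lead_coef Nq) != 0.
  by apply: contraTneq lNq => /ev_inj ->; rewrite unitr0.
have mNq0 : map_poly (ev q) Nq != 0.
  by apply: contraNneq Nq0 => /map_ev_inj ->.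
have [M [Mmin sM]] := min_poly_exists mNq0 Nqy.
have [qq [r [c [c0 eq r0]]]] := min_poly_pseudo_dvd Mmin Nqy.
have {r0} r0 := map_ev_inj r0; rewrite r0 addr0 in eq.
have {}c0 : c != 0 by apply: contraNneq c0 => ->; rewrite rmorph0.
have M0 := min_poly_neq0 Mmin.
have [v hv] := mpoly_nonvanishing c0.
(* The first [m] variables are kept; the others take values from a point where [c] does not
   vanish. *)
pose hs (i : 'I_q) : {mpoly k[m]} :=
  oapp (fun i' : 'I_m => 'X_i') ((v i)%:MP) (insub (val i)).
pose sg : {rmorphism Rq -> {mpoly k[m]}} := mmap (@mpolyC m k) hs.
have sgK b : sg (membed k mq b) = b.
  rewrite [LHS]membed_eval -[RHS]mmap_id; apply: eq_mmap => // i.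
  by rewrite /hs /= insubT //= => lt; congr 'X_(_); apply/val_inj.
have sgc : sg c != 0.
  apply: contraNneq hv => e0.
  have : (sg c).@[fun i => v (widen_ord mq i)] = 0 by rewrite e0 meval0.
  move=> <-; rewrite [sg c]/(mmap _ _ _) [X in _ == X]/meval.
  rewrite (rmorph_mmap (meval (fun i : 'I_m => v (widen_ord mq i))) (@mpolyC m k)).
  apply/eqP/eq_mmap => [b|i] /=; first by rewrite mevalC.
  rewrite /hs; case: insubP => [i' _ ei|] /=; last by rewrite mevalC.
  by rewrite mevalXU; congr v; apply/val_inj.
have eqs : sg c *: N = map_poly sg qq * map_poly sg M.
  have sgN : map_poly sg Nq = N.
    by apply/polyP => i; rewrite /Nq coef_map; rewrite coef_map; apply: sgK.
  by rewrite -rmorphM -eq /= map_polyZ sgN.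
have N0 : N != 0 by rewrite -size_poly_gt0 sN.
have nz : map_poly sg qq * map_poly sg M != 0 by rewrite -eqs scale_poly_eq0 negb_or sgc.
have [sq0 sM0] : map_poly sg qq != 0 /\ map_poly sg M != 0.
  by apply/andP; rewrite -negb_or -mulf_eq0.
have q0 : qq != 0 by apply: contraNneq sq0 => ->; rewrite rmorph0.
have dvd_size (G : {poly {mpoly k[m]}}) : G != 0 -> evp (ev m) y G = 0 -> (e.+1 <= size G)%N.
  move=> G0 /Ndvd [hh eG]; rewrite -sN eG size_mul //.
    have : (0 < size hh)%N.
      by rewrite size_poly_gt0; apply: contraNneq G0 => e0; rewrite eG e0 mul0r.
    by case: (size hh) => // a _; rewrite addSn leq_addl.
  by apply: contraNneq G0 => e0; rewrite eG e0 mul0r.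
have p0 : evp (ev m) y (map_poly sg qq) * evp (ev m) y (map_poly sg M) = 0.
  by rewrite -rmorphM -eqs -mul_polyC rmorphM /= Ny mulr0.
have sz : (size qq + size M).-1 = e.+1.
  by rewrite -size_mul // -eq size_scale.
have sM1 := min_poly_size Mmin.
have leM : (e.+1 <= size M)%N.
  (* One of the two specialised factors vanishes at [y], hence has degree at least [e]. It cannot be
     the cofactor, because [M] is not constant. *)
  move/eqP: p0; rewrite mulf_eq0 => /orP[/eqP|/eqP] /dvd_size.
    move=> /(_ sq0) /leq_trans /(_ (size_poly _ _)).
    by move: sz sM1; move: (size qq) (size M) => a b; clear; lia.
  by move=> /(_ sM0) /leq_trans /(_ (size_poly _ _)).
have [_ _ Mm] := Mmin.
split=> // G lG Gy; rewrite sNq; apply: leq_trans leM _; exact: Mm.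
Qed.

(** Over all [q] independent elements, [N] divides [F \Po 'X^pw] up to a constant. At a point [v]
    keeping [N] separable and [F] nonzero, the [e] roots of [N] have distinct [pw]-th powers, which
    are roots of [F]. *)
Lemma compare_degrees : (e <= d)%N.
Proof.
have [lNq sNq] := lead_Nq; have mN := Nq_min.
have N'q : evp (ev q) y Nq^`() != 0.
  apply/eqP => e0; case/eqP: N'0.
  have : Nq^`() = 0.
    apply: map_ev_inj; apply: (min_poly_kernel mN) => //.
    by apply: lt_size_deriv; rewrite -size_poly_gt0 sNq.
  rewrite /Nq deriv_map => e1.
  by apply: (map_inj_poly (membed_inj (le := mq)) (rmorph0 _)); rewrite e1 rmorph0.
have [S [T [D [D0 eD]]]] := min_poly_bezout mN N'q.
pose Fq : {poly Rq} := (map_poly (membed k dmq) F) \Po 'X^pw.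
have Fqy : evp (ev q) y Fq = 0.
  rewrite /Fq evpE map_comp_poly map_polyXn horner_comp hornerXn.
  by rewrite -[LHS]/(evp (ev q) (y ^+ pw) _) evp_membed.
have [qq [r [c [c0 eq r0]]]] := min_poly_pseudo_dvd mN Fqy.
have {r0} r0 := map_ev_inj r0; rewrite r0 addr0 in eq.
have nz a : ev q a != 0 -> a != 0 by apply: contraNneq => ->; rewrite rmorph0.
have lF0 : membed k dmq (lead_coef F) != 0.
  by rewrite (raddf_eq0 _ (membed_inj (le := dmq))) lead_coef_eq0.
have [v hv] := mpoly_nonvanishing (mulf_neq0 (mulf_neq0 (nz _ D0) (nz _ c0)) lF0).
move: hv; rewrite !mevalM !mulf_eq0 !negb_or => /andP[/andP[Dv cv] lFv].
pose mv := map_poly (meval v).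
have sNv : size (mv Nq) = e.+1.
  rewrite size_map_poly_id0 // -unitfE; exact: (rmorph_unit (meval v) lNq).
have eDv : mv S * mv Nq + mv T * (mv Nq)^`() = (D.@[v])%:P.
  rewrite /mv deriv_map -!rmorphM -rmorphD /=.
  have -> : S * Nq + T * Nq^`() = D%:P.
    apply/eqP; rewrite -subr_eq0; apply/eqP/map_ev_inj.
    by rewrite rmorphB /= eD map_polyC subrr.
  by rewrite map_polyC.
have [s [us ss hr]] := distinct_roots sNv Dv eDv.
pose Fv := map_poly (meval v) (map_poly (membed k dmq) F).
have Fv0 : Fv != 0.
  have : Fv`_(size F).-1 != 0 by rewrite !coef_map.
  by apply: contraNneq => ->; rewrite coef0.
have rFv : all (root Fv) [seq x ^+ pw | x <- s].
  apply/allP => z /mapP [x xs ->]; have := congr1 mv eq.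
  rewrite /mv rmorphM -mul_polyC rmorphM /= map_polyC => /(congr1 (fun p : {poly k} => p.[x])).
  rewrite !hornerM hornerC (rootP (hr x xs)) mulr0 => /eqP.
  rewrite mulf_eq0 (negPf cv) /= /Fq map_comp_poly map_polyXn horner_comp hornerXn.
  by move=> h0; rewrite rootE.
have := max_poly_roots Fv0 rFv; rewrite map_inj_uniq ?us; last by have [_] := gp.
rewrite size_map ss => /(_ isT) lt.
rewrite -ltnS; apply: leq_trans lt _; apply: leq_trans (size_poly _ _) _.
exact: leq_trans (size_poly _ _) sF.
Qed.
End Compare.

Section DegreeBound.
Variables (k : closedFieldType) (h l dm d : nat).
Variables (Q : {mpoly k[h]}) (P : 'I_l -> {mpoly k[h]}).
Hypothesis Q0 : Q != 0.
Variable hU : {mpoly k[dm * l + dm]}.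
Hypothesis count : forall (A : 'I_dm -> 'I_l -> k) (c : 'I_dm -> k) e
    (pts : 'I_e -> 'I_h -> k),
  hU.@[param A c] != 0 -> (forall i, Q.@[pts i] != 0) ->
  (forall i r, \sum_j A r j * phx Q P (pts i) j = c r) ->
  (forall i i', phx Q P (pts i) =1 phx Q P (pts i') -> i = i') -> (e <= d)%N.
Variables (A1 : 'I_dm -> 'I_l -> k) (c1 : 'I_dm -> k).
Hypothesis hU1 : hU.@[param A1 c1] != 0.
Local Notation kap := (kapF k h).
Local Notation phi := (phiF Q P).
Variable t : 'I_dm -> {mpoly k[l]}.
Hypothesis indt : indep kap (fun i => mmap kap phi (t i)).

Variables (m e : nat) (L : 'I_m -> 'I_l -> k) (L0 : 'I_l -> k) (N : {poly {mpoly k[m]}}).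
Local Notation ev := (mmap kap (lin L kap phi)).
Local Notation y := (\sum_c kap (L0 c) * phi c).
Hypotheses (sN : size N = e.+1) (lN : lead_coef N \is a GRing.unit).
Hypotheses (Ny : evp ev y N = 0) (N'0 : N^`() != 0).
Hypothesis indL : indep kap (lin L kap phi).
Hypothesis Ndvd : forall G, evp ev y G = 0 -> exists h, G = h * N.

(** The forms [L] are completed to a maximal independent family of linear forms. The [dm]
    independent polynomials [t] show that it has at least [dm] members, so its first [dm] members
    can be perturbed to a generic section; [N] and [F] then both have coefficients in initial
    segments of one family. *)
Lemma degree_bound : (e <= d)%N.
Proof.
pose w0 (i : nat) := if insub i is Some i' then lin L kap phi i' else 0.
have w0E (i : 'I_m) : w0 i = lin L kap phi i by rewrite /w0 valK.
pose Lin x := exists c : 'I_l -> k, x = \sum_j kap (c j) * phi j.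
have ind0 : indepn kap m w0.
  by move=> p pz; apply: indL; rewrite -[RHS]pz; apply: eq_mmap => // i; rewrite w0E.
have lin0 i : (i < m)%N -> Lin (w0 i).
  by move=> lt; exists (L (Ordinal lt)); exact: (w0E (Ordinal lt)).
have linphi v : v \in [seq phi j | j <- enum 'I_l] -> Lin v.
  move=> /mapP [j _ ->]; exists (fun j' => (j' == j)%:R).
  rewrite (bigD1 j) //= eqxx rmorph1 mul1r big1 ?addr0 // => j' /negPf ->.
  by rewrite rmorph0 mul0r.
have [q [w [mq ew indw linw algw]]] := indepn_maximal ind0 lin0 linphi.
have algphi j : algebraic_over kap (fun i : 'I_q => w i) (phi j).
  by apply: algw; apply: map_f; rewrite mem_enum.
have dmq : (dm <= q)%N := steinitz algphi indt.
have [A hA] := fin_choice (fun i : 'I_q => linw i (ltn_ord i)).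
pose A0 (r : 'I_dm) := A (widen_ord dmq r).
have aE r : aF Q P A0 r = w r by rewrite (hA (widen_ord dmq r)).
have indA : indep kap (aF Q P A0).
  move=> p pz; apply: (indepn_leq dmq indw); rewrite -[RHS]pz.
  by apply: eq_mmap.
(* With the perturbation [A1 - A0], the value [t = 1] yields the generic family [A1]. *)
have hU1' : hU.@[param (fun r j => A0 r j + (A1 r j - A0 r j)) c1] != 0.
  suff e1 : param (fun r j => A0 r j + (A1 r j - A0 r j)) c1 =1 param A1 c1.
    by rewrite (meval_eq _ e1).
  by move=> i; apply: eq_param => // r j; rewrite addrCA subrr addr0.
have [pw [F [gp F0 sF Fy]]] := special_equation Q0 count L0 indA hU1'.
have ewm (i : 'I_m) : w i = lin L kap phi i by rewrite ew // w0E.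
have eev c : mmap kap (fun i : 'I_m => w i) c = ev c by apply: eq_mmap.
apply: (compare_degrees (w := w) (y := y) indw mq dmq sN lN _ N'0 _ gp F0 sF).
- rewrite -[RHS]Ny; apply: eq_evp; exact: eev.
- move=> G Gy; apply: Ndvd; rewrite -[RHS]Gy; apply: eq_evp => c.
  exact: (esym (eev c)).
- by rewrite -[RHS]Fy; apply: eq_evp => c; apply: eq_mmap => // r; rewrite aE.
Qed.
End DegreeBound.

(** * The group and its orbit *)

Lemma addf_divX (F : fieldType) (u v x : F) a b : x != 0 ->
  u / x ^+ a + v / x ^+ b = (u * x ^+ b + v * x ^+ a) / x ^+ (a + b).
Proof. by move=> x0; rewrite exprD addf_div // expf_neq0. Qed.

Lemma mulf_divX (F : fieldType) (u v x : F) a b :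
  (u / x ^+ a) * (v / x ^+ b) = (u * v) / x ^+ (a + b).
Proof. by rewrite exprD invfM mulrACA. Qed.

Section FractionClass.
Variables (k : fieldType) (X : Type) (m : nat) (pt : X -> 'I_m -> k) (dom : X -> Prop).
Variable W : {mpoly k[m]}.
Hypothesis W0 : forall x, dom x -> W.@[pt x] != 0.

(** Covers regular functions on the group, with [W] the determinant, as well as on [A^{r,s}], where
    [W] is nonzero exactly on it. *)
Definition frac_fun (f : X -> k) : Prop :=
  exists p e, forall x, dom x -> f x = p.@[pt x] / W.@[pt x] ^+ e.

Lemma frac_fun_poly p : frac_fun (fun x => p.@[pt x]).
Proof. by exists p, 0%N => x _; rewrite expr0 divr1. Qed.

Lemma frac_fun_eq f f' : (forall x, dom x -> f x = f' x) -> frac_fun f -> frac_fun f'.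
Proof. by move=> ef [p [e h]]; exists p, e => x dx; rewrite -ef ?h. Qed.

Lemma frac_funC c : frac_fun (fun=> c).
Proof. by apply: frac_fun_eq (frac_fun_poly c%:MP) => x _; rewrite mevalC. Qed.

Lemma frac_funM f f' : frac_fun f -> frac_fun f' -> frac_fun (fun x => f x * f' x).
Proof.
move=> [p [e h]] [p' [e' h']]; exists (p * p'), (e + e')%N => x dx.
by rewrite h // h' // mevalM mulf_divX.
Qed.

Lemma frac_funD f f' : frac_fun f -> frac_fun f' -> frac_fun (fun x => f x + f' x).
Proof.
move=> [p [e h]] [p' [e' h']]; exists (p * W ^+ e' + p' * W ^+ e), (e + e')%N => x dx.
by rewrite h // h' // mevalD !mevalM !rmorphXn addf_divX // W0.
Qed.

Lemma frac_funX f n : frac_fun f -> frac_fun (fun x => f x ^+ n).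
Proof.
move=> hf; elim: n => [|n IH]; first by apply: frac_fun_eq (frac_funC 1).
by apply: frac_fun_eq (frac_funM hf IH) => x _; rewrite exprS.
Qed.

Lemma frac_fun_mpoly l (f : 'I_l -> X -> k) (F : {mpoly k[l]}) :
  (forall i, frac_fun (f i)) -> frac_fun (fun x => F.@[fun i => f i x]).
Proof.
move=> hf; elim/mpoly_alg_ind: F => [c|i|F F' h h'|F F' h h'].
- by apply: frac_fun_eq (frac_funC c) => x _; rewrite mevalC.
- by apply: frac_fun_eq (hf i) => x _; rewrite mevalXU.
- by apply: frac_fun_eq (frac_funD h h') => x _; rewrite mevalD.
- by apply: frac_fun_eq (frac_funM h h') => x _; rewrite mevalM.
Qed.
End FractionClass.

Definition det_mpoly (k : fieldType) N : {mpoly k[N * N]} :=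
  \det (\matrix_(i < N, j < N) 'X_(mxvec_index i j)).

Lemma det_mpolyE (k : fieldType) N (g : 'M[k]_N) :
  (det_mpoly k N).@[fun i => mxvec g ord0 i] = \det g.
Proof.
rewrite -det_map_mx; congr (\det _); apply/matrixP => i j.
by rewrite !mxE /= mevalXU mxvecE.
Qed.

Lemma sum_mxvec (R : nmodType) n (F : 'I_(n * n) -> R) :
  \sum_i F i = \sum_i \sum_j F (mxvec_index i j).
Proof.
rewrite pair_bigA /= (reindex _ (curry_mxvec_bij _ _)) /=.
by apply: eq_bigr => -[i j].
Qed.

Lemma vanish_generic (k : closedFieldType) h (Q p : {mpoly k[h]}) : Q != 0 ->
  (forall x, Q.@[x] != 0 -> p.@[x] = 0) -> p = 0.
Proof.
move=> Q0 hp; apply/eqP/negPn/negP => p0.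
have [v] := mpoly_nonvanishing (mulf_neq0 p0 Q0).
by rewrite mevalM mulf_eq0 negb_or => /andP[/negP hv /hp] /eqP.
Qed.

(** Clearing denominators produces one numerator [p] for both sides, and [p] is zero as soon as it
    vanishes off [Q]. *)
Lemma generic_point (k : closedFieldType) h l (Q : {mpoly k[h]}) (P : 'I_l -> {mpoly k[h]})
    (F : {mpoly k[l]}) : Q != 0 ->
  mmap (kapF k h) (phiF Q P) F = 0 <-> forall x, Q.@[x] != 0 -> F.@[phx Q P x] = 0.
Proof.
move=> Q0.
have QF : tofrac Q != 0 by rewrite tofrac_eq0.
have [p [e [eE ex]]] : exists p e,
    mmap (kapF k h) (phiF Q P) F = tofrac p / tofrac Q ^+ e /\
    forall x, Q.@[x] != 0 -> F.@[phx Q P x] = p.@[x] / Q.@[x] ^+ e.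
  elim/mpoly_alg_ind: F => [c|i|F1 F2 [p1 [e1 [E1 h1]]] [p2 [e2 [E2 h2]]]|
      F1 F2 [p1 [e1 [E1 h1]]] [p2 [e2 [E2 h2]]]].
  - exists c%:MP, 0%N; rewrite mmapC expr0 divr1; split=> // x _.
    by rewrite !mevalC expr0 divr1.
  - exists (P i), 1%N; rewrite mmapXU expr1; split=> // x _.
    by rewrite mevalXU expr1.
  - exists (p1 * Q ^+ e2 + p2 * Q ^+ e1), (e1 + e2)%N; split=> [|x qx].
      rewrite rmorphD /= E1 E2 rmorphD !rmorphM !rmorphXn.
      exact: addf_divX.
    rewrite mevalD h1 // h2 // mevalD !mevalM !rmorphXn.
    exact: addf_divX.
  - exists (p1 * p2), (e1 + e2)%N; split=> [|x qx].
      by rewrite rmorphM /= E1 E2 rmorphM; apply: mulf_divX.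
    by rewrite mevalM h1 // h2 // mevalM mulf_divX.
rewrite eE; split=> [/eqP|hx].
  rewrite mulf_eq0 invr_eq0 expf_eq0 (negPf QF) andbF orbF tofrac_eq0 => /eqP p0 x qx.
  by rewrite ex // p0 meval0 mul0r.
suff -> : p = 0 by rewrite rmorph0 mul0r.
apply: (vanish_generic Q0) => x qx; have /eqP := hx x qx.
rewrite ex // mulf_eq0 invr_eq0 expf_eq0 (negPf qx) andbF orbF.
by move/eqP.
Qed.

Lemma lin_lin (k : closedFieldType) n l j (B : 'I_j -> 'I_n -> k) (C : 'I_n -> 'I_l -> k)
    (S : comNzRingType) (g : {rmorphism k -> S}) z :
  lin B g (lin C g z) =1 lin (fun i c => \sum_t B i t * C t c) g z.
Proof.
move=> i; rewrite /lin; under eq_bigr do rewrite mulr_sumr.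
rewrite exchange_big; apply: eq_bigr => c _.
rewrite rmorph_sum mulr_suml; apply: eq_bigr => t _.
by rewrite rmorphM mulrA.
Qed.

(** The values at [z] of the homogeneous components are the coefficients of [f (t z)] as a
    polynomial in [t]; having every nonzero [t] as a root, it is zero. *)
Lemma conic_components (k : closedFieldType) j (z : 'I_j -> k) (f : {mpoly k[j]}) :
  (forall t, t != 0 -> f.@[fun i => t * z i] = 0) ->
  forall d, (pihomog mdeg d f).@[z] = 0.
Proof.
move=> hf; pose p : {poly k} := \poly_(d < msize f) (pihomog mdeg d f).@[z].
have pE t : p.[t] = f.@[fun i => t * z i].
  rewrite horner_poly [in RHS](pihomog_partitionE (mf := mdeg) (leqnn (msize f))).
  rewrite rmorph_sum; apply: eq_bigr => d _ /=.
  by rewrite (meval_homog _ _ (pihomogP _ _ _)) mulrC.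
have p0 : p = 0.
  apply/eqP/negPn/negP => p0; have X0 : p * 'X != 0 by rewrite mulf_neq0 ?polyX_eq0.
  have /closed_nonrootP [t] := X0.
  by rewrite rootM negb_or rootX rootE pE => /andP[/eqP nz /hf].
move=> d; case: (ltnP d (msize f)) => lt.
  by have := congr1 (fun q : {poly k} => q`_d) p0; rewrite coef_poly lt coef0.
suff -> : pihomog mdeg d f = 0 by rewrite meval0.
rewrite pihomogE big_seq_cond big_pred0 // => m.
apply/negP => /andP[mf /eqP e]; have := msize_mdeg_lt mf.
by rewrite ltnNge (leq_trans lt) // e.
Qed.

Section Geometry.
Variables (k : closedFieldType) (N n r s : nat).
Variables (G : 'M[k]_N -> Prop) (rho : 'M[k]_N -> 'M[k]_n).
Variable iota : 'rV[k]_(r + s) -> 'M[k]_N.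
Hypotheses (hG : lin_alg_group G) (hrho : rational_rep G rho).
Hypotheses (hi : morphism_Ars G iota) (hdom : dominant G iota).

Definition mpt (g : 'M[k]_N) (i : 'I_(N * N)) : k := mxvec g ord0 i.
Definition vpt m (x : 'rV[k]_m) (i : 'I_m) : k := x ord0 i.
Definition rpt (g : 'M[k]_N) (i : 'I_(n * n)) : k := mxvec (rho g) ord0 i.

Lemma group_det g : G g -> \det g != 0.
Proof. by have [[C [_ hC]] _] := hG; move/hC => []. Qed.

Lemma regular_frac f : regular_on G f <-> frac_fun mpt G (det_mpoly k N) f.
Proof.
by split=> -[p [e h]]; exists p, e => g gG; rewrite h // det_mpolyE.
Qed.

Lemma det_mpoly_group g : G g -> (det_mpoly k N).@[mpt g] != 0.
Proof. by move=> gG; rewrite det_mpolyE group_det. Qed.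

Lemma rpt_frac i : frac_fun mpt G (det_mpoly k N) (fun g => rpt g i).
Proof.
have [_ [_ hr]] := hrho; case/mxvec_indexP: i => i j.
apply: frac_fun_eq (proj1 (regular_frac _) (hr i j)) => g _.
by rewrite /rpt mxvecE.
Qed.

Lemma regular_dense f : frac_fun mpt G (det_mpoly k N) f ->
  (forall x, Ars x -> f (iota x) = 0) -> forall g, G g -> f g = 0.
Proof.
move=> [p [e hf]] hx g gG; rewrite hf //.
pose C (w : 'rV[k]_(N * N)) := peval p w = 0.
have zC : zclosed C.
  exists (fun q => q = p) => w; split=> [pw q ->|h] //; exact: h.
suff : C (mxvec g) by rewrite /C /peval => ->; rewrite mul0r.
apply: (hdom gG zC) => _ [x [xA ->]].
have := hf (iota x) (hi.1 x xA); rewrite hx // => /esym /eqP.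
rewrite mulf_eq0 invr_eq0 expf_eq0 (negPf (det_mpoly_group (hi.1 x xA))) andbF orbF.
by move/eqP.
Qed.

(** The denominators of [rho (iota x)] are powers of the first [r] coordinates and of the
    determinant. [W] combines both; it is nonzero exactly on [A^{r,s}], since [iota] takes
    invertible values there. *)
Lemma parametrization : exists (Q : {mpoly k[r + s]}) (P : 'I_(n * n) -> {mpoly k[r + s]}),
  (forall x, Ars x <-> Q.@[vpt x] != 0) /\
  (forall x, Ars x -> rpt (iota x) =1 phx Q P (vpt x)).
Proof.
have [hiG [Pi [e0 hPi]]] := hi.
pose q : {mpoly k[r + s]} := \prod_(i < r) 'X_(lshift s i).
have qE x : q.@[vpt x] = \prod_(i < r) x ord0 (lshift s i).
  by rewrite /q rmorph_prod; apply: eq_bigr => i _; rewrite /= mevalXU.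
pose D : {mpoly k[r + s]} := \det (\matrix_(u, v) Pi u v).
have DE x : Ars x -> D.@[vpt x] = \det (iota x) * q.@[vpt x] ^+ (e0 * N).
  move=> xA; rewrite /D -det_map_mx.
  have -> : map_mx (meval (vpt x)) (\matrix_(u, v) Pi u v) = (q.@[vpt x] ^+ e0) *: iota x.
    apply/matrixP => u v; rewrite !mxE hPi // qE mulrCA mulfV ?mulr1 //.
    by rewrite expf_neq0.
  by rewrite detZ -exprM mulrC.
pose W := q * D.
have WA x : Ars x <-> W.@[vpt x] != 0.
  rewrite /W mevalM mulf_eq0 negb_or qE; split=> [xA|/andP[]//].
  have q0 : \prod_(i < r) x ord0 (lshift s i) != 0 by [].
  rewrite q0 DE // mulf_neq0 ?group_det //; first exact: hiG.
  by rewrite expf_neq0 // qE.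
have W0 x : Ars x -> W.@[vpt x] != 0 by move/WA.
have qinv : frac_fun (@vpt _) (@Ars k r s) W (fun x => (q.@[vpt x])^-1).
  exists D, 1%N => x xA; rewrite expr1 /W mevalM.
  have := W0 x xA; rewrite /W mevalM mulf_eq0 negb_or => /andP[q0 D0].
  by rewrite invfM mulrCA mulfV // mulr1.
have dinv : frac_fun (@vpt _) (@Ars k r s) W (fun x => (\det (iota x))^-1).
  exists (q ^+ (e0 * N).+1), 1%N => x xA; rewrite expr1 /W mevalM DE // rmorphXn /= exprS.
  have q0 : q.@[vpt x] != 0 by rewrite qE.
  by rewrite [\det _ * _]mulrC mulrA invfM mulrA mulfV ?mul1r // mulf_neq0 // expf_neq0.
have iotaF i : frac_fun (@vpt _) (@Ars k r s) W (fun x => mpt (iota x) i).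
  case/mxvec_indexP: i => u v.
  apply: frac_fun_eq (frac_funM (frac_fun_poly _ _ W (Pi u v)) (frac_funX e0 qinv)) => x xA.
  by rewrite /mpt mxvecE hPi // exprVn qE.
have rF i : frac_fun (@vpt _) (@Ars k r s) W (fun x => rpt (iota x) i).
  have [p [e hp]] := rpt_frac i.
  apply: frac_fun_eq (frac_funM (frac_fun_mpoly W0 p iotaF) (frac_funX e dinv)) => x xA.
  have eD : (det_mpoly k N).@[mpt (iota x)] = \det (iota x) by apply: det_mpolyE.
  by rewrite hp; [rewrite eD exprVn|exact: hiG].
have [pe hpe] := fin_choice (fun i => (let: ex_intro p (ex_intro e h) := rF i in
  ex_intro (fun pe : {mpoly k[r + s]} * nat =>
    forall x, Ars x -> rpt (iota x) i = pe.1.@[vpt x] / W.@[vpt x] ^+ pe.2) (p, e) h)).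
(* One exponent for all entries, kept positive so that [W ^+ M] vanishes wherever [W] does. *)
pose M := (\sum_i (pe i).2).+1.
have le i : ((pe i).2 <= M)%N by rewrite /M (bigD1 i) //= leqW // leq_addr.
exists (W ^+ M), (fun i => (pe i).1 * W ^+ (M - (pe i).2)); split=> [x|x xA i].
  by rewrite rmorphXn /= expf_eq0 /=; apply: WA.
rewrite hpe // /phx; move: (W) (W0 x xA) => W' w0.
rewrite mevalM !rmorphXn /=.
have wX a : W'.@[vpt x] ^+ a != 0 by rewrite expf_neq0.
by apply/eqP; rewrite eqr_div // -mulrA -exprD subnK.
Qed.

Section Generic.
Variables (Q : {mpoly k[r + s]}) (P : 'I_(n * n) -> {mpoly k[r + s]}).
Hypothesis QA : forall x : 'rV[k]_(r + s), Ars x <-> Q.@[vpt x] != 0.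
Hypothesis PA : forall x, Ars x -> rpt (iota x) =1 phx Q P (vpt x).

Lemma Ars_row (v : 'I_(r + s) -> k) : Q.@[v] != 0 <-> Ars (\row_i v i).
Proof.
by rewrite QA (meval_eq (v1 := vpt (\row_i v i)) (v2 := v)) // => i; rewrite /vpt mxE.
Qed.

Lemma phx_row (v : 'I_(r + s) -> k) : Q.@[v] != 0 ->
  phx Q P v =1 rpt (iota (\row_i v i)).
Proof.
move=> qv i; rewrite PA; last exact/Ars_row.
by rewrite /phx; congr (_ / _); apply: meval_eq => j; rewrite /vpt mxE.
Qed.

Lemma Q_neq0 : Q != 0.
Proof.
have : Ars (const_mx 1 : 'rV[k]_(r + s)).
  by rewrite /Ars big1 ?oner_neq0 // => i _; rewrite mxE.
by move/QA; apply: contraNneq => ->; rewrite meval0.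
Qed.

(** Dominance of [iota] in algebraic form: [phiF Q P] is a generic point of the image of [rho]. *)
Lemma vanish_group (F : {mpoly k[n * n]}) :
  mmap (kapF k (r + s)) (phiF Q P) F = 0 <-> forall g, G g -> F.@[rpt g] = 0.
Proof.
rewrite (generic_point P F Q_neq0); split=> [hx|hg v qv].
  apply: (regular_dense (frac_fun_mpoly det_mpoly_group F rpt_frac)) => x xA.
  by rewrite (meval_eq _ (PA xA)); apply: hx; apply/QA.
rewrite (meval_eq _ (phx_row qv)); apply: hg; apply: hi.1; exact/Ars_row.
Qed.

Lemma vanish_linear j (C : 'I_j -> 'I_(n * n) -> k) (f : {mpoly k[j]}) :
  mmap (kapF k (r + s)) (lin C (kapF k (r + s)) (phiF Q P)) f = 0 <->
  forall g, G g -> f.@[lin C idfun (rpt g)] = 0.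
Proof.
rewrite -linear_pullbackE vanish_group; split=> h g gG.
  by rewrite -[LHS]linear_pullbackE; apply: h.
by rewrite [LHS]linear_pullbackE; apply: h.
Qed.
End Generic.
End Geometry.

(** * Dimension, degree and Taylor expansion *)

Lemma zclosed_zeros (k : fieldType) m (p : {mpoly k[m]}) : zclosed (fun x => peval p x = 0).
Proof. by exists (fun q => q = p) => x; split=> [px q ->|h] //; apply: h. Qed.

(* [T i] vanishes on [Z i] but not on [Z i.+1]. *)
Lemma chain_independent (k : closedFieldType) m (Y : 'rV[k]_m -> Prop) dm Z :
  irr_chain Y dm Z -> exists T : 'I_dm -> {mpoly k[m]}, forall F : {mpoly k[dm]},
    (forall y, Y y -> F.@[fun i => (T i).@[vpt y]] = 0) -> F = 0.
Proof.
move=> [hZ hS].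
have /fin_choice [T hT] : forall i : nat, exists t : {mpoly k[m]}, (i < dm)%N ->
    (forall x, Z i x -> t.@[vpt x] = 0) /\ exists x, Z i.+1 x /\ t.@[vpt x] != 0.
  move=> i; case: (ltnP i dm) => lt; last by exists 0.
  have [[C [[Pc hC] ZC]] _] := hZ i (ltnW lt).
  have [_ [x [Zx nZx]]] := hS i lt.
  have Yx : Y x by have [[C' [_ ZC']] _] := hZ i.+1 lt; have [] := proj1 (ZC' x) Zx.
  have [t [tP tx]] : exists t, Pc t /\ peval t x <> 0.
    apply: NNPP => no; apply: nZx; apply/ZC; split=> //; apply/hC => t tP.
    by apply: NNPP => h; apply: no; exists t.
  exists t => _; split; last by exists x; split=> //; apply/eqP.
  by move=> z Zz; have [_ /hC] := proj1 (ZC z) Zz; apply.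
(* For a relation on [Z i.+1], restriction to [Z i] kills the part free of [T i] by induction;
   irreducibility of [Z i.+1] then allows [T i] to be cancelled. *)
have key i : (i <= dm)%N -> forall F : {mpoly k[i]},
    (forall x, Z i x -> F.@[fun j : 'I_i => (T j).@[vpt x]] = 0) -> F = 0.
  elim: i => [|i IH] le F hF.
    have [_ [[x Zx] _]] := hZ 0%N le; have := hF x Zx.
    by rewrite (nvar0_mpolyC F) mevalC => ->; rewrite mpolyC0.
  have [Ti0 [x0 [Zx0 Tx0]]] := hT i le.
  have ZS x : Z i x -> Z i.+1 x by have [h _] := hS i le; apply: h.
  pose val_at x (p : {poly {mpoly k[i]}}) :=
    evp (meval (fun j : 'I_i => (T j).@[vpt x])) (T i).@[vpt x] p.
  suff step p : (forall x, Z i.+1 x -> val_at x p = 0) -> p = 0.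
    have : muni F = 0.
      apply: step => x /hF <-; rewrite /val_at [in RHS]/meval -muni_eval.
      by apply: eq_evp => c; apply: eq_mmap.
    by move=> e; apply: (@muni_inj i k); rewrite e muni0.
  elim/poly_ind: p => [//|p c IHp] hp.
  have c0 : c = 0.
    apply: (IH (ltnW le)) => x Zx; have := hp x (ZS x Zx).
    by rewrite /val_at rmorphD rmorphM /= evpX evpC Ti0 // mulr0 add0r.
  move: hp; rewrite c0 addr0 => hp; rewrite (_ : p = 0) ?mul0r //.
  apply: IHp.
  pose R := evp (mmap (@mpolyC m k) (fun j : 'I_i => T j)) (T i) p.
  have RE x : peval R x = val_at x p.
    rewrite /peval /R (rmorph_evp (meval (fun j => x ord0 j))) /=.
    apply: eq_evp => b; rewrite /= (rmorph_mmap (meval (fun j => x ord0 j)) (@mpolyC m k)).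
    by apply: eq_mmap => // a; rewrite /= mevalC.
  have [_ [_ irr]] := hZ i.+1 le.
  case: (irr _ _ (zclosed_zeros R) (zclosed_zeros (T i))) => [x Zx|h|h].
  - have /eqP := hp x Zx; rewrite /val_at rmorphM /= evpX mulf_eq0.
    by rewrite -/(val_at x p) -RE => /orP[/eqP|/eqP]; [left|right].
  - by move=> x Zx; rewrite -RE; apply: h.
  - by have := h x0 Zx0 => e; rewrite -[_.@[_]]/(peval (T i) x0) e eqxx in Tx0.
exists T => F hF; apply: (key dm) => // x Zx; apply: hF.
by have [[C [_ ZC]] _] := hZ dm (leqnn _); have [] := proj1 (ZC x) Zx.
Qed.

Lemma param_vpt (k : closedFieldType) dm l (par : 'rV[k]_(dm * l + dm)) :
  param (fun r j => (vec_mx (lsubmx par) : 'M_(dm, l)) r j) (fun r => rsubmx par ord0 r)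
    =1 vpt par.
Proof.
move=> i; rewrite /param /vpt -[in RHS](hsubmxK par) -[in RHS](vec_mxK (lsubmx par)).
by congr (row_mx (mxvec _) _ _ _); apply/matrixP => r j; rewrite !mxE ?ord1.
Qed.

(** A principal open set [hU != 0] is chosen inside [U]; of the exact count, the upper bound on the
    number of points is kept. *)
Lemma generic_count (k : closedFieldType) l (Y : 'rV[k]_l -> Prop) dm d
    (U : 'rV[k]_(dm * l + dm) -> Prop) :
  zopen U -> (exists par, U par) ->
  (forall par, U par ->
      let A : 'M[k]_(dm, l) := vec_mx (lsubmx par) in
      let c : 'rV[k]_dm := rsubmx par in
      \rank A = dm /\
      exists s : seq 'rV[k]_l,
        uniq s /\ size s = d /\
        forall x, (x \in s) <-> (Y x /\ x *m A^T = c)) ->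
  exists (hU : {mpoly k[dm * l + dm]}) (A1 : 'I_dm -> 'I_l -> k) (c1 : 'I_dm -> k),
    hU.@[param A1 c1] != 0 /\
    forall (A : 'I_dm -> 'I_l -> k) (c : 'I_dm -> k) e (y : 'I_e -> 'rV[k]_l),
      hU.@[param A c] != 0 -> (forall i, Y (y i)) ->
      (forall i r, \sum_j A r j * vpt (y i) j = c r) -> injective y -> (e <= d)%N.
Proof.
move=> [Pc hU] [par0 U0] hcount.
have [h [hP h0]] : exists h, Pc h /\ peval h par0 <> 0.
  apply: NNPP => no; have := proj2 (hU par0); apply=> [p pP|//].
  by apply: NNPP => h; apply: no; exists p.
exists h, (fun r j => (vec_mx (lsubmx par0) : 'M_(dm, l)) r j), (fun r => rsubmx par0 ord0 r).
split; first by rewrite (meval_eq _ (param_vpt par0)); apply/eqP.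
move=> A c e y hAc Yy Ay yI.
pose par : 'rV[k]_(dm * l + dm) := row_mx (mxvec (\matrix_(r, j) A r j)) (\row_r c r).
have Upar : U par.
  apply: NNPP => nU; have := proj1 (hU par) nU h hP; apply/eqP; exact: hAc.
have [_ [s [us [ss hs]]]] := hcount par Upar.
rewrite row_mxKl row_mxKr mxvecK in hs.
rewrite -ss -[e]card_ord cardE -(size_map y); apply: uniq_leq_size.
  by rewrite map_inj_uniq ?enum_uniq.
move=> _ /mapP [i _ ->]; apply/hs; split=> //.
apply/rowP => r; rewrite !mxE -[RHS](Ay i); apply: eq_bigr => j _.
by rewrite !mxE mulrC.
Qed.

(** For a monomial [y^m = y_i y^m'], the difference [y^m - a^m] equals
    [a_i (y^m' - a^m') + (y_i - a_i) y^m']; the general case is linear. *)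
Lemma mpoly_taylor (k : fieldType) n (a : 'I_n -> k) D (f : {mpoly k[n]}) :
  (msize f <= D.+1)%N -> exists F : 'I_n -> {mpoly k[n]},
    (forall p, (msize (F p) <= D)%N) /\
    forall y, f.@[y] - f.@[a] = \sum_p (y p - a p) * (F p).@[y].
Proof.
pose TP D (f : {mpoly k[n]}) := exists F : 'I_n -> {mpoly k[n]},
    (forall p, (msize (F p) <= D)%N) /\
    forall y, f.@[y] - f.@[a] = \sum_p (y p - a p) * (F p).@[y].
have TD D' f1 f2 : TP D' f1 -> TP D' f2 -> TP D' (f1 + f2).
  move=> [F1 [s1 h1]] [F2 [s2 h2]]; exists (fun p => F1 p + F2 p); split=> [p|y].
    by apply: leq_trans (msizeD_le _ _) _; rewrite geq_max s1 s2.
  rewrite !mevalD opprD addrACA h1 h2 -big_split; apply: eq_bigr => p _.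
  by rewrite mevalD mulrDr.
have TZ D' c f1 : TP D' f1 -> TP D' (c *: f1).
  move=> [F1 [s1 h1]]; exists (fun p => c *: F1 p); split=> [p|y].
    exact: leq_trans (msizeZ_le _ _) _.
  rewrite !mevalZ -mulrBr h1 mulr_sumr; apply: eq_bigr => p _.
  by rewrite mevalZ mulrCA.
have T0 D' c : TP D' c%:MP.
  exists (fun=> 0); split=> [p|y]; first by rewrite msize0.
  by rewrite !mevalC subrr big1 // => p _; rewrite mulr0.
have TX D' m : (mdeg m <= D')%N -> TP D' 'X_[m].
  elim: D' m => [|D' IH] m.
    by rewrite leqn0 mdeg_eq0 => /eqP ->; rewrite mpolyX0 -mpolyC1.
  case: (eqVneq m 0%MM) => [-> _|m0]; first by rewrite mpolyX0 -mpolyC1.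
  have [i mi] : exists i, (0 < m i)%N.
    apply: NNPP => no; case/eqP: m0; apply/mnmP => i; rewrite mnm0E.
    by apply/eqP; rewrite -leqn0 leqNgt; apply/negP => h; apply: no; exists i.
  have em : m = (U_(i) + (m - U_(i)))%MM by rewrite addmC submK // lep1mP -lt0n.
  rewrite em mdegD mdeg1 add1n ltnS => le.
  have [F1 [s1 h1]] := IH _ le; set m' := (m - U_(i))%MM in em le h1 *.
  exists (fun p => a i *: F1 p + (p == i)%:R *: 'X_[m']); split=> [p|y].
    apply: leq_trans (msizeD_le _ _) _; rewrite geq_max; apply/andP; split.
      by apply: leq_trans (msizeZ_le _ _) _; apply: leqW.
    by apply: leq_trans (msizeZ_le _ _) _; rewrite msizeX ltnS.
  rewrite mpolyXD !mevalM !mevalXU.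
  have -> : \sum_p (y p - a p) * (a i *: F1 p + (p == i)%:R *: 'X_[m']).@[y] =
      a i * (\sum_p (y p - a p) * (F1 p).@[y]) + (y i - a i) * 'X_[m'].@[y].
    rewrite mulr_sumr [in RHS](_ : (y i - a i) * _ =
      \sum_p (y p - a p) * ((p == i)%:R * 'X_[m'].@[y])).
      rewrite -big_split; apply: eq_bigr => p _.
      by rewrite mevalD !mevalZ mulrDr mulrCA.
    rewrite (bigD1 i) //= eqxx mul1r big1 ?addr0 // => p /negPf ->.
    by rewrite mul0r mulr0.
  by rewrite -h1 mulrBr mulrBl [RHS]addrC addrA subrK.
move=> sf; rewrite [f]mpolyE big_seq.
apply: (big_ind (TP D)) => [|f1 f2|m mf]; [by rewrite -mpolyC0|exact: TD|].
apply/TZ/TX; rewrite -ltnS; exact: leq_trans (msize_mdeg_lt mf) sf.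
Qed.

Lemma Fpoly_mpoly (k : fieldType) n d (F : 'I_n -> {mpoly k[n]}) p y :
  (0 < d)%N -> (msize (F p) <= 2 * d - 1)%N ->
  Fpoly (d := d) (fun p q => (F p)@_[multinom (q i : nat) | i < n]) p y = (F p).@[y].
Proof.
move=> d0; set B := (2 * d - 1)%N => sF.
have B0 : (0 < B)%N by rewrite /B; lia.
have ltm (m : 'X_{1..n < B}) i : (m i < B)%N.
  by apply: leq_ltn_trans (bmdeg m); rewrite mdegE (bigD1 i) //= leq_addr.
pose f (m : 'X_{1..n < B}) : {ffun 'I_n -> 'I_B} := [ffun i => Ordinal (ltm m i)].
have z0 : (mdeg (0%MM : 'X_{1..n}) < B)%N by rewrite mdeg0.
(* The default monomial is taken only when the degree is at least [B], outside the range of the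
   sum. *)
pose g (q : {ffun 'I_n -> 'I_B}) : 'X_{1..n < B} :=
  insubd (BMultinom z0) [multinom (q i : nat) | i < n].
rewrite /meval (mmapE _ sF) /Fpoly (reindex_onto f g) => [|q hq]; last first.
  apply/ffunP => i; apply/val_inj; rewrite ffunE /= /g val_insubd.
  rewrite mdegE (eq_bigr (fun i => q i : nat)) => [|i' _]; last by rewrite mnmE.
  rewrite ifT ?mnmE //; apply: leq_ltn_trans hq _.
  by move: d0; rewrite /B; clear; lia.
have fE m : [multinom (f m i : nat) | i < n] = m :> 'X_{1..n}.
  by apply/mnmP => i; rewrite mnmE ffunE.
apply: eq_big => m.
  have -> : (\sum_i (f m i : nat))%N = mdeg m.
    by rewrite mdegE; apply: eq_bigr => i _; rewrite ffunE.
  have := bmdeg m; rewrite /B => lt.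
  have -> : (mdeg m <= 2 * d - 2)%N by move: (mdeg _) lt d0 => x; clear; lia.
  by apply/eqP/val_inj; rewrite /= /g val_insubd fE bmdeg.
move=> _; rewrite fE; congr (_ * _).
by apply: eq_bigr => i _; rewrite ffunE.
Qed.

(** * Separating equations of the orbit *)

Section Orbit.
Variables (k : closedFieldType) (N n r s : nat).
Variables (G : 'M[k]_N -> Prop) (rho : 'M[k]_N -> 'M[k]_n).
Variables (iota : 'rV[k]_(r + s) -> 'M[k]_N) (b : 'rV[k]_n).
Hypotheses (hG : lin_alg_group G) (hrho : rational_rep G rho).

(** The coordinates of [act rho g b] as linear forms in the entries of [rho g]: form [i] has
    coefficient [b_j] at the entry [(i, j)]. *)
Definition orbit_form (i : 'I_n) (c : 'I_(n * n)) : k :=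
  mxvec (\matrix_(i' < n, j < n) ((i' == i)%:R * b ord0 j)) ord0 c.

Lemma orbit_formE g : lin orbit_form idfun (rpt rho g) =1 vpt (act rho g b).
Proof.
move=> i; rewrite /lin /vpt mxE sum_mxvec (bigD1 i) //= [X in _ + X]big1 ?addr0.
  by apply: eq_bigr => j _; rewrite /orbit_form /rpt !mxvecE mxE eqxx mul1r mulrC.
move=> i' ne; rewrite big1 // => j _.
by rewrite /orbit_form mxvecE mxE (negPf ne) !mul0r.
Qed.

Lemma act1 v : act rho 1%:M v = v.
Proof.
apply/rowP => i; rewrite mxE hrho.1 (bigD1 i) //= mxE eqxx mul1r big1 ?addr0 // => j ne.
by rewrite mxE eq_sym (negPf ne) mul0r.
Qed.

Lemma actM g g' v : G g -> G g' -> act rho (g *m g') v = act rho g (act rho g' v).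
Proof.
move=> gG g'G; apply/rowP => i; rewrite !mxE hrho.2.1 //.
under [RHS]eq_bigr do rewrite mxE mulr_sumr.
rewrite exchange_big; apply: eq_bigr => j _.
by rewrite mxE mulr_suml; apply: eq_bigr => j' _; rewrite mulrA.
Qed.

(** The action of [g] is linear, so the preimage of a closed set containing the orbit of [b] is
    closed and again contains it. *)
Lemma orbit_closure_stable a w : zclosure (gorbit G rho b) a -> gorbit G rho a w ->
  zclosure (gorbit G rho b) w.
Proof.
move=> ha [g [gG ->]] C [Pc hC] hb.
pose C' v := C (act rho g v).
have zC' : zclosed C'.
  pose sub (p : {mpoly k[n]}) : {mpoly k[n]} := linear_pullback (fun i j => rho g i j) p.
  have subE p v : peval (sub p) v = peval p (act rho g v).
    rewrite /peval /meval linear_pullbackE; apply: eq_mmap => // i.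
    by rewrite /lin mxE.
  exists (fun q => exists p, Pc p /\ q = sub p) => v; split.
    by move=> /hC h q [p [pP ->]]; rewrite subE; apply: h.
  by move=> h; apply/hC => p pP; rewrite -subE; apply: h; exists p.
apply: (ha C' zC') => _ [g' [g'G ->]]; rewrite /C' -actM //; apply: hb.
by exists (g *m g'); split=> //; apply: hG.2.2.1.
Qed.

Hypotheses (hi : morphism_Ars G iota) (hdom : dominant G iota).
Hypothesis hconic : conic (gorbit G rho b).

Section Generic.
Variables (Q : {mpoly k[r + s]}) (P : 'I_(n * n) -> {mpoly k[r + s]}).
Hypothesis QA : forall x : 'rV[k]_(r + s), Ars x <-> Q.@[vpt x] != 0.
Hypothesis PA : forall x, Ars x -> rpt rho (iota x) =1 phx Q P (vpt x).
Local Notation kap := (kapF k (r + s)).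
Local Notation phi := (phiF Q P).
Local Notation psi := (lin orbit_form kap phi).

Lemma vanish_orbit j (B : 'I_j -> 'I_n -> k) (f : {mpoly k[j]}) :
  mmap kap (lin B kap psi) f = 0 <->
  forall g, G g -> f.@[lin B idfun (vpt (act rho g b))] = 0.
Proof.
have e g : lin (fun i c => \sum_t B i t * orbit_form t c) idfun (rpt rho g) =1
    lin B idfun (vpt (act rho g b)).
  move=> i; rewrite -(lin_lin B orbit_form idfun); apply: eq_bigr => c _.
  by rewrite orbit_formE.
rewrite (eq_mmap f (fun=> erefl) (lin_lin B orbit_form kap phi)).
rewrite (vanish_linear hG hrho hi hdom QA PA).
by split=> h g gG; have := h g gG; rewrite (meval_eq _ (e g)).
Qed.

Lemma orbit_homog_stable j (B : 'I_j -> 'I_n -> k) : homog_stable kap (lin B kap psi).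
Proof.
move=> f d /vanish_orbit hf; apply/vanish_orbit => g gG.
apply: conic_components => t t0.
have [|g' [g'G eg]] := hconic t0 (v := act rho g b); first by exists g.
rewrite -[RHS](hf g' g'G) -eg; apply: meval_eq => i.
move: (act rho g b) => v.
by rewrite /lin /= mulr_sumr; apply: eq_bigr => c _; rewrite /vpt mxE mulrCA.
Qed.

Lemma separating_equation d a : zdeg (rep_image G rho) d ->
  ~ zclosure (gorbit G rho b) a ->
  exists f : {mpoly k[n]}, [/\ forall g, G g -> f.@[vpt (act rho g b)] = 0,
    f.@[vpt a] != 0 & (msize f <= d.+1)%N].
Proof.
move=> [dm [[[Z hZ] _] [U [zU [exU hUc]]]]] hna.
have [p [pb pa]] : exists p : {mpoly k[n]},
    (forall g, G g -> p.@[vpt (act rho g b)] = 0) /\ p.@[vpt a] != 0.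
  apply: NNPP => no; apply: hna => C [Pc hC] hb; apply/hC => p pP.
  apply: NNPP => pa; apply: no; exists p; split=> [g gG|]; last exact/eqP.
  by have /hC := hb _ (ex_intro _ g (conj gG erefl)); apply.
have vb (f : {mpoly k[n]}) :
    mmap kap psi f = 0 <-> forall g, G g -> f.@[vpt (act rho g b)] = 0.
  rewrite -(eq_mmap f (fun=> erefl) (lin_id kap psi)) vanish_orbit.
  by split=> h g gG; have := h g gG; rewrite (meval_eq _ (lin_id idfun _)).
have pz : mmap kap psi p = 0 by apply/vb.
have [m [L [L0 [N' [e]]]]] := normal_form orbit_homog_stable pz pa.
move=> [[sN lN Ny N'0] indL Ndvd [f [fz fa sf]]].
exists f; split=> //; first exact/vb.
apply: leq_trans sf _; rewrite ltnS.
have [hU [A1 [c1 [hU1 count]]]] := generic_count zU exU hUc.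
have [T hT] := chain_independent hZ.
have Q0 := Q_neq0 QA.
(* Linear forms on the orbit become linear forms in the matrix entries, where the degree of the
   image of [rho] bounds sections. *)
pose L' i c := \sum_t L i t * orbit_form t c.
pose L0' c := \sum_t L0 t * orbit_form t c.
have eL : lin L kap psi =1 lin L' kap phi by apply: lin_lin.
have eL0 : \sum_c kap (L0 c) * psi c = \sum_c kap (L0' c) * phi c.
  exact: (lin_lin (fun _ : 'I_1 => L0) orbit_form kap phi ord0).
have eev c : mmap kap (lin L kap psi) c = mmap kap (lin L' kap phi) c.
  exact: eq_mmap.
have eevp F : evp (mmap kap (lin L kap psi)) (\sum_c kap (L0 c) * psi c) F =
    evp (mmap kap (lin L' kap phi)) (\sum_c kap (L0' c) * phi c) F.
  by rewrite eL0; apply: eq_evp.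
refine (@degree_bound k _ _ dm d Q P Q0 hU _ A1 c1 hU1 T _ _ _ L' L0' N' sN lN _ N'0 _ _).
- move=> A c e' pts hAc Qp Ap pI.
  pose y i : 'rV[k]_(n * n) := mxvec (rho (iota (\row_j pts i j))).
  have yE i : vpt (y i) =1 phx Q P (pts i).
    by move=> j; rewrite (phx_row QA PA (Qp i)).
  apply: (count A c e' y) => //.
  + move=> i; exists (iota (\row_j pts i j)); split=> //.
    by apply: hi.1; apply/(Ars_row QA).
  + by move=> i r'; rewrite -[RHS](Ap i); apply: eq_bigr => j _; rewrite yE.
  + by move=> i i' ey; apply: pI => j; rewrite -!yE ey.
- move=> F Fz; apply: hT => _ [g [gG ->]].
  pose FT := mmap (@mpolyC (n * n) k) T F.
  have FTE (S : comNzRingType) (f' : {rmorphism k -> S}) z :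
      mmap f' z FT = mmap f' (fun i => mmap f' z (T i)) F.
    rewrite /FT (rmorph_mmap (mmap f' z) (@mpolyC (n * n) k)).
    by apply: eq_mmap => // c /=; rewrite mmapC.
  rewrite -[LHS]FTE; apply: (proj1 (vanish_group hG hrho hi hdom QA PA FT)) => //.
  by rewrite FTE.
- by rewrite -[RHS]Ny eevp.
- by move=> q qz; apply: indL; rewrite -[RHS]qz; apply: eq_mmap.
- by move=> F Fz; apply: Ndvd; rewrite eevp.
Qed.
End Generic.
End Orbit.

(** Laurent monomials are linearly independent as functions on [A^{r,s}] over an infinite field.
    Hence [c] solves the linear system exactly when the substituted [H] vanishes at every point of
    [A^{r,s}], and inconsistency is stated in this form. *)
Theorem theorem2 (k : closedFieldType) (N n r s d : nat)
    (G : 'M[k]_N -> Prop) (rho : 'M[k]_N -> 'M[k]_n)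
    (iota : 'rV[k]_(r + s) -> 'M[k]_N) (a b : 'rV[k]_n) :
  lin_alg_group G -> connected_grp G ->
  rational_rep G rho -> (1 < n)%N ->
  zdeg (rep_image G rho) d ->
  morphism_Ars G iota -> dominant G iota ->
  (forall j, b ord0 j != 0) ->
  (exists dm, zdim (gorbit G rho b) dm /\ (dm < n)%N) ->
  (exists v, gorbit G rho b v /\ v != 0) ->
  conic (gorbit G rho b) ->
  ((forall w, gorbit G rho a w -> zclosure (gorbit G rho b) w) <->
   ~ (exists c : 'I_n -> {ffun 'I_n -> 'I_(2 * d - 1)} -> k,
        forall x, Ars x ->
          Hpoly c a (fun i => \sum_j b ord0 j * rho (iota x) i j) = 0)).
Proof.
move=> hG _ hrho _ hdeg hi hdom _ _ _ hconic.
have actE g i : \sum_j b ord0 j * rho g i j = vpt (act rho g b) i.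
  by rewrite /vpt mxE; apply: eq_bigr => j _; rewrite mulrC.
split=> [hcl [c hc]|noc w wa].
  have acl : zclosure (gorbit G rho b) a.
    by apply: hcl; exists 1%:M; split; [exact: hG.2.1|rewrite (act1 hrho)].
  pose F p : {mpoly k[n]} := \sum_(q : {ffun 'I_n -> 'I_(2 * d - 1)} |
    (\sum_i (q i : nat) <= 2 * d - 2)%N) (c p q)%:MP * \prod_i 'X_i ^+ q i.
  pose H : {mpoly k[n]} := \sum_p ('X_p - (a ord0 p)%:MP) * F p - 1.
  have HE y : H.@[y] = Hpoly c a y.
    rewrite /H /Hpoly mevalB meval1 rmorph_sum; congr (_ - 1); apply: eq_bigr => p _.
    rewrite rmorphM rmorphB /= mevalXU mevalC; congr (_ * _).
    rewrite /F /Fpoly rmorph_sum; apply: eq_bigr => q _.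
    rewrite rmorphM rmorph_prod /= mevalC; congr (_ * _).
    by apply: eq_bigr => i _; rewrite rmorphXn /= mevalXU.
  have Hreg : frac_fun (@mpt k N) G (det_mpoly k N) (fun g => H.@[vpt (act rho g b)]).
    apply: (frac_fun_mpoly (det_mpoly_group hG)) => i.
    have := frac_fun_mpoly (det_mpoly_group hG)
      (linear_pullback (orbit_form b) 'X_i) (rpt_frac hrho).
    apply: frac_fun_eq => g _.
    by rewrite [LHS]linear_pullbackE mmapXU orbit_formE.
  have Hb g : G g -> H.@[vpt (act rho g b)] = 0.
    apply: (regular_dense hG hi hdom Hreg) => x xA.
    by rewrite -[RHS](hc x xA) HE; congr Hpoly; apply: functional_extensionality => i;
      rewrite actE.
  have : peval H a = 0.
    by apply: (acl _ (zclosed_zeros H)) => _ [g [gG ->]]; apply: Hb.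
  rewrite /peval -/(vpt a) HE /Hpoly big1 ?add0r => [/eqP|p _].
    by rewrite oppr_eq0 oner_eq0.
  by rewrite /vpt subrr mul0r.
apply: (orbit_closure_stable hG hrho) wa.
apply: NNPP => na; apply: noc.
have [Q [P [QA PA]]] := parametrization hG hrho hi.
have [f [fb fa sf]] := separating_equation hG hrho hi hdom hconic QA PA hdeg na.
have [F [sF hF]] := mpoly_taylor (vpt a) sf.
(* For [d = 0] the equation [f] would be constant, yet zero at [b] and nonzero at [a]. *)
have d0 : (0 < d)%N.
  rewrite lt0n; apply/eqP => e; rewrite e in sf.
  have ef := msize1_polyC sf; have := fb 1%:M hG.2.1.
  by move: fa; rewrite ef !mevalC => /negPf fa /eqP; rewrite fa.
pose F' p := - (f.@[vpt a])^-1 *: F p.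
(* The Taylor factors have degree at most [d - 1], which is at most [2 * d - 2] because [d] is
   positive. *)
have sF' p : (msize (F' p) <= 2 * d - 1)%N.
  apply: leq_trans (msizeZ_le _ _) _; apply: leq_trans (sF p) _.
  by move: d0; clear; lia.
exists (fun p (q : {ffun 'I_n -> 'I_(2 * d - 1)}) => (F' p)@_[multinom (q i : nat) | i < n]) => x xA.
rewrite /Hpoly; apply/eqP; rewrite subr_eq0; apply/eqP.
have fx : f.@[vpt (act rho (iota x) b)] = 0 by apply: fb; apply: hi.1.
have := hF (vpt (act rho (iota x) b)); rewrite fx add0r => ef.
rewrite -[RHS](mulfV fa) mulrC -[X in _ = _ * X]opprK ef mulrN -mulNr mulr_sumr.
apply: eq_bigr => p _; rewrite Fpoly_mpoly // actE /F' mevalZ.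
rewrite mulrCA; congr (_ * (_ * _)); apply: meval_eq => i; exact: actE.
Qed.
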